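(* Let $n\ge1$, let $A=(a_{ij})_{1\le i<j\le 2n}$ be an upper-triangular array (representing a skew-symmetric $2n\times2n$ matrix) such that $a_{ij}=0$ if $1\le i<j\le n$ or $n+1\le i<j\le 2n$, and let $B=(b_{ij})$ be the $n\times n$ matrix with $b_{ij}=a_{i,j+n}$. Let $D\in\mathcal{T}^e_n$. Then $$\mathrm{Pfaf}_D(A)=\sum_{D'\in S(D)}\ \sum_{d\in\mathrm{TL}_n}\tilde g_{D'}(d)\,\mathrm{Imm}_d(B).$$
   Context: Matchings. $[2n]=\{1,\dots,2n\}$. $F_{2n}$ is the set of perfect matchings $\pi$ of $[2n]$, and $a_\pi=\prod_{(i<j)\in\pi}a_{ij}$. Symmetric TL-diagrams. Place points $1,\dots,2n$ on the left side and $1',\dots,(2n)'$ on the right side of a rectangle, numbered from top to bottom. A TL-diagram is a non-crossing perfect matching of these $4n$ points (drawn inside the rectangle); it is symmetric if invariant under the mirror reflection $i\leftrightarrow i'$. Then every edge is either horizontal, of the form $(i,i')$, or belongs to a mirror pair of vertical edges $\{(i,j),(i',j')\}$. The order $|D|$ is the number of edges with both ends on the left side. $\mathcal{T}_n$ is the set of symmetric TL-diagrams and $\mathcal{T}^e_n$ the subset of those with $|D|$ even. Diagram pfaffinants. For $\pi\in F_{2n}$ let $\nu(\pi)$ be the matching of $[2n]\cup[2n]'$ with edges $(i,j')$ and $(i',j)$ for each $(i,j)\in\pi$. Fix for each $\pi$ a nice embedding of $\nu(\pi)$: all edges lie in the rectangle, every pair of edges meets at most once, the picture is mirror symmetric,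 no two edges are tangent, no three edges pass through one point. An unpaired crossing is a crossing of an edge with its own mirror image; all other crossings come in mirror-symmetric pairs (paired crossings). Each edge joins the left side to the right side, so at a crossing of two edges there are two half-edges leading to left endpoints and two leading to right endpoints. The vertical uncrossing replaces the crossing by one strand joining the two left half-edges and one joining the two right half-edges (picture '')(''); the horizontal uncrossing joins the left half-edge of each edge to the right half-edge of the other edge without crossing. $X(\pi)$ is the set of diagrams obtained by uncrossing every crossing of $\nu(\pi)$ in one of the two ways, the two members of a paired crossing being uncrossed in the same way. Each $x\in X(\pi)$ is mirror symmetric, and is topologically an element $D(x)\in\mathcal{T}_n$ together with some closed loops. Set $\mathrm{wt}(x)=2^{l(x)}(-1)^{\mathrm{uv}(x)+\mathrm{ph}(x)}$, where $l(x)$ is the number of closed loops (a pair of mirror-symmetric loops counted once), $\mathrm{uv}(x)$ the number of unpaired crossings uncrossed vertically, and $\mathrm{ph}(x)$ the number of pairs of paired crossings uncrossed horizontally. Put $f_D(\pi)=\sum_{x\in X(\pi),\,D(x)=D}\mathrm{wt}(x)$ and $\mathrm{Pfaf}'_D(A)=\sum_{\pi\in F_{2n}}f_D(\pi)\,a_\pi$ for $D\in\mathcal{T}_n$. TL-pfaffinants. A vertical left edge $(i,j)$ with $i<j$ is odd if $i$ is odd, even otherwise. For $D\in\mathcal{T}_n$, $S(D)$ is the set of all diagrams in $\mathcal{T}_n$ obtained from $D$ by erasing several (possibly zero) odd edges and their mirror images, and matching the resulting unmatched vertices by horizontal edges $(i,i')$. For $D\in\mathcal{T}^e_n$, $\mathrm{Pfaf}_D(A)=\sum_{D'\in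 S(D)}\mathrm{Pfaf}'_{D'}(A)$. TL-immanants. $\mathrm{TL}_n$ is the set of non-crossing perfect matchings of $2n$ points on the boundary of a rectangle, labeled $1,\dots,n$ from top to bottom on the left side and $n+1,\dots,2n$ from bottom to top on the right side. For $w\in S_n$ choose a wiring diagram of $w$: wires running from left to right, the wire starting at the $i$-th left point (from the top) ending at the $w(i)$-th right point (from the top). $X(w)$ is the set of ways to uncross every crossing vertically or horizontally, where at a crossing of two wires the vertical uncrossing replaces the crossing by one strand joining the two half-wires coming from the left and one strand joining the two half-wires going to the right (picture '')(''), and the horizontal uncrossing joins the left half of each wire to the right half of the other wire without crossing; for $x\in X(w)$, $D(x)\in\mathrm{TL}_n$ is the diagram topologically equivalent to $x$ with loops removed, $h(x)$ is the number of horizontal uncrossings, $l(x)$ the number of loops, and $\mathrm{wt}(x)=2^{l(x)}(-1)^{h(x)}$. For $d\in\mathrm{TL}_n$ put $f_d(w)=\sum_{x\in X(w),\,D(x)=d}\mathrm{wt}(x)$ and $\mathrm{Imm}_d(B)=\sum_{w\in S_n}f_d(w)\,b_{1,w(1)}\cdots b_{n,w(n)}$. The coefficients $\tilde g_D(d)$. For $d\in\mathrm{TL}_n$ define a mirror-symmetric matching $\nu(d)$ of $[2n]\cup[2n]'$: regard the left points of $d$ (labeled $1,\dots,n$) as the vertices $1,\dots,n$, and the right points of $d$ (from top to bottom, originally labeled $2n,2n-1,\dots,n+1$) as the vertices $(n+1)',\dots,(2n)'$; take all edges of $d$ so relabeled together with all their mirror images under $i\leftrightarrow i'$. Choose a mirror-symmetric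 embedding of $\nu(d)$ in the rectangle in which no pair of edges meets more than once or is tangent and no three edges pass through one point. (Crossings then occur only between edges joining the left and right sides.) $X(d)$ is the set of all ways to uncross all crossings of $\nu(d)$, each vertically or horizontally, mirror-symmetric crossings being uncrossed in the same manner. For $x\in X(d)$, the diagram $D(x)\in\mathcal{T}_n$ is the symmetric TL-diagram topologically equivalent to $x$ with closed loops removed, and the weight is $\mathrm{wt}(x)=2^{l(x)}(-1)^{\mathrm{uv}(x)+\mathrm{ph}(x)}$, where $l(x)$ is the number of closed loops of $x$ (a pair of mirror-symmetric loops counted once), $\mathrm{uv}(x)$ is the number of unpaired crossings of $\nu(d)$ (crossings of an edge with its own mirror image) uncrossed vertically, and $\mathrm{ph}(x)$ is the number of pairs of paired (mirror-symmetric) crossings of $\nu(d)$ uncrossed horizontally. For $D\in\mathcal{T}_n$ put $g_D(d)=\sum_{x\in X(d),\,D(x)=D}\mathrm{wt}(x)$, let $z(d)$ be the number of edges of $d$ with both ends in $[n]$, and set $\tilde g_D(d)=(-1)^{z(d)\cdot n}g_D(d)$. *)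

(* Defs.v *)
(* All rows, columns and layers are counted from 0. *)
From mathcomp Require Import all_boot all_order all_fingroup all_algebra.

Set Implicit Arguments.
Unset Strict Implicit.
Unset Printing Implicit Defensive.

Import GRing.Theory.
Local Open Scope ring_scope.

(* A perfect matching is encoded by the fixed-point-free involution sending
   every element to its partner. *)
Definition is_matching (T : finType) (f : {ffun T -> T}) : bool :=
  [forall x, (f x != x) && (f (f x) == x)].

(* [inl i] is the point in row [i] of the left side of the rectangle, [inr i]
   the point in row [i] of its right side; rows go from top to bottom. *)
Definition point (m : nat) : Type := ('I_m + 'I_m)%type.

Definition diagram (m : nat) : Type := {ffun point m -> point m}.

Definition row_of (m : nat) (p : point m) : 'I_m :=
  match p with inl i => i | inr i => i end.

Definition mirror (m : nat) (p : point m) : point m :=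
  match p with inl i => inr i | inr i => inl i end.

(* Labels 1, ..., 2m around the boundary: down the left side, then up the
   right side. *)
Definition label (m : nat) (p : point m) : nat :=
  match p with inl i => i.+1 | inr i => (m + (m - i))%N end.

Definition noncrossing (m : nat) (f : diagram m) : bool :=
  ~~ [exists p, exists q, [&& (label p < label q)%N,
        (label q < label (f p))%N & (label (f p) < label (f q))%N]].

Definition TL (m : nat) : {set diagram m} :=
  [set f : diagram m | is_matching f & noncrossing f].

(* Symmetric TL-diagrams with m points on each side. *)
Definition symTL (m : nat) : {set diagram m} :=
  [set f in TL m | [forall p, f (mirror p) == mirror (f p)]].

Definition left_edges (m : nat) (f : diagram m) : {set 'I_m * 'I_m} :=
  [set e : 'I_m * 'I_m | (f (inl e.1) == inl e.2) & (e.1 < e.2)%N].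

Definition diagram_order (m : nat) (f : diagram m) : nat := #|left_edges f|.

Definition symTL_even (m : nat) : {set diagram m} :=
  [set f in symTL m | ~~ odd (diagram_order f)].

(* [e.1.+1] is the row of the upper end of [e] counted from 1. *)
Definition odd_edges (m : nat) (f : diagram m) : {set 'I_m * 'I_m} :=
  [set e in left_edges f | odd e.1.+1].

(* The edges in [E] and their mirror images are replaced by horizontal ones. *)
Definition erase (m : nat) (f : diagram m) (E : {set 'I_m * 'I_m}) : diagram m :=
  [ffun p => if [exists e in E, (row_of p == e.1) || (row_of p == e.2)]
             then mirror p else f p].

(* Erasing may create crossings: only the results lying in [symTL m] count. *)
Definition S_of (m : nat) (D : diagram m) : {set diagram m} :=
  [set D' in symTL m |
     [exists E : {set 'I_m * 'I_m}, (E \subset odd_edges D) && (D' == erase D E)]].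

(* A drawing of [m] arcs, each joining the left side to the right side, is cut
   by vertical lines into columns; between column [c] and column [c.+1] lies the
   layer number [c], where the strands in rows [h] and [h.+1] cross for every
   [h] in the layer.  Several crossings may lie on one vertical line. *)
Definition wiring (m : nat) : Type := seq {set 'I_m.-1}.

Definition upper (m : nat) (h : 'I_m.-1) : 'I_m := widen_ord (leq_pred m) h.

Fact lower_subproof (m : nat) (h : 'I_m.-1) : (h.+1 < m)%N.
Proof. by rewrite -ltn_predRL. Qed.

Definition lower (m : nat) (h : 'I_m.-1) : 'I_m := Ordinal (lower_subproof h).

(* No three strands meet in one point. *)
Definition proper_wiring (m : nat) (W : wiring m) : bool :=
  all (fun l : {set 'I_m.-1} =>
    [forall h in l, forall h' in l, h' != h.+1 :> nat]) W.

Definition layer_perm (m : nat) (l : {set 'I_m.-1}) : 'S_m :=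
  (\prod_(h in l) tperm (upper h) (lower h))%g.

(* [wire_at W c i] is the row, in column [c], of the wire starting at the left
   point [i]; a product of permutations is applied from left to right. *)
Definition wire_at (m : nat) (W : wiring m) (c : nat) : 'S_m :=
  (\prod_(l <- take c W) layer_perm l)%g.

Definition wire_end (m : nat) (W : wiring m) : 'S_m := wire_at W (size W).

Definition is_wiring_of (n : nat) (w : 'S_n) (W : wiring n) : bool :=
  proper_wiring W && (wire_end W == w).

Section Crossings.
Variables (m : nat) (W : wiring m).

Definition crossing : Type := ('I_(size W) * 'I_m.-1)%type.

Definition crossings : {set crossing} :=
  [set k : crossing | k.2 \in nth set0 W k.1].

(* The crossings of the wires that start at the left points [a] and [b]. *)
Definition crossings_of (a b : 'I_m) : {set crossing} :=
  [set k in crossings |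
     [set wire_at W k.1 a; wire_at W k.1 b] == [set upper k.2; lower k.2]].

Definition meet_at_most_once : bool :=
  [forall a, forall b, (#|crossings_of a b| <= 1)%N].

(* The mirror reflection exchanges layers [c] and [size W - 1 - c]. *)
Definition symmetric_wiring : bool := rev W == W.

Definition mirror_crossing (k : crossing) : crossing := (rev_ord k.1, k.2).

(* In a symmetric drawing the mirror image of the wire from the left point [a]
   to the right point [wire_end W a] is the wire starting at the left point
   [wire_end W a]. *)
Definition unpaired : {set crossing} :=
  [set k in crossings | [exists a, k \in crossings_of a (wire_end W a)]].

(* A choice of uncrossings is given by the set [x] of the crossings uncrossed
   vertically.  The resulting picture is the graph below, whose vertices are
   the intersections (column, row) of the strands with the vertical lines. *)
Definition vertex : Type := ('I_(size W).+1 * 'I_m)%type.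

Definition touches (h : 'I_m.-1) (r : 'I_m) : bool :=
  (r == upper h) || (r == lower h).

(* A horizontal strand through the layer following the column of [u]; this
   includes the strands of horizontally uncrossed crossings. *)
Definition hlink (x : {set crossing}) (u v : vertex) : bool :=
  [&& v.1 == u.1.+1 :> nat, u.2 == v.2 &
      ~~ [exists k in x, (k.1 == u.1 :> nat) && touches k.2 u.2]].

(* The two strands of a vertically uncrossed crossing, the left one having its
   ends in column [k.1] and the right one in column [k.1.+1]. *)
Definition vlink (x : {set crossing}) (u v : vertex) : bool :=
  [&& u.1 == v.1, u.2 != v.2 &
      [exists k in x, [&& (u.1 == k.1 :> nat) || (u.1 == k.1.+1 :> nat),
                          touches k.2 u.2 & touches k.2 v.2]]].

Definition strand (x : {set crossing}) : rel vertex :=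
  connect [rel u v | [|| hlink x u v, hlink x v u | vlink x u v]].

Definition end_vertex (p : point m) : vertex :=
  match p with inl i => (ord0, i) | inr i => (ord_max, i) end.

Definition resolve (x : {set crossing}) : diagram m :=
  [ffun p => odflt p
     [pick q | (q != p) && strand x (end_vertex p) (end_vertex q)]].

Definition loops (x : {set crossing}) : {set {set vertex}} :=
  [set [set v | strand x u v] | u : vertex &
     ~~ [exists p, strand x u (end_vertex p)]].

Definition mirror_vertex (v : vertex) : vertex := (rev_ord v.1, v.2).

(* Mirror-symmetric pairs of loops are counted once. *)
Definition sym_loops (x : {set crossing}) : nat :=
  #|[set [set C; mirror_vertex @: C] | C : {set vertex} in loops x]|.

Definition uv (x : {set crossing}) : nat := #|unpaired :&: x|.

(* The number of mirror pairs of paired crossings uncrossed horizontally. *)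
Definition ph (x : {set crossing}) : nat :=
  #|[set [set k; mirror_crossing k] |
       k : crossing in (crossings :\: unpaired) :\: x]|.

Definition sym_wt (x : {set crossing}) : int :=
  2%:Z ^+ sym_loops x * (-1) ^+ (uv x + ph x).

Definition wt (x : {set crossing}) : int :=
  2%:Z ^+ #|loops x| * (-1) ^+ #|crossings :\: x|.

Definition uncrossings : {set {set crossing}} := powerset crossings.

Definition sym_uncrossings : {set {set crossing}} :=
  [set x in uncrossings | mirror_crossing @: x == x].

End Crossings.

Definition f_TL (n : nat) (W : wiring n) (d : diagram n) : int :=
  \sum_(x in uncrossings W | resolve x == d) wt x.

(* [V w] is the chosen wiring diagram of [w]. *)
Definition Imm (R : comNzRingType) (n : nat) (V : 'S_n -> wiring n)
    (d : diagram n) (B : 'M[R]_n) : R :=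
  \sum_(w : 'S_n) (f_TL (V w) d)%:~R * \prod_(i < n) B i (w i).

(* Rows of the left (equivalently, for a symmetric matching, the right) ends of
   the edges that join the two sides. *)
Definition through (m : nat) (nu : diagram m) : {set 'I_m} :=
  [set i | if nu (inl i) is inr _ then true else false].

(* In the matchings considered below an edge with both ends on one side is
   crossed by no other edge: its ends do not separate those of any other edge,
   and two edges meet at most once.  So only the edges joining the two sides
   have to be drawn; the strands of the drawing are numbered by their ends
   from top to bottom, [enum_val] being increasing. *)
Definition embedding (m : nat) (nu : diagram m) : Type := wiring #|through nu|.

Definition nice_embedding (m : nat) (nu : diagram m) (W : embedding nu) : bool :=
  [&& proper_wiring W, meet_at_most_once W, symmetric_wiring W &
      [forall r, nu (inl (enum_val r)) == inr (enum_val (wire_end W r))]].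

Definition strand_point (m : nat) (T : {set 'I_m}) (q : point #|T|) : point m :=
  match q with inl r => inl (enum_val r) | inr r => inr (enum_val r) end.

(* The diagram obtained from [nu] by the uncrossings [x], loops removed. *)
Definition resolve_in (m : nat) (nu : diagram m) (W : embedding nu)
    (x : {set crossing W}) : diagram m :=
  [ffun p => if [pick q | strand_point (T := through nu) q == p] is Some q
             then strand_point (resolve x q) else nu p].

Definition coef (m : nat) (nu : diagram m) (W : embedding nu) (D : diagram m)
    : int :=
  \sum_(x in sym_uncrossings W | resolve_in (nu := nu) x == D) sym_wt x.

Definition nu_matching (m : nat) (pi : {ffun 'I_m -> 'I_m}) : diagram m :=
  [ffun p => match p with inl i => inr (pi i) | inr i => inl (pi i) end].

Section Pfaffinants.
Variables (R : comNzRingType) (m : nat).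
Variable E : forall pi : {ffun 'I_m -> 'I_m}, embedding (nu_matching pi).

Definition f_Pfaf (D : diagram m) (pi : {ffun 'I_m -> 'I_m}) : int :=
  coef (E pi) D.

(* Only the entries [A i j] with [i < j] occur. *)
Definition diag_Pfaf (D : diagram m) (A : 'M[R]_m) : R :=
  \sum_(pi : {ffun 'I_m -> 'I_m} | is_matching pi)
     (f_Pfaf D pi)%:~R * \prod_(i < m | (i < pi i)%N) A i (pi i).

Definition Pfaf (D : diagram m) (A : 'M[R]_m) : R :=
  \sum_(D' in S_of D) diag_Pfaf D' A.

End Pfaffinants.

(* The left points of [d] become the left vertices in rows [0, ..., n-1], its
   right points the right vertices in rows [n, ..., 2n-1]. *)
Definition embed_point (n : nat) (p : point n) : point (n + n) :=
  match p with inl i => inl (lshift n i) | inr i => inr (rshift n i) end.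

(* The images of the edges of [d] under [embed_point], and their mirrors. *)
Definition nu_TL (n : nat) (d : diagram n) : diagram (n + n) :=
  [ffun q => match q with
     | inl r => match split r with
                | inl i => embed_point (d (inl i))
                | inr i => mirror (embed_point (d (inr i)))
                end
     | inr r => match split r with
                | inl i => mirror (embed_point (d (inl i)))
                | inr i => embed_point (d (inr i))
                end
     end].

Definition g_tilde (n : nat) (G : forall d : diagram n, embedding (nu_TL d))
    (D : diagram (n + n)) (d : diagram n) : int :=
  (-1) ^+ (#|left_edges d| * n) * coef (G d) D.

(* Main.v *)
(* Two-colourings replace diagrams: for a colouring s of the rows (or of the
   boundary points) let K_s(D) be 1 if s is constant on the edges of D, and 0
   otherwise.  The functions D |-> K_s(D) separate integer combinations of
   symmetric TL-diagrams: taking for s the set of upper ends of the arcs of D,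
   twisted by the parity of the rows, one gets a unitriangular matrix.  So it
   suffices to compare the two sides after summation against K_s.

   Since a loop has exactly two colourings, the sum over all uncrossings of
   2^loops times a sign times K_s is a sum over the colourings of all points of
   the drawing that are constant on the strands.  Exchanging the two sums, each
   crossing contributes [vertical allowed] - [horizontal allowed], which is a
   sign times the condition that the colours, twisted by the parity of the row,
   follow the two wires through the crossing; a crossing on the mirror axis
   contributes this condition without a sign.  Hence at most one colouring
   survives.  Its sign telescopes: if N_c points of column c have colour 1, the
   crossings contribute (-1)^(their number + 'C(N_0, 2) + 'C(N_end, 2)).  In this
   way every state sum has a closed form, the matching of w (for the matrix A)
   is compared with the TL-diagrams d by summing the closed form for nu(d)
   against f_d(w), and what remains is a computation of parities.

   Planarity of the resolved diagrams also comes from colourings: along a strand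
   disjoint from a given strand P, the parity of the number of points of P above
   the current point of the column is constant. *)
Require Import Defs.
From mathcomp Require Import all_boot all_order all_fingroup all_algebra.
From mathcomp Require Import zify.

Set Implicit Arguments.
Unset Strict Implicit.
Unset Printing Implicit Defensive.

Import GRing.Theory.
Local Open Scope ring_scope.

(** The closed form of a state sum depends on the drawing only through its end permutation. So the
    drawings of [nu(pi)], [w] and [nu(d)] never have to be fitted together: the identity is proved
    coefficient by coefficient, in [bipartite_coef], without any correspondence between uncrossings.

    In a symmetric drawing only the crossings left of the axis carry a sign. The telescoping
    therefore stops at the middle column, where every wire lies next to its mirror image and has the
    opposite colour. Exactly half of the points have colour 1 there, whence the constant ['C(q, 2)]
    for [2q] strands.

    The factor [(-1)^(z(d) n)] is what makes the sign of the sum for [nu(d)] independent of [d]. For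
    odd [n] the reason is ['C(n, 2) = 'C(k, 2) + z(d)] modulo 2, where [k = n - 2 z(d)] is the
    number of edges joining the two sides. Only because of this does the sum over [d] against
    [f_d(w)] become a state sum again, now of the wiring of [w]. *)

(** * Preliminaries: involutions, paths, colourings and binomials modulo 2 *)

Lemma even_card_involution (T : finType) (f : T -> T) (S : {set T}) :
  {in S, forall x, [/\ f x \in S, f x != x & f (f x) = x]} -> ~~ odd #|S|.
Proof.
have [N] := ubnP #|S|; elim: N S => // N IH S leSN fS.
have [->|[x Sx]] := set_0Vmem S; first by rewrite cards0.
have [Sfx fxx ffx] := fS x Sx.
have Sfx' : f x \in S :\ x by rewrite !inE fxx.
rewrite (cardsD1 x) Sx (cardsD1 (f x)) Sfx' /= negbK; apply: IH.
  by move: leSN; rewrite (cardsD1 x) Sx (cardsD1 (f x)) Sfx'; lia.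
move=> y; rewrite !inE => /and3P[yfx yx Sy]; have [Sfy fyy ffy] := fS y Sy.
split=> //; rewrite Sfy andbT; apply/andP; split.
  by apply: contra yx => /eqP fxy; rewrite -ffy fxy ffx.
by apply: contra yfx => /eqP fyx; rewrite -fyx ffy.
Qed.

(** By the degree bounds, a simple path from [p] to [q] already uses every edge at each of its
    vertices. So it is the whole component, and its inner vertices have two neighbours, which [s]
    has not. *)
Lemma ends_of_component (T : finType) (e : rel T) (p q s : T) :
  symmetric e -> (forall v, #|[set u | e v u]| <= 2)%N ->
  (forall v, v \in [:: p; q; s] -> #|[set u | e v u]| <= 1)%N ->
  p != q -> connect e p q -> connect e p s -> s = p \/ s = q.
Proof.
move=> eC deg2 deg1 pq cpq cps.
have [P ePl qP] := connectP cpq.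
case/shortenP: ePl qP => {}P eP uP _ qP.
have sP : (0 < size P)%N by case: P qP {eP uP} => //= qp; rewrite qp eqxx in pq.
set N := size P in sP *.
pose v i := nth p (p :: P) i.
have ev i : (i < N)%N -> e (v i) (v i.+1) by move=> iN; apply: (pathP p eP).
have vinj i j : (i <= N)%N -> (j <= N)%N -> (v i == v j) = (i == j).
  by move=> iN jN; apply: nth_uniq.
have v0 : v 0%N = p by [].
have vN : v N = q by rewrite qP -nth_last /v /= /N; case: (P) sP.
have two i : (0 < i < N)%N -> [set u | e (v i) u] = [set v i.-1; v i.+1].
  move=> iN; apply/esym/eqP; rewrite eqEcard; apply/andP; split.
    apply/subsetP => u; rewrite !inE => /orP[] /eqP->; last by apply: ev; lia.
    by rewrite eC; have := ev i.-1; rewrite prednK; [apply; lia|lia].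
  rewrite cards2 vinj; [|lia|lia].
  by apply: leq_trans (deg2 _) _; have -> : (i.-1 != i.+1) by lia.
have one u w z : u \in [:: p; q; s] -> e u w -> e u z -> z = w.
  by move=> us euw euz; apply: (card_le1_eqP (deg1 u us)); rewrite inE.
have closedP u w : u \in p :: P -> e u w -> w \in p :: P.
  case/(nthP p) => i; rewrite /= ltnS -/N -/(v i) => iN <- evw.
  have vP j : (j <= N)%N -> v j \in p :: P by move=> jN; apply: mem_nth.
  have [i0|i0] := posnP i.
    rewrite i0 v0 in evw; rewrite (one p (v 1%N) w) ?vP ?inE ?eqxx //.
    by rewrite -v0 ev.
  have [iN'|iN'] := eqVneq i N.
    rewrite iN' vN in evw.
    rewrite (one q (v N.-1) w) ?vP ?leq_pred ?inE ?eqxx ?orbT //.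
    by rewrite -vN eC -{2}(prednK sP) ev ?prednK.
  have: w \in [set u | e (v i) u] by rewrite inE.
  by rewrite two ?inE; [case/orP=> /eqP->; apply: vP; lia|lia].
have: s \in p :: P.
  have [S eS ->] := connectP cps.
  have: forall b, path e b S -> b \in p :: P -> last b S \in p :: P.
    by elim: S {eS} => //= a S IH b /andP[eba eS] bP; apply: (IH a eS); apply: closedP eba.
  by apply => //; apply: mem_head.
case/(nthP p) => i; rewrite /= ltnS -/N -/(v i) => iN vis.
have [i0|i0] := posnP i; first by left; rewrite -vis i0.
have [iN'|iN'] := eqVneq i N; first by right; rewrite -vis iN'.
have := deg1 s; rewrite !inE eqxx !orbT => /(_ isT).
by rewrite -vis two ?cards2 ?vinj; lia.
Qed.

(** Each class outside [B] is coloured freely, so the colourings correspond to sets of such classes.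
    The classes are the fibres of [cl]: strands in the plain case, strands joined with their mirror
    images in the symmetric case. *)
Lemma card_colorings (T X : finType) (cl : T -> X) (B : pred T) (c0 : T -> bool) :
  (forall u v, cl u = cl v -> B u = B v) ->
  (forall u v, B u -> cl u = cl v -> c0 u = c0 v) ->
  #|[set c : {ffun T -> bool} |
      [forall u, forall v, (cl u == cl v) ==> (c u == c v)]
      && [forall u, B u ==> (c u == c0 u)]]| = (2 ^ #|[set cl u | u : T & ~~ B u]|)%N.
Proof.
move=> clB clc0; rewrite -card_powerset; set Y := [set cl u | u : T & ~~ B u].
pose col (S : {set X}) := [ffun u => if B u then c0 u else cl u \in S].
rewrite -(@card_in_imset _ _ col (mem (powerset Y))); last first.
  move=> S1 S2; rewrite /= !inE => /subsetP sS1 /subsetP sS2 eqS; apply/setP => y.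
  case: (boolP (y \in Y)) => [/imsetP[u]|yY].
    by rewrite inE => Bu ->; have /ffunP/(_ u) := eqS; rewrite !ffunE (negbTE Bu).
  by rewrite (negbTE (contra (sS1 y) yY)) (negbTE (contra (sS2 y) yY)).
apply: eq_card => c; apply/idP/imsetP => [|[S _ ->]].
  rewrite inE => /andP[/forallP ccl /forallP cB].
  have ccl' u v : cl u = cl v -> c u = c v.
    by move=> uv; apply/eqP; have /forallP/(_ v)/implyP := ccl u; apply; apply/eqP.
  exists [set cl u | u : T & ~~ B u && c u].
    rewrite inE; apply/subsetP => y /imsetP[u]; rewrite inE => /andP[Bu _] ->.
    by apply/imsetP; exists u; rewrite // inE.
  apply/ffunP => u; rewrite ffunE; case: ifPn => Bu; first exact/eqP/(implyP (cB u)).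
  apply/idP/imsetP => [cu|[v]]; first by exists u; rewrite // inE Bu cu.
  by rewrite inE => /andP[_ cv] /ccl' ->.
rewrite inE; apply/andP; split; apply/forallP => u.
  apply/forallP => v; apply/implyP => /eqP uv; rewrite !ffunE (clB u v uv) uv.
  by case: ifP => // Bv; rewrite (clc0 u v) // (clB u v uv).
by apply/implyP => Bu; rewrite ffunE Bu.
Qed.

Lemma sum_powerset_prod (R : comNzRingType) (I : finType) (H : {set I}) (f g : I -> R) :
  \sum_(y in powerset H) \prod_(k in H) (if k \in y then f k else g k) =
  \prod_(k in H) (f k + g k).
Proof.
rewrite [RHS]big_mkcond.
(* Extension by 0 and 1 outside [H]: in the expanded product only the subsets of [H] then
   contribute. *)
transitivity (\prod_k ((if k \in H then f k else 0) + (if k \in H then g k else 1))).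
  rewrite bigA_distr [RHS](bigID (fun J : {set I} => J \subset H)) /=.
  rewrite [X in _ + X]big1 ?addr0 => [|J /= /subsetPn[k kJ kH]]; last first.
    by rewrite (bigD1 k) //= kJ (negbTE kH) mul0r.
  apply: congr_big => // J; first by rewrite inE.
  rewrite inE => /subsetP sJ; rewrite big_mkcond /=; apply: eq_bigr => k _.
  by case: ifPn => // kH; rewrite (negbTE (contra (sJ k) kH)).
by apply: eq_bigr => k _; case: ifP; rewrite ?add0r.
Qed.

(** The pairs in a disjoint union are those of each part and [a * b] mixed ones. *)
Lemma odd_bin2D a b : odd 'C(a + b, 2) = odd 'C(a, 2) (+) odd 'C(b, 2) (+) (odd a && odd b).
Proof.
elim: b => [|b IH]; first by rewrite addn0 addbF andbF addbF.
rewrite addnS binS bin1 oddD IH binS bin1 !oddD /=.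
by case: (odd a); case: (odd b); case: (odd 'C(a, 2)); case: (odd 'C(b, 2)).
Qed.

Lemma odd_bin2_double a : odd 'C(a.*2, 2) = odd a.
Proof. by rewrite -addnn odd_bin2D addbb andbb. Qed.

(** * Layers of crossings *)

Section Layers.
Variable m : nat.
Implicit Types (h : 'I_m.-1) (l : {set 'I_m.-1}) (r : 'I_m).

Definition proper_layer l : bool :=
  [forall h in l, forall h' in l, h' != h.+1 :> nat].

Definition touched l r : bool := [exists h in l, touches h r].

Lemma touchesE h r : touches h r = (r == h :> nat) || (r == h.+1 :> nat).
Proof. by []. Qed.

Lemma odd_lower h : odd (lower h) = ~~ odd (upper h).
Proof. by []. Qed.

Lemma lower_neq_upper h : lower h != upper h.
Proof. by rewrite -val_eqE /=; lia. Qed.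

Lemma proper_layerP l h h' : proper_layer l -> h \in l -> h' \in l -> h' != h.+1 :> nat.
Proof. by move=> /forall_inP pl hl; have /forall_inP := pl h hl; apply. Qed.

Lemma touches_uniq l h h' r :
  proper_layer l -> h \in l -> h' \in l -> touches h r -> touches h' r -> h = h'.
Proof.
move=> pl hl hl'; rewrite !touchesE => tr tr'; apply: val_inj => /=.
have := proper_layerP pl hl hl'; have := proper_layerP pl hl' hl; lia.
Qed.

(** The transpositions of a proper layer have disjoint supports. Duplicate-free sublists of [l] are
    allowed so that the product can be treated by induction. *)
Lemma prod_tperm (s : seq 'I_m.-1) l r :
  proper_layer l -> {subset s <= l} -> uniq s ->
  let w : 'S_m := (\prod_(h <- s) tperm (upper h) (lower h))%g in
  (forall h : 'I_m.-1, h \in s -> w (upper h) = lower h /\ w (lower h) = upper h)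
  /\ (~~ has (fun h => touches h r) s -> w r = r).
Proof.
move=> pl; elim: s r => [|h s IH] r sl /=; first by rewrite big_nil perm1; split.
move=> /andP[hs us]; rewrite big_cons.
have ssl : {subset s <= l} by move=> x xs; apply: sl; rewrite inE xs orbT.
have {}IH r' := IH r' ssl us.
have hl : h \in l by apply: sl; apply: mem_head.
have hfix r' : touches h r' ->
    (\prod_(h <- s) tperm (upper h) (lower h))%g r' = r'.
  move=> tr; apply: (proj2 (IH r')); apply/hasPn => h' h's; apply/negP => tr'.
  by move: hs; rewrite (touches_uniq pl hl (ssl _ h's) tr tr') h's.
split=> [h'|].
  rewrite inE => /orP[/eqP->|h's].
    by rewrite !permM tpermL tpermR !hfix ?/touches ?eqxx ?orbT.
  rewrite !permM; have hh' : h != h' by apply: contraNneq hs => ->.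
  have h'l := ssl _ h's.
  have nt r' : touches h' r' -> tperm (upper h) (lower h) r' = r'.
    move=> tr'; rewrite tpermD //; apply: contraNneq hh' => er';
    by apply/eqP; apply: (@touches_uniq l _ _ r'); rewrite // -er' /touches eqxx ?orbT.
  by rewrite !nt /touches ?eqxx ?orbT //; apply: (proj1 (IH r)).
rewrite negb_or => /andP[/norP[n1 n2] nr].
by rewrite permM tpermD 1?eq_sym //; apply: (proj2 (IH r)).
Qed.

Variable l : {set 'I_m.-1}.
Hypothesis pl : proper_layer l.

Lemma layer_permE r :
  (forall h, h \in l ->
    layer_perm l (upper h) = lower h /\ layer_perm l (lower h) = upper h)
  /\ (~~ touched l r -> layer_perm l r = r).
Proof.
pose s := [seq h <- index_enum 'I_m.-1 | h \in l].
have sE h : (h \in s) = (h \in l) by rewrite mem_filter mem_index_enum andbT.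
have sl : {subset s <= l} by move=> h; rewrite sE.
have [swap fix_] := prod_tperm r pl sl (filter_uniq _ (index_enum_uniq _)).
have -> : layer_perm l = (\prod_(h <- s) tperm (upper h) (lower h))%g.
  by rewrite big_filter.
split=> [h hl|tr]; first by apply: swap; rewrite sE.
apply: fix_; apply: contra tr => /hasP[h]; rewrite sE => hl hr.
by apply/exists_inP; exists h.
Qed.

Lemma layer_perm_upper h : h \in l -> layer_perm l (upper h) = lower h.
Proof. by move=> hl; have [/(_ h hl)[]] := layer_permE (upper h). Qed.

Lemma layer_perm_lower h : h \in l -> layer_perm l (lower h) = upper h.
Proof. by move=> hl; have [/(_ h hl)[]] := layer_permE (upper h). Qed.

Lemma layer_perm_out r : ~~ touched l r -> layer_perm l r = r.
Proof. by have [] := layer_permE r. Qed.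

Variant layer_spec r : 'I_m -> bool -> Type :=
  | LayerUpper h of h \in l & r = upper h : layer_spec r (lower h) true
  | LayerLower h of h \in l & r = lower h : layer_spec r (upper h) true
  | LayerOut of (forall h, h \in l -> ~~ touches h r) : layer_spec r r false.

Lemma layerP r : layer_spec r (layer_perm l r) (touched l r).
Proof.
case: (boolP (touched l r)) => [|nr]; last first.
  rewrite layer_perm_out //; constructor=> h hl.
  by apply: contra nr => tr; apply/exists_inP; exists h.
move/exists_inP/sig2_eqW => [h hl].
rewrite /touches; case: eqP => [-> _|_ /= /eqP->].
  by rewrite layer_perm_upper //; apply: LayerUpper.
by rewrite layer_perm_lower //; apply: LayerLower.
Qed.

Lemma layer_permK : involutive (layer_perm l).
Proof.
move=> r; case: {2}_ / (layerP r) => [h hl ->|h hl ->|nr].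
- by rewrite layer_perm_lower.
- by rewrite layer_perm_upper.
- by rewrite layer_perm_out //; apply/exists_inP => -[h /nr/negP].
Qed.

Lemma odd_layer_perm r : odd (layer_perm l r) = odd r (+) touched l r.
Proof.
case: layerP => [h _ ->|h _ ->|_]; rewrite ?odd_lower ?addbT ?addbF ?negbK //.
Qed.

Lemma sum_layer (F : 'I_m -> nat) :
  (\sum_r F r = \sum_(h in l) (F (upper h) + F (lower h)) + \sum_(r | ~~ touched l r) F r)%N.
Proof.
rewrite (bigID (touched l)) /=; congr addn.
have upperI : {in l &, injective (@upper m)}.
  by move=> h h' _ _ /(congr1 val) /= e; apply: val_inj.
have lowerI : {in l &, injective (@lower m)}.
  by move=> h h' _ _ /(congr1 val) /= [e]; apply: val_inj.
rewrite big_split /= -(big_imset _ upperI) -(big_imset _ lowerI) /=.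
rewrite -bigU /=; last first.
  rewrite disjoint_subset; apply/subsetP => r /imsetP[h hl ->].
  rewrite inE; apply/imsetP => -[h' hl' /(congr1 val) /= e].
  by have := proper_layerP pl hl' hl; rewrite e eqxx.
apply: eq_bigl => r; rewrite inE; apply/idP/orP.
  by case: layerP => // h hl -> _; [left|right]; apply: imset_f.
by case=> /imsetP[h hl ->]; apply/exists_inP; exists h; rewrite // /touches eqxx ?orbT.
Qed.

(** One step of the telescoping. The twisted condition makes a crossing with equal colours exchange
    two ones for two zeros, or conversely, and preserves the number of ones everywhere else. Since
    ['C(M + 2E, 2)] has the parity of ['C(M, 2) + E], the binomial changes parity once for each
    crossing with equal colours. *)
Lemma odd_bin2_layer (D D' : 'I_m -> bool) :
  (forall r, D' (layer_perm l r) (+) odd (layer_perm l r) = D r (+) odd r) ->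
  odd 'C(\sum_r D r, 2) (+) odd 'C(\sum_r D' r, 2) =
  odd #|[set h in l | D (upper h) == D (lower h)]|.
Proof.
move=> DD'.
have D'l h : h \in l -> D' (lower h) = ~~ D (upper h).
  move=> hl; have := DD' (upper h); rewrite layer_perm_upper // odd_lower.
  by case: (D' _) (D _) (odd _) => [] [] [].
have D'u h : h \in l -> D' (upper h) = ~~ D (lower h).
  move=> hl; have := DD' (lower h); rewrite layer_perm_lower // odd_lower.
  by case: (D' _) (D _) (odd _) => [] [] [].
have D'o r : ~~ touched l r -> D' r = D r.
  by move=> tr; have := DD' r; rewrite layer_perm_out // => /addIb.
(* [E] and [F] count the crossings entered by two ones and by two zeros. [M] counts the remaining
   ones, equally many on both sides of the layer. *)
pose E := (\sum_(h in l) (D (upper h) && D (lower h)))%N.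
pose F := (\sum_(h in l) (~~ D (upper h) && ~~ D (lower h)))%N.
pose M := (\sum_(h in l) (D (upper h) (+) D (lower h)) + \sum_(r | ~~ touched l r) D r)%N.
have -> : (\sum_r D r = M + E.*2)%N.
  rewrite sum_layer -addnn -!big_split /M addnAC -!big_split /=; congr addn.
  by apply: eq_bigr => h _; do 2!case: (D _).
have -> : (\sum_r D' r = M + F.*2)%N.
  rewrite sum_layer -addnn -!big_split /M addnAC -!big_split /=; congr addn.
    by apply: eq_bigr => h hl; rewrite D'u // D'l //; do 2!case: (D _).
  by apply: eq_bigr => r tr; rewrite D'o.
have -> : #|[set h in l | D (upper h) == D (lower h)]| = (E + F)%N.
  rewrite -sum1_card big_mkcond /E /F !(big_mkcond (mem l)) -big_split /=.
  by apply: eq_bigr => h _; rewrite inE; case: (h \in l) => //; do 2!case: (D _).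
rewrite !(odd_bin2D M) !odd_bin2_double !odd_double !andbF !addbF oddD.
by case: (odd 'C(M, 2)) (odd E) (odd F) => [] [] [].
Qed.

End Layers.

(** * Wires and inversions *)

Lemma crossing_pairP m (A B : 'I_m) (h : 'I_m.-1) :
  reflect ((A = upper h /\ B = lower h) \/ (A = lower h /\ B = upper h))
          ([set A; B] == [set upper h; lower h]).
Proof.
apply: (iffP eqP) => [eqAB|[[-> ->]|[-> ->]]] //; last exact: setUC.
have: A \in [set upper h; lower h] by rewrite -eqAB !inE eqxx.
have: B \in [set upper h; lower h] by rewrite -eqAB !inE eqxx orbT.
have: upper h \in [set A; B] by rewrite eqAB !inE eqxx.
have: lower h \in [set A; B] by rewrite eqAB !inE eqxx orbT.
rewrite !inE -!val_eqE /= => *.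
suff [[]|[]]: (A = h :> nat /\ B = h.+1 :> nat) \/ (A = h.+1 :> nat /\ B = h :> nat).
- by move=> *; left; split; apply: val_inj.
- by move=> *; right; split; apply: val_inj.
- lia.
Qed.

(** A layer moves each wire by at most one row, so two wires change their order only by exchanging
    adjacent rows. *)
Lemma layer_cross m (l : {set 'I_m.-1}) (A B : 'I_m) :
  proper_layer l -> (A < B)%N -> (layer_perm l B < layer_perm l A)%N ->
  exists2 h, h \in l & A = upper h /\ B = lower h.
Proof.
move=> pl AB BA.
have eqAB : B = A.+1 :> nat /\ layer_perm l A = B.
  have : layer_perm l A = B :> nat /\ B = A.+1 :> nat; last first.
    by case=> *; split => //; apply: val_inj.
  move: AB BA; case: (layerP pl A) => [h _ ->|h _ ->|_];
    case: (layerP pl B) => [h' _ ->|h' _ ->|_] /=; lia.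
have [eB eA] := eqAB.
case: (layerP pl A) eA eB => [h hl -> eB' _|h _ -> /(congr1 val) /=|_ ->].
- by exists h.
- by move=> ->; lia.
- by lia.
Qed.

Section Wires.
Variables (m : nat) (W : wiring m).

Lemma wire_at0 : wire_at W 0 = 1%g.
Proof. by rewrite /wire_at take0 big_nil. Qed.

Lemma wire_atS c : wire_at W c.+1 = (wire_at W c * layer_perm (nth set0 W c))%g.
Proof.
rewrite /wire_at; have [cW|Wc] := ltnP c (size W).
  by rewrite (take_nth set0) // -cats1 big_cat big_seq1.
by rewrite !take_oversize ?nth_default ?leqW // /layer_perm big_set0 mulg1.
Qed.

Lemma wire_atSE c a : wire_at W c.+1 a = layer_perm (nth set0 W c) (wire_at W c a).
Proof. by rewrite wire_atS permM. Qed.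

Hypothesis pW : proper_wiring W.

Lemma proper_nth c : proper_layer (nth set0 W c).
Proof.
have [cW|Wc] := ltnP c (size W); first exact: (all_nthP set0 pW).
by rewrite nth_default //; apply/forall_inP => h; rewrite inE.
Qed.

(** The order of two wires changes in a layer exactly when they cross there. *)
Lemma odd_crossings_of a b :
  a != b -> odd #|crossings_of W a b| = (a < b)%N (+) (wire_end W a < wire_end W b)%N.
Proof.
move=> ab; rewrite /wire_end.
pose X c := [set k in crossings_of W a b | (k.1 < c)%N].
have -> : crossings_of W a b = X (size W).
  by apply/setP => k; rewrite [in RHS]inE ltn_ord andbT.
suff IH0 c : (c <= size W)%N ->
    odd #|X c| = (a < b)%N (+) (wire_at W c a < wire_at W c b)%N by apply: IH0.
elim: c => [_|c IH cW].
  rewrite wire_at0 !perm1 addbb; suff -> : X 0%N = set0 by rewrite cards0.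
  by apply/setP => k; rewrite !inE ltn0 andbF.
pose A := wire_at W c a; pose B := wire_at W c b; pose l := nth set0 W c.
have pl : proper_layer l by apply: proper_nth.
have AB : A != B by rewrite (inj_eq perm_inj).
(* The crossings of the two wires in layer [c]: at most one, as each wire has a single row in column
   [c]. *)
pose Y := [set k in crossings_of W a b | k.1 == c :> nat].
have -> : X c.+1 = X c :|: Y.
  by apply/setP => k; rewrite !inE -andb_orr ltnS leq_eqVlt orbC.
have dXY : [disjoint X c & Y].
  apply/pred0P => k; rewrite /= [k \in X c]inE [k \in Y]inE; apply/negP.
  by case/andP=> /andP[_ lt] /andP[_ /eqP e]; rewrite e ltnn in lt.
rewrite cardsU (disjoint_setI0 dXY) cards0 subn0 oddD IH; last exact: ltnW.
rewrite -[LHS]addbA -/A -/B; congr addb.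
suff -> : odd #|Y| = (A < B)%N (+) (wire_at W c.+1 a < wire_at W c.+1 b)%N by rewrite addbA addbb.
rewrite !wire_atSE -/l -/A -/B.
have memY k : k \in Y -> [set A; B] == [set upper k.2; lower k.2] /\ k.2 \in l.
  rewrite 2!inE [in X in X && _]inE => /andP[/andP[kl ww] /eqP kc].
  by rewrite kc in kl ww.
have Y1 k : k \in Y -> Y = [set k].
  move=> kY; apply/setP => k'; rewrite inE; apply/idP/eqP => [k'Y|->//].
  have [/crossing_pairP e _] := memY _ kY; have [/crossing_pairP e' _] := memY _ k'Y.
  have k1 : k.1 == c :> nat by move: kY; rewrite inE => /andP[].
  have k1' : k'.1 == c :> nat by move: k'Y; rewrite inE => /andP[].
  rewrite [k]surjective_pairing [k']surjective_pairing; congr pair; apply: val_inj.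
    exact: etrans (eqP k1') (esym (eqP k1)).
  by case: e e' => [[-> ->]|[-> ->]] [] [/(congr1 val)/= + /(congr1 val)/=]; clear; lia.
have Yc h : h \in l -> (A = upper h /\ B = lower h) \/ (A = lower h /\ B = upper h) ->
    (Ordinal cW, h) \in Y.
  move=> hl e; rewrite !inE /= hl eqxx andbT /=.
  exact/crossing_pairP.
have [Y0|[k kY]] := set_0Vmem Y; last first.
  rewrite (Y1 k kY) cards1; have [/crossing_pairP[[-> ->]|[-> ->]] kl] := memY _ kY;
  by rewrite layer_perm_upper // layer_perm_lower //=; clear; lia.
rewrite Y0 cards0 /=.
have neq' : layer_perm l A != layer_perm l B by rewrite (inj_eq perm_inj).
rewrite -val_eqE /= in AB; rewrite -val_eqE /= in neq'.
have [lt|le] := ltnP A B; have [lt'|le'] := ltnP (layer_perm l A) (layer_perm l B) => //.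
  have [|h hl e] := layer_cross pl lt; first by lia.
  by have := Yc h hl (or_introl e); rewrite Y0 inE.
have [| |h hl [e1 e2]] := @layer_cross _ l B A pl; [lia|lia|].
by have := Yc h hl (or_intror (conj e2 e1)); rewrite Y0 inE.
Qed.

Definition inversions (f : 'I_m -> 'I_m) : {set 'I_m * 'I_m} :=
  [set ab : 'I_m * 'I_m | (ab.1 < ab.2)%N && (f ab.2 < f ab.1)%N].

Lemma card_crossings :
  #|crossings W| = (\sum_(ab : 'I_m * 'I_m | (ab.1 < ab.2)%N) #|crossings_of W ab.1 ab.2|)%N.
Proof.
pose w (k : crossing W) := wire_at W k.1.
(* The two wires of a crossing are found by following them back to the left side; sorting makes the
   pair unique. *)
pose g k : 'I_m * 'I_m :=
  let a := (w k)^-1%g (upper k.2) in let b := (w k)^-1%g (lower k.2) in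
  if (a < b)%N then (a, b) else (b, a).
have gP k : ((g k).1 < (g k).2)%N.
  rewrite /g; case: ifP => //= /negbT; rewrite -leqNgt leq_eqVlt => /orP[|//].
  rewrite val_eqE (inj_eq perm_inj) => /eqP /(congr1 val) /=; lia.
rewrite -sum1_card (partition_big g (fun ab => (ab.1 < ab.2)%N)) //=.
apply: eq_bigr => -[a b] /= ab; rewrite -sum1_card; apply: eq_bigl => k.
rewrite [RHS]inE; congr andb; apply/eqP/crossing_pairP; rewrite -/(w k) /g.
  by case: ifP => _ [<- <-]; rewrite !permKV; [left|right].
case=> -[<- <-]; rewrite !permK ?ab //.
by rewrite ltnNge ltnW.
Qed.

Lemma inversionsE f : #|inversions f| =
  (\sum_(ab : 'I_m * 'I_m | (ab.1 < ab.2)%N) (f ab.2 < f ab.1)%N)%N.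
Proof.
rewrite -sum1_card (eq_bigl (fun ab : 'I_m * 'I_m => (ab.1 < ab.2)%N && (f ab.2 < f ab.1)%N)).
  by rewrite big_mkcondr.
by move=> ab; rewrite inE.
Qed.

Lemma odd_card_crossings : odd #|crossings W| = odd #|inversions (wire_end W)|.
Proof.
rewrite card_crossings inversionsE !(big_morph odd oddD (erefl (odd 0))).
apply: eq_bigr => -[a b] /= ab; rewrite odd_crossings_of ?ab; last first.
  by rewrite -val_eqE /= ltn_eqF.
have : wire_end W a != wire_end W b :> nat.
  by rewrite val_eqE (inj_eq perm_inj) -val_eqE /= ltn_eqF.
by case: ltngtP.
Qed.

(** With at most one crossing for each pair of wires, the parity from [odd_crossings_of] is the
    number itself. *)
Lemma card_crossings_inversions :
  meet_at_most_once W -> #|crossings W| = #|inversions (wire_end W)|.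
Proof.
move=> /forallP meet; rewrite card_crossings inversionsE.
apply: eq_bigr => -[a b] /= ab; have /forallP/(_ b) := meet a.
have : odd #|crossings_of W a b| = (wire_end W b < wire_end W a)%N; last first.
  by move=> <-; case: #|_| => [|[]].
rewrite odd_crossings_of ?ab -?val_eqE /= ?ltn_eqF //.
have : wire_end W a != wire_end W b :> nat.
  by rewrite val_eqE (inj_eq perm_inj) -val_eqE /= ltn_eqF.
by case: ltngtP.
Qed.

End Wires.

(** * Strands of a resolved drawing *)

Section Strands.
Variables (m : nat) (W : wiring m) (x : {set crossing W}).
Hypothesis pW : proper_wiring W.
Hypothesis xW : x \subset crossings W.

Implicit Types (u v : vertex W) (c : nat) (h : 'I_m.-1) (r : 'I_m).

Definition vertical (c : nat) : {set 'I_m.-1} :=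
  [set h | [exists k in x, (k.1 == c :> nat) && (k.2 == h)]].

Lemma vertical_proper c : proper_layer (vertical c).
Proof.
have sub h : h \in vertical c -> h \in nth set0 W c.
  rewrite inE => /exists_inP[k kx /andP[/eqP <- /eqP <-]].
  by have := subsetP xW k kx; rewrite inE.
apply/forall_inP => h hx; apply/forall_inP => h' hx'.
by apply: proper_layerP (proper_nth pW c) _ _; apply: sub.
Qed.

Definition link : rel (vertex W) :=
  [rel u v | [|| hlink x u v, hlink x v u | vlink x u v]].

Lemma strandE : strand x = connect link. Proof. by []. Qed.

Lemma hlinkE u v :
  hlink x u v = [&& v.1 == u.1.+1 :> nat, u.2 == v.2 & ~~ touched (vertical u.1) u.2].
Proof.
congr [&& _, _ & ~~ _]; apply/exists_inP/exists_inP => [[k kx /andP[k1 t]]|[h]].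
  by exists k.2 => //; rewrite inE; apply/exists_inP; exists k; rewrite // k1 eqxx.
rewrite inE => /exists_inP[k kx /andP[k1 /eqP <-]] t.
by exists k; rewrite // k1.
Qed.

Lemma touches_pair (h : 'I_m.-1) (r s : 'I_m) :
  r != s -> touches h r -> touches h s -> r = upper h /\ s = lower h \/ r = lower h /\ s = upper h.
Proof.
move=> rs; case/orP=> /eqP er; case/orP=> /eqP es; move: rs; rewrite er es ?eqxx //; auto.
Qed.

Lemma vlinkP u v : reflect
  (u.1 = v.1 /\ exists (c : nat) h, [/\ (u.1 = c :> nat \/ u.1 = c.+1 :> nat), h \in vertical c &
     u.2 = upper h /\ v.2 = lower h \/ u.2 = lower h /\ v.2 = upper h]) (vlink x u v).
Proof.
apply: (iffP and3P) => [[/eqP uv1 uv2 /exists_inP[k kx /and3P[uk tu tv]]]|].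
  split=> //; exists k.1; exists k.2; split.
  - by case/orP: uk => /eqP; [left|right].
  - by rewrite inE; apply/exists_inP; exists k; rewrite // !eqxx.
  - exact: touches_pair.
case=> uv1 [c [h [uc]]]; rewrite inE => /exists_inP[k kx /andP[/eqP kc /eqP kh]] e.
split; first exact/eqP.
  by case: e => -[-> ->]; rewrite ?lower_neq_upper // eq_sym lower_neq_upper.
apply/exists_inP; exists k => //; rewrite kc kh; apply/and3P; split.
- by case: uc => ->; rewrite eqxx ?orbT.
- by case: e => -[-> _]; rewrite /touches eqxx ?orbT.
- by case: e => -[_ ->]; rewrite /touches eqxx ?orbT.
Qed.

Lemma vlinkC u v : vlink x u v = vlink x v u.
Proof.
apply/vlinkP/vlinkP => -[e [c [h [ec hc eh]]]]; split=> //; exists c, h; split=> //.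
- by rewrite -e.
- by case: eh => -[-> ->]; [right|left].
- by rewrite -e.
- by case: eh => -[-> ->]; [right|left].
Qed.

Lemma link_sym : symmetric link.
Proof. by move=> u v; rewrite /link /= vlinkC orbCA. Qed.

Lemma strand_sym : connect_sym link.
Proof. exact: sym_connect_sym link_sym. Qed.

Definition vtx (c : nat) (r : 'I_m) : vertex W := (inord c, r).

Lemma vtxE (u : vertex W) : u = vtx u.1 u.2.
Proof. by rewrite /vtx inord_val -surjective_pairing. Qed.

Lemma vtx1 c r : (c <= size W)%N -> (vtx c r).1 = c :> nat.
Proof. by move=> cW; rewrite /= inordK. Qed.

(** Constancy along links is a condition on one layer at a time. This permits induction on the
    columns and, later, factorization over the crossings. *)
Lemma link_local (T : eqType) (f : vertex W -> T) :
  (forall u v, link u v -> f u = f v) <->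
  (forall c, (c < size W)%N ->
     (forall r, ~~ touched (vertical c) r -> f (vtx c r) = f (vtx c.+1 r)) /\
     (forall h, h \in vertical c -> f (vtx c (upper h)) = f (vtx c (lower h)) /\
                                    f (vtx c.+1 (upper h)) = f (vtx c.+1 (lower h)))).
Proof.
split=> [fl c cW|fl].
  split=> [r nt|h hc].
    by apply: fl; rewrite /link /= hlinkE !vtx1 ?eqxx ?(ltnW cW) //= nt.
  have e r : (vtx c r).1 = c :> nat by rewrite vtx1 // ltnW.
  have e' r : (vtx c.+1 r).1 = c.+1 :> nat by rewrite vtx1.
  by split; apply: fl; apply/or3P/Or33; apply/vlinkP; (split; first by []);
    exists c, h; split; rewrite ?e ?e'; auto.
have fh u v : hlink x u v -> f u = f v.
  rewrite hlinkE => /and3P[/eqP e1 /eqP e2 nt].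
  have cW : (u.1 < size W)%N by rewrite -ltnS -e1 ltn_ord.
  by rewrite (vtxE u) (vtxE v) e1 -e2; have [+ _] := fl _ cW; apply.
move=> u v /or3P[/fh//|/fh//|/vlinkP[e1 [c [h [ec hc eh]]]]].
have cW : (c < size W)%N.
  move: hc; rewrite inE => /exists_inP[k _ /andP[/eqP <- _]]; exact: ltn_ord.
have [_ /(_ h hc)[f1 f2]] := fl c cW.
rewrite (vtxE u) (vtxE v) -e1.
by case: ec => ->; case: eh => -[-> ->].
Qed.

(** Through the layer on its right a vertex has at most one link: to the other end of a vertical
    strand, or straight on. In the last column the value is meaningless, and [link_nbr] excludes it;
    [lnbr] is the analogue on the left. *)
Definition rnbr (u : vertex W) : vertex W :=
  if touched (vertical u.1) u.2 then (u.1, layer_perm (vertical u.1) u.2) else (inord u.1.+1, u.2).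
Definition lnbr (u : vertex W) : vertex W :=
  if touched (vertical u.1.-1) u.2 then (u.1, layer_perm (vertical u.1.-1) u.2)
  else (inord u.1.-1, u.2).

Lemma link_nbr u v : link u v ->
  (u.1 < size W)%N /\ v = rnbr u \/ (0 < u.1)%N /\ v = lnbr u.
Proof.
case/or3P=> [||/vlinkP[e1 [c [h [ec hc eh]]]]].
- rewrite hlinkE => /and3P[/eqP e1 /eqP e2 /negbTE nt]; left; split.
    by rewrite -ltnS -e1 ltn_ord.
  by rewrite /rnbr nt [LHS]vtxE e1 e2.
- rewrite hlinkE => /and3P[/eqP e1 /eqP e2 /negbTE nt]; right; split; first by rewrite e1.
  by rewrite /lnbr e1 -e2 nt [LHS]vtxE.
have cW : (c < size W)%N.
  move: hc; rewrite inE => /exists_inP[k _ /andP[/eqP <- _]]; exact: ltn_ord.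
have [tu ev] : touched (vertical c) u.2 /\ v.2 = layer_perm (vertical c) u.2.
  split; first by apply/exists_inP; exists h => //; case: eh => -[-> _]; rewrite /touches eqxx ?orbT.
  by case: eh => -[-> ->]; rewrite ?layer_perm_upper ?layer_perm_lower //; apply: vertical_proper.
case: ec => ec; [left|right]; (split; first by rewrite ec).
  by rewrite /rnbr ec tu -ev e1 -surjective_pairing.
by rewrite /lnbr ec /= tu -ev e1 -surjective_pairing.
Qed.

Lemma link_deg u : (#|[set v | link u v]| <= (u.1 < size W) + (0 < u.1))%N.
Proof.
apply: (@leq_trans #|[set v | (u.1 < size W)%N && (v == rnbr u)] :|: [set v | (0 < u.1)%N && (v == lnbr u)]|).
  apply: subset_leq_card; apply/subsetP => v; rewrite !inE => /link_nbr.
  by case=> -[-> ->]; rewrite eqxx ?orbT.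
apply: leq_trans (leq_card_setU _ _) _; apply: leq_add.
  case: (u.1 < _)%N; first by rewrite (_ : [set v | _] = [set rnbr u]) ?cards1 //; apply/setP => v; rewrite !inE.
  by rewrite (_ : [set v | _] = set0) ?cards0 //; apply/setP => v; rewrite !inE.
case: (0 < u.1)%N; first by rewrite (_ : [set v | _] = [set lnbr u]) ?cards1 //; apply/setP => v; rewrite !inE.
by rewrite (_ : [set v | _] = set0) ?cards0 //; apply/setP => v; rewrite !inE.
Qed.

(** * Parity arguments for unions of strands *)

Section Closed.
Variable P : pred (vertex W).
Hypothesis Plink : forall u v, link u v -> P u = P v.

(** From column to column a union [P] of strands runs on horizontally, except at vertical strands,
    which contribute both of their ends or neither. The weight [g] allows the count to be restricted
    to the rows above a given one. *)
Lemma odd_column (g : 'I_m -> bool) c : (c < size W)%N ->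
  (forall h, h \in vertical c -> g (upper h) = g (lower h)) ->
  odd (\sum_r (g r && P (vtx c r))) = odd (\sum_r (g r && P (vtx c.+1 r))).
Proof.
move=> cW gh; have [Pu Ph] := proj1 (link_local P) Plink c cW.
have even_pairs (f : 'I_m -> bool) : (forall h, h \in vertical c -> f (upper h) = f (lower h)) ->
    odd (\sum_r f r) = odd (\sum_(r | ~~ touched (vertical c) r) f r).
  move=> fh; rewrite (sum_layer (vertical_proper c)) oddD (eq_bigr (fun h => (f (upper h)).*2)).
    by rewrite (big_morph odd oddD (erefl (odd 0))) big1 // => h _; rewrite odd_double.
  by move=> h hc; rewrite -fh // addnn.
rewrite !even_pairs => [|h hc|h hc]; try by rewrite gh ?(proj1 (Ph h hc)) ?(proj2 (Ph h hc)).
by congr odd; apply: eq_bigr => r nt; rewrite Pu.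
Qed.

(** By [odd_column] with constant weight, the numbers of ends on the two sides have equal parity. *)
Lemma odd_ends : ~~ odd #|[set p | P (end_vertex W p)]|.
Proof.
have e c : (c <= size W)%N -> odd (\sum_r P (vtx 0 r)) = odd (\sum_r P (vtx c r)).
  elim: c => // c IH cW; rewrite IH ?(ltnW cW) //.
  by have := @odd_column (fun=> true) c cW (fun _ _ => erefl).
rewrite -sum1_card big_mkcond /= big_sumType /= oddD.
have E0 i : ((0, i) : vertex W) = vtx 0 i by rewrite /vtx; congr pair; apply: val_inj; rewrite /= inordK.
have EL i : ((ord_max, i) : vertex W) = vtx (size W) i.
  by rewrite /vtx; congr pair; apply: val_inj; rewrite /= inordK.
rewrite (eq_bigr (fun i => nat_of_bool (P (vtx 0 i)))); last first.
  by move=> i _; rewrite inE /= -E0; case: (P _).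
rewrite [X in _ (+) odd X](eq_bigr (fun i => nat_of_bool (P (vtx (size W) i)))); last first.
  by move=> i _; rewrite inE /= EL; case: (P _).
by rewrite (e _ (leqnn _)) addbb.
Qed.

Definition above (u : vertex W) : bool := odd (\sum_(r : 'I_m | (r < u.2)%N) P (u.1, r)).

Lemma above_link u v : ~~ P u -> link u v -> above u = above v.
Proof.
move=> Pu uv; have Pv : ~~ P v by rewrite -(Plink uv).
have abE c r : above (vtx c r) = odd (\sum_(s : 'I_m) ((s < r)%N && P (vtx c s))).
  by rewrite /above /vtx /= big_mkcond; congr odd; apply: eq_bigr => s _; case: (s < r)%N.
have abh u' v' : hlink x u' v' -> above u' = above v'.
  rewrite hlinkE => /and3P[/eqP e1 /eqP e2 nt].
  have cW : (u'.1 < size W)%N by rewrite -ltnS -e1 ltn_ord.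
  rewrite (vtxE u') (vtxE v') e1 -e2 !abE; apply: odd_column => // h hc.
  (* No vertical strand of the layer touches the row of a horizontal link, so each lies entirely
     above that row or entirely below it. *)
  have : ~~ touches h u'.2 by apply: contra nt => t; apply/exists_inP; exists h.
  by rewrite touchesE /=; lia.
case/or3P: (uv) => [/abh//|/abh//|/vlinkP[e1 [c [h [_ _ eh]]]]].
have nP : ~~ P (u.1, upper h).
  case: eh => -[eu ev]; first by rewrite -eu -surjective_pairing.
  by rewrite -ev e1 -surjective_pairing.
(* A vertical link joins adjacent rows, so the two counts differ only by its upper end, which is not
   in [P]. *)
suff eq_above : above (u.1, upper h) = above (u.1, lower h).
  by rewrite [u]surjective_pairing [v]surjective_pairing -e1; case: eh => -[-> ->].
rewrite /above /= [in RHS](bigD1 (upper h)) ?ltnSn //= (negbTE nP) add0n.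
by congr odd; apply: eq_bigl => r; rewrite -val_eqE /=; clear; lia.
Qed.

Lemma above_strand u v : ~~ P u -> strand x u v -> above u = above v.
Proof.
move=> Pu /connectP[p pl ->]; elim: p u Pu pl => //= w p IH u Pu /andP[uw pw].
by rewrite (above_link Pu uw) (IH w) // -(Plink uw).
Qed.

End Closed.

Lemma strand_closed u : forall v w, link v w -> strand x u v = strand x u w.
Proof.
move=> v w vw; rewrite !strandE; apply/idP/idP => uv.
  exact: connect_trans uv (connect1 vw).
by apply: connect_trans uv (connect1 _); rewrite link_sym.
Qed.

Lemma link_end p : (#|[set v | link (end_vertex W p) v]| <= 1)%N.
Proof.
apply: leq_trans (link_deg _) _; case: p => i /=; rewrite ?ltnn ?addn0 ?add0n; case: (_ < _)%N => //.
Qed.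

(** A second end exists by parity; a third one is excluded by the degrees, at most two in general
    and at most one at an end. *)
Lemma strand_ends p : exists q, [/\ q != p, strand x (end_vertex W p) (end_vertex W q) &
  forall s, strand x (end_vertex W p) (end_vertex W s) -> s = p \/ s = q].
Proof.
pose S := [set q | strand x (end_vertex W p) (end_vertex W q)].
have oS : ~~ odd #|S| by apply: odd_ends (strand_closed _).
have pS : p \in S by rewrite inE; apply: connect0.
have [S0|[q]] := set_0Vmem (S :\ p).
  by move: oS; rewrite (cardsD1 p) pS S0 cards0.
rewrite !inE => /andP[qp pq]; exists q; split=> // s ps.
(* Without layers [inl i] and [inr i] are the same vertex, so [end_vertex] is not injective and this
   case needs its own argument. *)
have [W0|W0] := posnP (size W).
  have nolink u v : ~~ link u v.
    by apply/negP => /link_nbr L; have := ltn_ord u.1; case: L => -[+ _]; lia.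
  have end_eq s' : strand x (end_vertex W p) (end_vertex W s') -> s' = p \/ s' = mirror p.
    rewrite strandE => /connectP[[|w l]]; last by case/andP => /(negP (nolink _ _)).
    move=> _.
    by case: p {S oS pS pq ps qp} s' => i [] j /(congr1 snd) /= ->; [left|right|right|left].
  by have [e|e] := end_eq _ pq; [rewrite e eqxx in qp|have [->|->] := end_eq _ ps; [left|right]].
have end_inj : injective (end_vertex W).
  by case=> i [] j // [] => [->//|e ->|e ->|->//]; move: W0; rewrite ?e // -?e.
have [] := @ends_of_component _ link (end_vertex W p) (end_vertex W q) (end_vertex W s).
- exact: link_sym.
- by move=> v; apply: leq_trans (link_deg v) _; do 2!case: (_ < _)%N.
- by move=> v; rewrite !inE => /or3P[] /eqP->; apply: link_end.
- by rewrite (inj_eq end_inj) eq_sym.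
- by [].
- by [].
- by move/end_inj; left.
- by move/end_inj; right.
Qed.

Lemma resolveP p : [/\ resolve x p != p,
  strand x (end_vertex W p) (end_vertex W (resolve x p)) &
  forall s, strand x (end_vertex W p) (end_vertex W s) = (s == p) || (s == resolve x p)].
Proof.
have [q [qp pq qu]] := strand_ends p.
suff -> : resolve x p = q.
  split=> // s; apply/idP/orP => [/qu[]->|[] /eqP-> //]; rewrite ?eqxx; auto.
  exact: connect0.
rewrite ffunE; case: pickP => [s /andP[sp /qu[]]|/(_ q)] /=; last by rewrite qp pq.
  by move=> e; rewrite e eqxx in sp.
by [].
Qed.

Lemma resolve_matching : is_matching (resolve x).
Proof.
apply/forallP => p; have [fp pf pu] := resolveP p; rewrite fp /=.
have [ffp fff ffu] := resolveP (resolve x p).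
have : strand x (end_vertex W (resolve x p)) (end_vertex W p) by rewrite strandE strand_sym.
by rewrite ffu eq_sym (negbTE fp) /= eq_sym.
Qed.

Definition above_point (a q : point m) : bool :=
  match a, q with
  | inl i, inl j => (i < j)%N
  | inr i, inr j => (i < j)%N
  | _, _ => false
  end.

(** In the first and the last column the strand of [p] occupies only the rows of its own ends, so
    [above] can be read off from these. By [above_strand] the parity is the same at both ends of the
    strand of [q]. *)
Lemma resolve_above p q : q != p -> q != resolve x p ->
  above_point p q (+) above_point (resolve x p) q =
  above_point p (resolve x q) (+) above_point (resolve x p) (resolve x q).
Proof.
move=> qp qfp.
have [fp pf pu] := resolveP p; have [fq qf _] := resolveP q.
pose P v := strand x (end_vertex W p) v.
have nPq : ~~ P (end_vertex W q) by rewrite /P pu negb_or qp.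
have aboveE s : above P (end_vertex W s) = above_point p s (+) above_point (resolve x p) s.
  have sumE (i j : 'I_m) :
      (\sum_(r : 'I_m | (r < j)%N) (r == i) = (i < j)%N)%N.
    have [ij|ij] := ltnP i j; last first.
      by rewrite big1 // => r rj; case: eqP => // e; rewrite e ltnNge ij in rj.
    by rewrite (bigD1 i) //= eqxx big1 // => r /andP[_ /negbTE->].
  have: #|pred2 p (resolve x p)| = 2 by rewrite card2 eq_sym fp.
  rewrite /above; case: s => j /= _.
    rewrite (eq_bigr (fun r => (inl r == p) + (inl r == resolve x p))%N); last first.
      move=> r _; rewrite -[(ord0, r)]/(end_vertex W (inl r)) /P pu.
      by case: eqP => [->|]; rewrite // eq_sym (negbTE fp).
    rewrite big_split oddD; congr addb.
      by case: (p) => i /=; [rewrite sumE|rewrite big1]; case: (_ < _)%N.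
    by case: (resolve x p) => i /=; [rewrite sumE|rewrite big1]; case: (_ < _)%N.
  rewrite (eq_bigr (fun r => (inr r == p) + (inr r == resolve x p))%N); last first.
    move=> r _; rewrite -[(ord_max, r)]/(end_vertex W (inr r)) /P pu.
    by case: eqP => [->|]; rewrite // eq_sym (negbTE fp).
  rewrite big_split oddD; congr addb.
    by case: (p) => i /=; [rewrite big1|rewrite sumE]; case: (_ < _)%N.
  by case: (resolve x p) => i /=; [rewrite big1|rewrite sumE]; case: (_ < _)%N.
rewrite -!aboveE; apply: above_strand qf => //; exact: strand_closed.
Qed.

Lemma resolve_noncrossing : noncrossing (resolve x).
Proof.
apply/existsPn => p; apply/existsPn => q; apply/and3P => -[pq qfp fpfq].
have qp : q != p by apply: contraTneq pq => ->; rewrite ltnn.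
have qfp' : q != resolve x p by apply: contraTneq qfp => ->; rewrite ltnn.
(* However the four ends are distributed over the two sides, a crossing contradicts this equality of
   parities. *)
have := resolve_above qp qfp'; move: (resolve x p) (resolve x q) pq qfp fpfq {qp qfp'}.
case: p q => p [] q [] a [] b /=; move: (ltn_ord p) (ltn_ord q) (ltn_ord a) (ltn_ord b); lia.
Qed.

Lemma resolve_TL : resolve x \in TL m.
Proof. by rewrite inE resolve_matching resolve_noncrossing. Qed.

End Strands.

(** * Colourings of the strands *)

Section Colourings.
Variables (m : nat) (W : wiring m).
Hypothesis pW : proper_wiring W.
Implicit Types (f : {ffun vertex W -> bool}) (x : {set crossing W}) (k : crossing W).

Definition vok f k : bool :=
  (f (vtx W k.1 (upper k.2)) == f (vtx W k.1 (lower k.2))) &&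
  (f (vtx W k.1.+1 (upper k.2)) == f (vtx W k.1.+1 (lower k.2))).

Definition hok f k : bool :=
  (f (vtx W k.1 (upper k.2)) == f (vtx W k.1.+1 (upper k.2))) &&
  (f (vtx W k.1 (lower k.2)) == f (vtx W k.1.+1 (lower k.2))).

Definition free_ok f : bool :=
  [forall c : 'I_(size W), forall r, ~~ touched (nth set0 W c) r ==>
     (f (vtx W c r) == f (vtx W c.+1 r))].

Definition cross_ok f x k : bool := if k \in x then vok f k else hok f k.

Lemma in_vertical x (c : 'I_(size W)) h : (h \in vertical x c) = ((c, h) \in x).
Proof.
rewrite inE; apply/exists_inP/idP => [[k kx /andP[/eqP e1 /eqP e2]]|cx].
  by rewrite -e2 (_ : c = k.1) -?surjective_pairing //; apply: val_inj.
by exists (c, h); rewrite // !eqxx.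
Qed.

(** Only the conditions at the crossings depend on [x], and each on a single crossing. This is what
    lets the sum over [x] factor as a product over the crossings. *)
Lemma strand_constP f x : x \subset crossings W ->
  reflect (forall u v, strand x u v -> f u = f v)
          (free_ok f && [forall k in crossings W, cross_ok f x k]).
Proof.
move=> xW.
have strand_link : (forall u v, strand x u v -> f u = f v) <-> (forall u v, link x u v -> f u = f v).
  split=> fx u v; first by move=> uv; apply: fx; apply: connect1.
  by rewrite strandE => /connectP[p pl ->]; elim: p u pl => //= w p IH u /andP[/fx-> /IH].
apply: (iffP idP) => [/andP[/forallP ff /forall_inP fc]|/strand_link/(link_local _ f) fl].
  apply/strand_link/link_local => // c cW; pose c' := Ordinal cW.
  split=> [r nt|h hc].
    case: (boolP (touched (nth set0 W c) r)) => [/exists_inP[h hl tr]|ntl]; last first.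
      by have /forallP/(_ r)/implyP/(_ ntl)/eqP := ff c'.
    have : cross_ok f x (c', h) by apply: fc; rewrite inE.
    rewrite /cross_ok ifN; last first.
      by apply: contra nt => hx; apply/exists_inP; exists h; rewrite // (in_vertical x c').
    by case/andP=> /eqP fu /eqP fl; case/orP: tr => /eqP->.
  rewrite (in_vertical x c') in hc.
  have : cross_ok f x (c', h) by apply: fc; apply: (subsetP xW).
  by rewrite /cross_ok hc => /andP[/eqP-> /eqP->].
have sub (c : 'I_(size W)) h : h \in vertical x c -> h \in nth set0 W c.
  by rewrite in_vertical => /(subsetP xW); rewrite inE.
apply/andP; split.
  apply/forallP => c; apply/forallP => r; apply/implyP => nt.
  have [+ _] := fl c (ltn_ord c); move=> -> //.
  by apply: contra nt => /exists_inP[h /sub hc tr]; apply/exists_inP; exists h.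
apply/forall_inP => -[c h]; rewrite inE /= => hl; have [fu fv] := fl c (ltn_ord c).
rewrite /cross_ok; case: ifPn => [|nx].
  by rewrite -in_vertical => /fv[fv1 fv2]; rewrite /vok /= fv1 fv2 !eqxx.
have nt r : touches h r -> ~~ touched (vertical x c) r.
  move=> tr; apply/exists_inP => -[h' h'x tr'].
  rewrite (touches_uniq (proper_nth pW c) hl (sub _ _ h'x) tr tr') in nx.
  by rewrite -in_vertical h'x in nx.
by rewrite /hok /= !fu ?nt ?/touches ?eqxx ?orbT.
Qed.

Definition class x (u : vertex W) := [set v | strand x u v].

Lemma classE x u v : strand x u v -> class x u = class x v.
Proof.
move=> uv; apply/setP => w; rewrite !inE !strandE.
by rewrite (same_connect (strand_sym x) uv).
Qed.

Lemma class_eq x u v : (class x u == class x v) = strand x u v.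
Proof.
apply/eqP/idP => [/setP/(_ v)|]; last exact: classE.
by rewrite !inE => ->; apply: connect0.
Qed.

(** * Powers of two as numbers of colourings *)

Section Count.
Variable x : {set crossing W}.
Hypothesis xW : x \subset crossings W.
Variable s : point m -> bool.

Definition on_boundary f : bool := [forall p, f (end_vertex W p) == s p].

Definition reaches_end (u : vertex W) : bool := [exists p, strand x u (end_vertex W p)].

(** The default [false] concerns only the vertices of loops, whose colour is free. *)
Definition boundary_colour (u : vertex W) : bool :=
  if [pick p | strand x u (end_vertex W p)] is Some p then s p else false.

Lemma reaches_strand u v : strand x u v -> reaches_end u = reaches_end v.
Proof.
by move=> uv; apply: eq_existsb => p; rewrite !strandE (same_connect (strand_sym x) uv).
Qed.

Hypothesis sx : forall p, s (resolve x p) = s p.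

Lemma strand_end_colour p q : strand x (end_vertex W p) (end_vertex W q) -> s p = s q.
Proof. by have [_ _ ->] := resolveP pW xW p; case/orP => /eqP->. Qed.

Lemma boundary_colourE u p : strand x u (end_vertex W p) -> boundary_colour u = s p.
Proof.
move=> up; rewrite /boundary_colour; case: pickP => [q uq|/(_ p)]; last by rewrite up.
apply: strand_end_colour; rewrite strandE; apply: connect_trans up.
by rewrite strand_sym.
Qed.

Lemma boundary_colour_strand u v : reaches_end u -> strand x u v ->
  boundary_colour u = boundary_colour v.
Proof.
case/existsP => p up uv; rewrite (boundary_colourE up) (@boundary_colourE v p) //.
by rewrite strandE -(same_connect (strand_sym x) uv).
Qed.

Lemma on_boundaryE f : (forall u v, strand x u v -> f u = f v) ->
  on_boundary f = [forall u, reaches_end u ==> (f u == boundary_colour u)].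
Proof.
move=> fx; apply/forallP/forallP => fs.
  move=> u; apply/implyP => /existsP[p up].
  by rewrite (boundary_colourE up) (fx _ _ up).
move=> p; have /implyP := fs (end_vertex W p).
have pp : strand x (end_vertex W p) (end_vertex W p) by apply: connect0.
rewrite (boundary_colourE pp); apply; by apply/existsP; exists p.
Qed.

Lemma card_loop_colourings :
  #|[set f | (free_ok f && [forall k in crossings W, cross_ok f x k]) && on_boundary f]|
  = (2 ^ #|loops x|)%N.
Proof.
rewrite -(@card_colorings _ _ (class x) reaches_end boundary_colour).
- apply: eq_card => f; rewrite !inE.
  apply/andP/andP => [[/(strand_constP f xW) fx fs]|[/forallP fx fs]].
    split; last by rewrite -on_boundaryE.
    by apply/forallP => u; apply/forallP => v; rewrite class_eq; apply/implyP => /fx->.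
  have {}fx u v : strand x u v -> f u = f v.
    by move=> uv; apply/eqP; have /forallP/(_ v) := fx u; rewrite class_eq uv.
  by split; [apply/strand_constP|rewrite on_boundaryE].
- by move=> u v /eqP; rewrite class_eq; apply: reaches_strand.
- by move=> u v Bu /eqP; rewrite class_eq; apply: boundary_colour_strand.
Qed.

Definition mirror_ok f : bool := [forall v, f (mirror_vertex v) == f v].

Hypothesis mx : (@mirror_crossing m W) @: x = x.
Hypothesis ms : forall p, s (mirror p) = s p.

Lemma mirror_vertexK : involutive (@mirror_vertex m W).
Proof. by case=> c r; rewrite /mirror_vertex /= rev_ordK. Qed.

Lemma mirror_crossingK : involutive (@mirror_crossing m W).
Proof. by case=> c r; rewrite /mirror_crossing /= rev_ordK. Qed.

Lemma mem_mirror k : (mirror_crossing k \in x) = (k \in x).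
Proof. by rewrite -{1}mx (mem_imset _ _ (can_inj mirror_crossingK)). Qed.

Lemma vertical_mirror c : (c < size W)%N -> vertical x (size W - c.+1) = vertical x c.
Proof.
move=> cW; apply/setP => h.
rewrite -[c]/(nat_of_ord (Ordinal cW)) in_vertical -mem_mirror.
by rewrite -[(size W - _)%N]/(nat_of_ord (rev_ord (Ordinal cW))) in_vertical.
Qed.

Lemma link_mirror u v : link x u v -> link x (mirror_vertex u) (mirror_vertex v).
Proof.
have hl u' v' : hlink x u' v' -> hlink x (mirror_vertex v') (mirror_vertex u').
  rewrite !hlinkE => /and3P[/eqP e1 /eqP e2 nt].
  have uW : (u'.1 < size W)%N by rewrite -ltnS -e1 ltn_ord.
  rewrite /= -e2 eqxx e1 !subSS vertical_mirror // nt !andbT; apply/eqP.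
  by rewrite subnSK.
case/or3P=> [/hl hl'|/hl hl'|/vlinkP[e1 [c [h [ec hc eh]]]]].
- by apply/or3P/Or32.
- by apply/or3P/Or31.
have cW : (c < size W)%N.
  move: hc; rewrite inE => /exists_inP[k _ /andP[/eqP <- _]]; exact: ltn_ord.
apply/or3P/Or33/vlinkP => //=; rewrite e1; split=> //.
exists (size W - c.+1)%N, h; split=> //; last by rewrite vertical_mirror.
by rewrite -e1 subSS; case: ec => ->; [right|left]; lia.
Qed.

Lemma strand_mirror u v : strand x (mirror_vertex u) (mirror_vertex v) = strand x u v.
Proof.
suff imp u' v' : strand x u' v' -> strand x (mirror_vertex u') (mirror_vertex v').
  by apply/idP/idP => [/imp|/imp //]; rewrite !mirror_vertexK.
rewrite !strandE => /connectP[p pl ->]; elim: p u' pl => [|w p IH] u' /=.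
  by move=> _; apply: connect0.
by case/andP => /link_mirror uw /IH; apply: connect_trans; apply: connect1.
Qed.

Lemma class_mirror u : (@mirror_vertex m W) @: class x u = class x (mirror_vertex u).
Proof.
apply/setP => v; rewrite -[v]mirror_vertexK (mem_imset _ _ (can_inj mirror_vertexK)).
by rewrite !inE strand_mirror.
Qed.

Lemma reaches_mirror u : reaches_end (mirror_vertex u) = reaches_end u.
Proof.
have end_mirror p : end_vertex W (mirror p) = mirror_vertex (end_vertex W p).
  by case: p => i; rewrite /mirror_vertex /=; congr pair; apply: val_inj; rewrite /= ?subSS ?subn0 ?subnn.
apply/existsP/existsP => -[p up]; exists (mirror p); rewrite end_mirror -strand_mirror mirror_vertexK //.
by rewrite mirror_vertexK.
Qed.

(** A mirror-symmetric colouring gives a loop and its mirror image the same colour, which is why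
    [sym_loops] counts them once. The classes to be coloured are the unions of a strand with its
    mirror image. *)
Lemma card_sym_loop_colourings :
  #|[set f | ((free_ok f && [forall k in crossings W, cross_ok f x k]) && mirror_ok f)
             && on_boundary f]| = (2 ^ sym_loops x)%N.
Proof.
pose pairC (C : {set vertex W}) := [set C; (@mirror_vertex m W) @: C].
have clP u v : (pairC (class x u) == pairC (class x v)) =
    strand x u v || strand x (mirror_vertex u) v.
  apply/eqP/orP => [e|].
    have : class x v \in pairC (class x u) by rewrite e !inE eqxx.
    by rewrite !inE class_mirror ![class x v == _]eq_sym !class_eq => /orP.
  rewrite /pairC !class_mirror => -[/classE uv|/classE uv].
    have /classE -> : strand x (mirror_vertex u) (mirror_vertex v).
      by rewrite strand_mirror -class_eq uv.
    by rewrite uv.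
  have /classE <- : strand x u (mirror_vertex v).
    by rewrite -strand_mirror mirror_vertexK -class_eq uv.
  by rewrite uv setUC.
have <- : #|[set pairC (class x u) | u : vertex W & ~~ reaches_end u]| = sym_loops x.
  congr #|pred_of_set _|; rewrite /loops; apply/setP => y; apply/imsetP/imsetP => -[].
    by move=> u uE ->; exists (class x u) => //; apply/imsetP; exists u.
  by move=> C /imsetP[u uE ->] ->; exists u.
have end_mirror p : mirror_vertex (end_vertex W p) = end_vertex W (mirror p).
  by case: p => i; rewrite /mirror_vertex /=; congr pair; apply: val_inj; rewrite /= ?subSS ?subn0 ?subnn.
have colour_mirror u : reaches_end u -> boundary_colour (mirror_vertex u) = boundary_colour u.
  case/existsP => p up; rewrite (boundary_colourE up) (@boundary_colourE _ (mirror p)) //.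
  by rewrite -end_mirror strand_mirror.
rewrite -(@card_colorings _ _ (fun u => pairC (class x u)) reaches_end boundary_colour).
- apply: eq_card => f; rewrite !inE.
  apply/andP/andP => [[/andP[/(strand_constP f xW) fx /forallP fm] fs]|[/forallP fx fs]].
    split; last by rewrite -on_boundaryE.
    apply/forallP => u; apply/forallP => v; rewrite clP; apply/implyP.
    by case/orP=> /fx <- //; rewrite eq_sym.
  have {}fx u v : strand x u v || strand x (mirror_vertex u) v -> f u = f v.
    by move=> uv; apply/eqP; have /forallP/(_ v) := fx u; rewrite clP uv.
  have fx' u v : strand x u v -> f u = f v by move=> uv; rewrite (fx u v) ?uv.
  split; last by rewrite on_boundaryE.
  apply/andP; split; first exact/strand_constP.
  by apply/forallP => u; rewrite (fx u (mirror_vertex u)) //; apply/orP; right; apply: connect0.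
- by move=> u v /eqP; rewrite clP => /orP[] /reaches_strand <- //; rewrite reaches_mirror.
- move=> u v Bu /eqP; rewrite clP => /orP[|uv]; first exact: boundary_colour_strand.
  by rewrite -(boundary_colour_strand _ uv) ?reaches_mirror // colour_mirror.
Qed.

End Count.
End Colourings.

(** * State sums *)

Lemma sign_parity (R : pzRingType) a b : odd a = odd b -> (-1) ^+ a = (-1) ^+ b :> R.
Proof. by move=> ab; rewrite -signr_odd ab signr_odd. Qed.

Lemma prod_bool (R : comNzRingType) (I : finType) (A : {set I}) (b : pred I) :
  \prod_(k in A) (b k)%:R = [forall k in A, b k]%:R :> R.
Proof.
case: (boolP [forall k in A, b k]) => [/forall_inP bA|/forall_inPn[k kA nb]].
  by rewrite big1 // => k /bA->.
by rewrite (bigD1 k) //= (negbTE nb) mul0r.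
Qed.

Lemma prod_sign (R : comNzRingType) (I : finType) (A : {set I}) (b : pred I) :
  \prod_(k in A) (-1) ^+ (b k) = (-1) ^+ #|[set k in A | b k]| :> R.
Proof.
rewrite prodrXr; congr (_ ^+ _); rewrite -sum1_card big_mkcond [RHS]big_mkcond /=.
by apply: eq_bigr => k _; rewrite inE; case: (k \in A); case: (b k).
Qed.

Section StateSum.
Variables (m : nat) (W : wiring m).
Hypothesis pW : proper_wiring W.
Implicit Types (f : {ffun vertex W -> bool}) (x : {set crossing W}) (k : crossing W).

(* Colours are constant along the strands of a resolved diagram, but along a
   wire of the unresolved drawing it is the colour plus the parity of the row
   that is constant; [t] gives this invariant for each wire. *)
Definition wire_colour (t : 'I_m -> bool) (c : nat) (r : 'I_m) : bool :=
  t ((wire_at W c)^-1%g r) (+) odd r.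

Definition colouring (t : 'I_m -> bool) : {ffun vertex W -> bool} :=
  [ffun v : vertex W => wire_colour t v.1 v.2].

Definition same f k : bool := f (vtx W k.1 (upper k.2)) == f (vtx W k.1 (lower k.2)).

(** A wire that keeps its twisted colour through a crossing changes the parity of its row, hence
    flips its colour. *)
Definition swaps f k : bool :=
  (f (vtx W k.1.+1 (lower k.2)) == ~~ f (vtx W k.1 (upper k.2))) &&
  (f (vtx W k.1.+1 (upper k.2)) == ~~ f (vtx W k.1 (lower k.2))).

(** If both uncrossings are compatible with the colours, they cancel. Otherwise either only the
    vertical one is, which forces equal colours in each column, or only the horizontal one, which
    forces different ones. *)
Lemma swap_weight f k :
  (vok f k)%:R - (hok f k)%:R = - (-1) ^+ same f k * (swaps f k)%:R :> int.
Proof.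
rewrite /vok /hok /same /swaps.
by case: (f (vtx _ k.1 (upper _))); case: (f (vtx _ k.1 (lower _)));
  case: (f (vtx _ _.+1 (upper _))); case: (f (vtx _ _.+1 (lower _))).
Qed.

Lemma wire_colour_layer t c r :
  let r' := layer_perm (nth set0 W c) r in
  wire_colour t c.+1 r' (+) odd r' = wire_colour t c r (+) odd r.
Proof. by rewrite /wire_colour wire_atS invMg permM permK -!addbA !addbb. Qed.

(** The conditions carry the twisted colours along the wires, so [f] is determined by its column
    0. *)
Lemma swapsP f :
  reflect (f = colouring (fun a => f (vtx W 0 a) (+) odd a))
          (free_ok f && [forall k in crossings W, swaps f k]).
Proof.
have step : free_ok f && [forall k in crossings W, swaps f k] <->
    (forall c r, (c < size W)%N -> let r' := layer_perm (nth set0 W c) r in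
       f (vtx W c.+1 r') (+) odd r' = f (vtx W c r) (+) odd r).
  split=> [/andP[/forallP ff /forall_inP fs] c r cW /=|fs].
    pose c' := Ordinal cW.
    have sw h : h \in nth set0 W c -> swaps f (c', h) by move=> hl; apply: fs; rewrite inE.
    case: (layerP (proper_nth pW c) r) => [h hl ->|h hl ->|nt].
    - by have /andP[/eqP/= -> _] := sw h hl; case: (f _); case: (odd h).
    - by have /andP[_ /eqP/= ->] := sw h hl; case: (f _); case: (odd h).
    - have /forallP/(_ r)/implyP := ff c'; rewrite -[nat_of_ord c']/c => /(_ _)/eqP->//.
      by apply/exists_inP => -[h /nt/negP].
  apply/andP; split.
    apply/forallP => c; apply/forallP => r; apply/implyP => nt; apply/eqP.
    by have := fs c r (ltn_ord c); rewrite layer_perm_out ?proper_nth //= => /addIb.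
  apply/forall_inP => -[c h]; rewrite inE /= => hl; rewrite /swaps /=.
  have := fs c (upper h) (ltn_ord c); have := fs c (lower h) (ltn_ord c).
  rewrite /= layer_perm_upper ?layer_perm_lower ?proper_nth //= => e1 e2.
  by apply/andP; split; apply/eqP; [move: e2|move: e1]; do 2!case: (f _); case: (odd h).
apply: (iffP idP) => [/step fs|fE].
  set t := (fun a : 'I_m => f (vtx W 0 a) (+) odd a); have fc c r : (c <= size W)%N -> f (vtx W c r) = wire_colour t c r.
    elim: c r => [|c IH] r cW.
      by rewrite /wire_colour wire_at0 invg1 perm1 /t -addbA addbb addbF.
    rewrite -[r](layer_permK (proper_nth pW c)); set r1 := layer_perm _ r.
    have := fs c r1 cW; rewrite /= IH ?(ltnW cW) // -wire_colour_layer.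
    exact: addIb.
  apply/ffunP => v; rewrite ffunE -fc -?vtxE //.
  by rewrite -ltnS ltn_ord.
apply/step => c r cW r'; rewrite fE !ffunE !vtx1 ?(ltnW cW) //=.
exact: wire_colour_layer.
Qed.

Lemma colouringE t c r : (c <= size W)%N -> colouring t (vtx W c r) = wire_colour t c r.
Proof. by move=> cW; rewrite ffunE vtx1. Qed.

Lemma wire_colour0 t r : wire_colour t 0 r = t r (+) odd r.
Proof. by rewrite /wire_colour wire_at0 invg1 perm1. Qed.

(** The cut is at an arbitrary column because the symmetric state sum needs only the left half. *)
Definition crossings_before (n : nat) : {set crossing W} :=
  [set k in crossings W | (k.1 < n)%N].

Definition ones t c : nat := (\sum_r wire_colour t c r)%N.

(** Induction on the columns; each layer contributes one instance of [odd_bin2_layer]. *)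
Lemma odd_same t n : (n <= size W)%N ->
  odd #|[set k in crossings_before n | same (colouring t) k]| =
  odd 'C(ones t 0, 2) (+) odd 'C(ones t n, 2).
Proof.
elim: n => [_|n IH nW].
  by rewrite addbb (_ : [set k in _ | _] = set0) ?cards0 //; apply/setP => k; rewrite !inE ltn0 andbF.
set A := [set k in crossings_before n | same (colouring t) k] in IH.
pose l := nth set0 W n; pose D := wire_colour t n.
pose B := [set ((Ordinal nW, h) : crossing W) | h in [set h in l | D (upper h) == D (lower h)]].
have -> : [set k in crossings_before n.+1 | same (colouring t) k] = A :|: B.
  apply/setP => -[c h]; rewrite !inE ltnS leq_eqVlt -andbA; apply/idP/orP.
    case/and3P=> hl /orP[/eqP/= ec|lt] sm; [right|left].
      have -> : c = Ordinal nW by apply: val_inj.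
      rewrite imset_f // inE /l -{1}ec hl /=; move: sm.
      by rewrite /same !colouringE ?(ltnW (ltn_ord _)) //= ec.
    by rewrite hl lt sm.
  case=> [|/imsetP[h']]; first by case/andP=> /andP[-> ->] ->; rewrite orbT.
  rewrite inE => /andP[hl sm] [-> ->] /=; rewrite eqxx -/l hl /same.
  by rewrite !colouringE ?(ltnW nW).
have dAB : [disjoint A & B].
  apply/pred0P => k /=; apply/negP => /andP[kA /imsetP[h _ ek]].
  by move: kA; rewrite ek !inE ltnn andbF.
rewrite cardsU (disjoint_setI0 dAB) cards0 subn0 oddD (IH (ltnW nW)) card_imset => [|h h' [] //].
rewrite -(@odd_bin2_layer _ l (proper_nth pW n) D (wire_colour t n.+1)); last exact: wire_colour_layer.
by rewrite /ones -/D -addbA addKb.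
Qed.

Lemma prod_same t n : (n <= size W)%N ->
  \prod_(k in crossings_before n) - (-1) ^+ same (colouring t) k =
  (-1) ^+ (#|crossings_before n| + 'C(ones t 0, 2) + 'C(ones t n, 2)) :> int.
Proof.
move=> nW; rewrite (eq_bigr (fun k => -1 * (-1) ^+ same (colouring t) k)); last first.
  by move=> k _; rewrite mulN1r.
rewrite big_split /= prodr_const prod_sign -exprD; apply: sign_parity.
by rewrite !oddD odd_same // addbA.
Qed.

Lemma card_plain_colourings x (s : point m -> bool) : x \subset crossings W ->
  #|[set f | (free_ok f && [forall k in crossings W, cross_ok f x k]) && on_boundary s f]|
  = (2 ^ #|loops x| * [forall p, s (resolve x p) == s p])%N.
Proof.
move=> xW; case: (boolP [forall p, _]) => [/forallP sx|/forallPn[p np]].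
  by rewrite muln1 card_loop_colourings // => p; apply/eqP.
rewrite muln0; apply/eqP; rewrite cards_eq0; apply/eqP/setP => f; rewrite !inE.
apply/negP => /andP[/(strand_constP pW f xW) fx /forallP fs].
by move: np; rewrite -(eqP (fs _)) -(eqP (fs p)) (fx _ (end_vertex W p)) ?eqxx //;
  rewrite strandE strand_sym; have [] := resolveP pW xW p.
Qed.

Lemma sum_colourings (P : pred {ffun vertex W -> bool}) :
  (#|[set f | P f]|)%:R = \sum_f (P f)%:R :> int.
Proof.
rewrite -sum1_card natr_sum big_mkcond /=; apply: eq_bigr => f _.
by rewrite inE; case: (P f).
Qed.

Lemma signed_cross_ok (H x : {set crossing W}) f :
  \prod_(k in H) (if k \in x then (vok f k)%:R else - (hok f k)%:R) =
  (-1) ^+ #|H :\: x| * [forall k in H, cross_ok f x k]%:R :> int.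
Proof.
have -> : H :\: x = [set k in H | k \notin x] by apply/setP => k; rewrite !inE andbC.
rewrite -prod_sign -prod_bool -big_split; apply: eq_bigr => k _.
by rewrite /cross_ok; case: (k \in x); rewrite /= ?expr0 ?expr1 ?mul1r ?mulN1r.
Qed.

Lemma state_sum (s : point m -> bool) :
  \sum_(x in uncrossings W) wt x * [forall p, s (resolve x p) == s p]%:R =
  (-1) ^+ (#|crossings W| + 'C(\sum_i s (inl i), 2) + 'C(\sum_i s (inr i), 2)) *
  [forall a, s (inr (wire_end W a)) (+) odd (wire_end W a) == s (inl a) (+) odd a]%:R :> int.
Proof.
pose t a := s (inl a) (+) odd a.
transitivity (\sum_f \sum_(x in powerset (crossings W)) (on_boundary s f)%:R * (free_ok f)%:R *
    \prod_(k in crossings W) (if k \in x then (vok f k)%:R else - (hok f k)%:R) : int).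
  rewrite exchange_big; apply: eq_bigr => x; rewrite inE => xW.
  rewrite /wt -[2%:Z]natz mulrAC -natrX -natrM -card_plain_colourings // sum_colourings mulrC mulr_sumr.
  apply: eq_bigr => f _; rewrite signed_cross_ok mulrCA; congr (_ * _).
  by case: (free_ok f); case: (on_boundary _ _); rewrite ?mul0r ?mul1r ?mulr0 ?andbF ?andbT.
(* Summation over [x] leaves one factor [vok - hok] per crossing. The resulting conditions admit
   only the colouring propagated from the left boundary. *)
transitivity (\sum_f (on_boundary s f && (f == colouring t))%:R *
    \prod_(k in crossings W) - (-1) ^+ same f k : int).
  apply: eq_bigr => f _; rewrite -mulr_sumr sum_powerset_prod.
  rewrite (eq_bigr _ (fun k _ => swap_weight f k)) big_split /= prod_bool mulrCA [RHS]mulrC.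
  congr (_ * _); rewrite -mulrA -!natrM !mulnb; congr (nat_of_bool _)%:R.
  case: (boolP (on_boundary s f)) => //= /forallP fs.
  have e0 a : f (vtx W 0 a) (+) odd a = t a.
    rewrite /t -(eqP (fs (inl a))); congr (f _ (+) _).
    by rewrite /vtx; congr pair; apply: val_inj; rewrite /= inordK.
  apply/swapsP/eqP => [->|->].
    by apply/ffunP => v; rewrite !ffunE /wire_colour e0.
  apply/ffunP => v; rewrite !ffunE /wire_colour; congr addb.
  by rewrite colouringE // wire_colour0 -addbA addbb addbF.
rewrite (bigD1 (colouring t)) //= [X in _ + X]big1 ?addr0 => [|f /negbTE->]; last by rewrite andbF mul0r.
rewrite eqxx andbT mulrC.
have cr : crossings_before (size W) = crossings W.
  by apply/setP => k; rewrite [LHS]inE ltn_ord andbT.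
have E0 i : ((0, i) : vertex W) = vtx W 0 i.
  by rewrite /vtx; congr pair; apply: val_inj; rewrite /= inordK.
have EL i : ((ord_max, i) : vertex W) = vtx W (size W) i.
  by rewrite /vtx; congr pair; apply: val_inj; rewrite /= inordK.
(* On the left this colouring agrees with [s] by the choice of [t], so only the right boundary has
   to be tested, wire by wire. *)
have -> : on_boundary s (colouring t) =
    [forall a, s (inr (wire_end W a)) (+) odd (wire_end W a) == s (inl a) (+) odd a].
  apply/forallP/forallP => [fs a|fs [i|i]] /=.
  - have := fs (inr (wire_end W a)); rewrite /= EL colouringE // /wire_colour permK => /eqP <-.
    by rewrite -addbA addbb addbF.
  - by rewrite E0 colouringE // wire_colour0 /t -addbA addbb addbF.
  rewrite EL colouringE // /wire_colour -/(wire_end W) /t.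
  rewrite -(eqP (fs _)) permKV.
  by rewrite -addbA addbb addbF.
case: (boolP [forall a, _]) => [/forallP valid|_]; last by rewrite !mulr0.
rewrite !mulr1 -cr prod_same // cr; congr (_ ^+ (_ + 'C(_, 2) + 'C(_, 2))).
  by apply: eq_bigr => i _; rewrite wire_colour0 /t -addbA addbb addbF.
apply: eq_bigr => i _; rewrite /wire_colour -/(wire_end W) /t -(eqP (valid _)) permKV.
by rewrite -addbA addbb addbF.
Qed.

End StateSum.

(** * Symmetric state sums *)

Lemma ltn_halfE c n : (c < n./2)%N = (c.*2.+1 < n)%N.
Proof. by have := odd_double_half n; case: (odd _); lia. Qed.

Section SymStateSum.
Variables (m : nat) (W : wiring m).
Hypothesis pW : proper_wiring W.
Hypothesis sW : symmetric_wiring W.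
Hypothesis meetW : meet_at_most_once W.
Hypothesis freeW : forall a, wire_end W a != a.
Implicit Types (f : {ffun vertex W -> bool}) (x y : {set crossing W}) (k : crossing W).
Let L := size W.

Lemma nth_mirror c : (c < L)%N -> nth set0 W (L - c.+1) = nth set0 W c.
Proof. by move=> cL; rewrite -nth_rev // (eqP sW). Qed.

(** Going [c] layers back from the right end of wire [a] is going [c] layers forward along its
    mirror image, which starts at [wire_end W a]. *)
Lemma wire_at_mirror c a : (c <= L)%N -> wire_at W (L - c) a = wire_at W c (wire_end W a).
Proof.
elim: c a => [|c IH] a cL; first by rewrite subn0 wire_at0 perm1.
rewrite wire_atSE -IH ?(ltnW cL) // -(subnSK cL) wire_atSE nth_mirror //.
by rewrite layer_permK ?proper_nth.
Qed.

Lemma wire_endK a : wire_end W (wire_end W a) = a.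
Proof. by rewrite -wire_at_mirror // subnn wire_at0 perm1. Qed.

Lemma wire_at_fixfree c a : (c <= L)%N -> wire_at W (L - c) a != wire_at W c a.
Proof. by move=> cL; rewrite wire_at_mirror // (inj_eq perm_inj). Qed.

(** The middle layer is the one with index [c] such that [2c + 1 = size W]. [left_half] includes it
    and [left_part] omits it. *)
Definition axis : {set crossing W} := [set k in crossings W | (k.1).*2.+1 == size W].
Definition left_half : {set crossing W} := [set k in crossings W | ((k.1).*2.+1 <= size W)%N].
Definition left_part : {set crossing W} := crossings_before W (size W)./2.

Lemma left_partE : left_part = [set k in crossings W | ((k.1).*2.+1 < size W)%N].
Proof.
by apply/setP => k; rewrite !inE ltn_halfE.
Qed.

Lemma mirror_crossings k : (mirror_crossing k \in crossings W) = (k \in crossings W).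
Proof. by case: k => c h; rewrite !inE /= nth_mirror. Qed.

Lemma mirror_fixed k : k.1.*2.+1 = size W -> mirror_crossing k = k.
Proof.
case: k => c h /= e; congr pair; apply: val_inj => /=; lia.
Qed.

(** If a wire crosses its mirror image, the mirror crossing belongs to the same two wires and is
    therefore the same crossing, as they meet at most once. Conversely, the columns on both sides of
    the middle layer are mirror images, so wires that cross in it are mirror images of each
    other. *)
Lemma unpaired_axis : unpaired W = axis.
Proof.
apply/setP => k; rewrite [in LHS]inE [in RHS]inE; apply/idP/idP => /andP[kW].
  case/existsP => a ka; rewrite kW /=.
  have /forallP/(_ (wire_end W a))/card_le1_eqP meet := forallP meetW a.
  have mk : mirror_crossing k \in crossings_of W a (wire_end W a).
    move: ka; rewrite !inE => /andP[kl /crossing_pairP e].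
    have := mirror_crossings k; rewrite !inE kl => -> /=.
    have kL := ltn_ord k.1.
    apply/crossing_pairP; rewrite -/L !wire_at_mirror // wire_endK !wire_atSE.
    by case: e => -[-> ->]; rewrite layer_perm_upper ?layer_perm_lower ?proper_nth //; auto.
  have /(congr1 (fun k : crossing W => nat_of_ord k.1)) /= := meet _ _ mk ka.
  have := ltn_ord k.1; lia.
move=> /eqP ax; rewrite kW; apply/existsP; pose a := (wire_at W k.1)^-1%g (upper k.2).
exists a; rewrite inE kW; apply/crossing_pairP; left; split; first by rewrite permKV.
have kL := ltn_ord k.1; rewrite -wire_at_mirror; last exact: ltnW.
have -> : (L - k.1 = k.1.+1)%N by rewrite /L; lia.
rewrite wire_atSE permKV layer_perm_upper ?proper_nth //.
by move: kW; rewrite inE.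
Qed.

Lemma half_split k : k \in crossings W -> k \in left_half \/ mirror_crossing k \in left_half.
Proof.
move=> kW; have -> : (k \in left_half) = (k.1.*2.+1 <= size W)%N by rewrite inE kW.
have -> : (mirror_crossing k \in left_half) = ((size W - k.1.+1).*2.+1 <= size W)%N.
  by rewrite inE mirror_crossings kW.
have kL := ltn_ord k.1.
by have [h|h] := leqP k.1.*2.+1 (size W); [left|right; lia].
Qed.

Lemma half_mirror k : k \in left_half -> mirror_crossing k \in left_half -> mirror_crossing k = k.
Proof.
rewrite !inE => /andP[_ kh] /andP[_ /= mh]; apply: mirror_fixed.
have mid c n : (c < n)%N -> (c.*2 < n)%N -> ((n - c.+1).*2 < n)%N -> c.*2.+1 = n by lia.
exact: mid (ltn_ord k.1) kh mh.
Qed.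

Lemma uvE x : uv x = #|[set k in left_half | (k \in axis) && (k \in x)]|.
Proof.
rewrite /uv unpaired_axis; apply: eq_card => k; rewrite !inE.
by case: (k.2 \in _); case: (k \in x); rewrite ?andbF //= ?andbT; case: eqP => [->|]; rewrite ?leqnn ?andbF.
Qed.

(** [left_half] contains exactly one crossing of each mirror pair off the axis. *)
Lemma phE x : (@mirror_crossing m W) @: x = x ->
  ph x = #|[set k in left_half | (k \notin axis) && (k \notin x)]|.
Proof.
move=> mx; rewrite /ph unpaired_axis; set A := [set k in left_half | _].
have inA k : k \in A -> [/\ k \in crossings W, k \notin axis, k \notin x & (k.1.*2.+1 < size W)%N].
  rewrite !inE => /andP[/andP[kW kh] /andP[nk kx]]; split=> //.
  by rewrite kW /= in nk; rewrite ltn_neqAle nk.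
have pair_inj : {in A &, injective (fun k => [set k; mirror_crossing k])}.
  move=> k k' /inA[_ _ _ kh] /inA[_ _ _ kh'] e.
  have : k' \in [set k; mirror_crossing k] by rewrite e !inE eqxx.
  rewrite !inE => /orP[/eqP //|/eqP ek]; move: kh'; rewrite ek /=.
  have no c n : (c < n)%N -> (c.*2.+1 < n)%N -> ((n - c.+1).*2.+1 < n)%N -> False by lia.
  by move/(no _ _ (ltn_ord k.1) kh).
rewrite -(card_in_imset pair_inj); apply: eq_card => y; apply/imsetP/imsetP => -[k kA ->].
  move: kA; rewrite inE => /andP[kx]; rewrite inE => /andP[ka kW].
  have nmx : mirror_crossing k \notin x by rewrite mem_mirror.
  have nma : mirror_crossing k \notin axis.
    apply: contra ka; rewrite ![_ \in axis]inE => /andP[_ /= e]; rewrite kW /=.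
    have mid c n : (c < n)%N -> (n - c.+1).*2.+1 == n -> c.*2.+1 == n by lia.
    exact: mid (ltn_ord k.1) e.
  have [kh|kh] := half_split kW.
    by exists k; rewrite // inE kh kx ka.
  by exists (mirror_crossing k); [rewrite inE kh nma nmx|rewrite mirror_crossingK setUC].
have [kW nk kx _] := inA _ kA.
by exists k; rewrite // !in_setD kx nk kW.
Qed.

(** For even [L] the middle column would be its own mirror image, and each wire would coincide there
    with its own mirror image, against [freeW]. So there is a middle layer, and it takes each wire
    to the row from which its mirror image comes. *)
Lemma wire_at_half a :
  odd L /\ layer_perm (nth set0 W L./2) (wire_at W L./2 a) = wire_at W L./2 (wire_end W a).
Proof.
have Lh : (L./2 <= L)%N by rewrite leq_half_double -addnn -addSn leq_addl.
have := wire_at_fixfree a Lh; have := wire_at_mirror a Lh.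
have := odd_double_half L; case: (odd L) => /= e; last first.
  have -> : (L - L./2 = L./2)%N by rewrite -{1}e add0n -addnn addnK.
  by rewrite eqxx.
have -> : (L - L./2 = L./2.+1)%N by rewrite -{1}e add1n -addnn -addSn addnK.
by rewrite wire_atSE.
Qed.

(** A row untouched by the middle layer would carry a wire equal to its mirror image. So the
    crossings on the axis cover all [2q] rows. *)
Lemma card_axis q : m = q.*2 -> #|axis| = q.
Proof.
move=> mq; have [m0|m0] := posnP m.
  have -> : axis = set0 by apply/setP => -[c h]; have := ltn_ord h; rewrite {2}m0.
  by rewrite cards0; lia.
have [oL _] := wire_at_half (Ordinal m0).
have hL : (L./2 < L)%N by have := odd_double_half L; rewrite oL; lia.
pose l := nth set0 W L./2.
have -> : #|axis| = #|l|.
  rewrite -(card_imset (mem l) (_ : injective (fun h => (Ordinal hL, h) : crossing W))); last by move=> h h' [].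
  apply: eq_card => -[c h]; rewrite !inE /=; apply/andP/imsetP => [[hc /eqP ec]|[h' hl [-> ->]]] /=.
    have ec' : c = Ordinal hL.
      have half_eq d n : d.*2.+1 = n -> d = n./2 by move=> <-; rewrite /= uphalf_double.
      exact/val_inj/half_eq.
    by exists h; rewrite ?ec' // /l -[L./2]/(nat_of_ord (Ordinal hL)) -ec'.
  split=> //; rewrite -/L; have := odd_double_half L; rewrite oL; lia.
have := sum_layer (proper_nth pW L./2) (fun=> 1%N); rewrite sum1_card card_ord => e.
have : (\sum_(r : 'I_m | ~~ touched (nth set0 W L./2) r) 1 = 0)%N.
  apply: big1 => r nt; have [_] := wire_at_half ((wire_at W L./2)^-1%g r).
  rewrite permKV layer_perm_out ?proper_nth // => er.
  have := freeW ((wire_at W L./2)^-1%g r).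
  by rewrite -(inj_eq (@perm_inj _ (wire_at W L./2))) -er permKV eqxx.
move=> e0; move: e; rewrite e0 addn0 sum_nat_const muln2 -/l; lia.
Qed.

(** Of each mirror pair off the axis one crossing is in [left_part]. Hence the size of [left_part],
    and with it the sign, is determined by the end permutation. *)
Lemma card_crossings_half q : m = q.*2 ->
  #|inversions (wire_end W)| = (q + #|left_part|.*2)%N.
Proof.
move=> mq; rewrite -card_crossings_inversions // -(card_axis mq).
have sum_mem (A : {set crossing W}) : A \subset crossings W ->
    (\sum_(k in crossings W) (k \in A) = #|A|)%N.
  move=> AW; rewrite -sum1_card big_mkcond [RHS]big_mkcond; apply: eq_bigr => k _.
  by case: (boolP (k \in A)) => [/(subsetP AW)->|_] //; case: ifP.
have axisW : axis \subset crossings W by apply/subsetP => k; rewrite inE => /andP[].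
have leftW : left_part \subset crossings W by apply/subsetP => k; rewrite inE => /andP[].
rewrite -sum1_card (eq_bigr (fun k => (k \in axis) +
    ((k \in left_part) + (mirror_crossing k \in left_part)))%N); last first.
  move=> k kW; rewrite left_partE ![_ \in [set _ in _ | _]]inE mirror_crossings kW /=.
  have tri c n : (c < n)%N -> (1 = (c.*2.+1 == n) + ((c.*2.+1 < n) + ((n - c.+1).*2.+1 < n)))%N by lia.
  exact: tri (ltn_ord k.1).
rewrite !big_split /= !sum_mem // -addnn; congr (_ + (_ + _))%N.
rewrite -[RHS](sum_mem _ leftW) [RHS](reindex_inj (can_inj (@mirror_crossingK _ W))) /=.
by apply: eq_bigl => k; rewrite mirror_crossings.
Qed.

Definition symmetrize (y : {set crossing W}) := y :|: (@mirror_crossing m W) @: y.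

Lemma mem_mirror_image (y : {set crossing W}) k :
  (k \in (@mirror_crossing m W) @: y) = (mirror_crossing k \in y).
Proof.
by rewrite -{1}(mirror_crossingK k) mem_imset //; apply: can_inj (@mirror_crossingK _ W).
Qed.

Lemma symmetrize_sym y : (@mirror_crossing m W) @: symmetrize y = symmetrize y.
Proof.
by apply/setP => k; rewrite mem_mirror_image !in_setU !mem_mirror_image mirror_crossingK orbC.
Qed.

Lemma halfW : left_half \subset crossings W.
Proof. by apply/subsetP => k; rewrite inE => /andP[]. Qed.

Lemma mem_symmetrize y k : y \subset left_half -> k \in left_half -> (k \in symmetrize y) = (k \in y).
Proof.
move=> yh kh; rewrite in_setU mem_mirror_image orb_idr // => mky.
by rewrite -(half_mirror kh (subsetP yh _ mky)).
Qed.

Lemma symmetrizeW y : y \subset left_half -> symmetrize y \subset crossings W.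
Proof.
move=> yh; have yW := subset_trans yh halfW; apply/subsetP => k.
by rewrite in_setU mem_mirror_image => /orP[/(subsetP yW)|/(subsetP yW)]; rewrite ?mirror_crossings.
Qed.

(** A symmetric choice is determined by its part in [left_half], which is arbitrary. *)
Lemma sum_sym_uncrossings (F : {set crossing W} -> int) :
  \sum_(x in sym_uncrossings W) F x = \sum_(y in powerset left_half) F (symmetrize y).
Proof.
rewrite (reindex_onto symmetrize (fun x => x :&: left_half)) /=.
  apply: eq_bigl => y; rewrite !inE; apply/andP/idP => [[_ /eqP <-]|yh]; first exact: subsetIr.
  rewrite symmetrizeW // symmetrize_sym eqxx; split=> //.
  apply/eqP/setP => k; rewrite in_setI; case: (boolP (k \in left_half)) => kh.
    by rewrite mem_symmetrize // andbT.
  by rewrite andbF (negbTE (contra (subsetP yh k) kh)).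
move=> x; rewrite !inE => /andP[xW /eqP mx]; apply/setP => k.
rewrite in_setU mem_mirror_image !in_setI (mem_mirror mx) -andb_orr andb_idr // => kx.
by apply/orP/half_split/(subsetP xW).
Qed.

Lemma mirror_okE f : reflect (forall c r, (c <= L)%N -> f (vtx W (L - c) r) = f (vtx W c r)) (mirror_ok f).
Proof.
have mE c r : (c <= L)%N -> mirror_vertex (vtx W c r) = vtx W (L - c) r.
  move=> cL; rewrite /mirror_vertex /vtx; congr pair; apply: val_inj.
  by rewrite /= !inordK ?ltnS ?leq_subr // subSS.
apply: (iffP forallP) => [fm c r cL|fm v].
  by rewrite -mE //; apply/eqP.
by rewrite [v]vtxE mE ?fm // -ltnS ltn_ord.
Qed.

Lemma local_mirror f k : mirror_ok f ->
  [/\ vok f (mirror_crossing k) = vok f k, hok f (mirror_crossing k) = hok f k &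
      swaps f (mirror_crossing k) = swaps f k].
Proof.
move/mirror_okE => fm; rewrite /vok /hok /swaps.
have e1 r : f (vtx W (mirror_crossing k).1 r) = f (vtx W k.1.+1 r).
  exact: fm k.1.+1 r (ltn_ord k.1).
have e2 r : f (vtx W (mirror_crossing k).1.+1 r) = f (vtx W k.1 r).
  rewrite -(fm k.1 r (ltnW (ltn_ord k.1))); congr (f (vtx W _ r)).
  exact: subnSK (ltn_ord k.1).
rewrite !e1 !e2; split; first exact: andbC.
  by congr (_ && _); rewrite eq_sym.
by rewrite andbC; congr (_ && _); rewrite eq_sym; do 2!case: (f _).
Qed.

Lemma forall_half (P : pred (crossing W)) : (forall k, P (mirror_crossing k) = P k) ->
  [forall k in crossings W, P k] = [forall k in left_half, P k].
Proof.
move=> mP; apply/forall_inP/forall_inP => PA k kA; first exact/PA/(subsetP halfW).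
by have [/PA|/PA] := half_split kA; rewrite ?mP.
Qed.

(** A symmetric colouring has the same colours on both sides of the axis. So [hok] always holds,
    [vok] means that the two rows have equal colours, and the difference says that they have
    different ones. *)
Lemma axis_weight f k : mirror_ok f -> k \in axis ->
  - (vok f k)%:R + (hok f k)%:R = (swaps f k)%:R :> int.
Proof.
move=> /mirror_okE fm; rewrite inE => /andP[_ /eqP ax].
have e r : f (vtx W k.1.+1 r) = f (vtx W k.1 r).
  have mid c n : c.*2.+1 = n -> c.+1 = (n - c)%N by lia.
  by rewrite (mid _ _ ax) fm //; exact: ltnW (ltn_ord k.1).
rewrite /vok /hok /swaps !e !eqxx.
by do 2!case: (f _).
Qed.

Lemma sym_weight (y : {set crossing W}) f : y \subset left_half -> mirror_ok f ->
  (-1) ^+ (uv (symmetrize y) + ph (symmetrize y)) *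
    [forall k in crossings W, cross_ok f (symmetrize y) k]%:R =
  \prod_(k in left_half) (if k \in y then (if k \in axis then - (vok f k)%:R else (vok f k)%:R)
                     else (if k \in axis then (hok f k)%:R else - (hok f k)%:R)) :> int.
Proof.
move=> yh fm; rewrite (forall_half (P := cross_ok f (symmetrize y))); last first.
  move=> k; rewrite /cross_ok (mem_mirror (symmetrize_sym y)).
  by have [-> -> _] := local_mirror k fm.
rewrite uvE (phE (symmetrize_sym y)) exprD -!prod_sign -prod_bool -!big_split.
apply: eq_bigr => k kh; rewrite /cross_ok mem_symmetrize //=.
by case: (k \in y); case: (k \in axis); rewrite /= ?expr0 ?expr1 ?mul1r ?mulN1r.
Qed.

Lemma card_sym_colourings x (s : 'I_m -> bool) : x \in sym_uncrossings W ->
  #|[set f | ((free_ok f && [forall k in crossings W, cross_ok f x k]) && mirror_ok f) &&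
      on_boundary (s \o @row_of m) f]|
  = (2 ^ sym_loops x * [forall p, s (row_of (resolve x p)) == s (row_of p)])%N.
Proof.
rewrite !inE => /andP[xW /eqP mx].
case: (boolP [forall p, _]) => [/forallP sx|/forallPn[p np]].
  rewrite muln1 card_sym_loop_colourings // => [p|[]//].
  exact/eqP/sx.
rewrite muln0; apply/eqP; rewrite cards_eq0; apply/eqP/setP => f; rewrite !inE.
apply/negP => /andP[/andP[/(strand_constP pW f xW) fx _] /forallP fs].
have := fs (resolve x p); have := fs p; rewrite /= => /eqP e1 /eqP e2.
move: np; rewrite -e1 -e2 (fx _ (end_vertex W p)) ?eqxx //.
by rewrite strandE strand_sym; have [] := resolveP pW xW p.
Qed.

(** In the middle column a wire and its mirror image occupy two rows exchanged by the middle layer.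
    These have opposite parity while [t] is the same, so exactly one of the two colours is 1. *)
Lemma ones_half t q : m = q.*2 -> (forall a, t (wire_end W a) = t a) -> ones W t L./2 = q.
Proof.
move=> mq tW; pose D := wire_colour W t L./2.
pose c a := wire_at W L./2 a.
have flip a : D (c (wire_end W a)) = ~~ D (c a).
  have [oL e] := wire_at_half a; rewrite /D /wire_colour /c !permK tW -e.
  rewrite odd_layer_perm ?proper_nth //.
  suff -> : touched (nth set0 W L./2) (wire_at W L./2 a) by rewrite addbT addbN.
  apply: contraTT isT => nt; move: e; rewrite layer_perm_out ?proper_nth //.
  by move/perm_inj=> ea; have := freeW a; rewrite -ea eqxx.
have sumD : (\sum_r D r = \sum_a D (c a))%N.
  by rewrite (reindex_inj (@perm_inj _ (wire_at W L./2))).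
have : (\sum_r D r + \sum_r D r = m)%N.
  rewrite {1}sumD {1}(reindex_inj (@perm_inj _ (wire_end W))) /= sumD -big_split /=.
  rewrite -[RHS](card_ord m) -sum1_card; apply: eq_bigr => a _.
  by rewrite flip; case: (D _).
by rewrite /ones -/D addnn => e; apply: double_inj; apply: etrans e mq.
Qed.

Lemma sym_state_sum (s : 'I_m -> bool) q : m = q.*2 ->
  \sum_(x in sym_uncrossings W)
     sym_wt x * [forall p, s (row_of (resolve x p)) == s (row_of p)]%:R =
  (-1) ^+ (#|left_part| + 'C(\sum_i s i, 2) + 'C(q, 2)) *
  [forall a, s (wire_end W a) (+) odd (wire_end W a) == s a (+) odd a]%:R :> int.
Proof.
move=> mq; pose t a := s a (+) odd a; pose bd f := on_boundary (s \o @row_of m) f.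
transitivity (\sum_f \sum_(y in powerset left_half) (bd f && mirror_ok f)%:R * (free_ok f)%:R *
    \prod_(k in left_half) (if k \in y then (if k \in axis then - (vok f k)%:R else (vok f k)%:R)
                     else (if k \in axis then (hok f k)%:R else - (hok f k)%:R)) : int).
  rewrite exchange_big sum_sym_uncrossings; apply: eq_bigr => y; rewrite inE => yh.
  have ysym : symmetrize y \in sym_uncrossings W.
    by rewrite !inE symmetrizeW // symmetrize_sym eqxx.
  rewrite /sym_wt -[2%:Z]natz mulrAC -natrX -natrM -card_sym_colourings // sum_colourings mulrC mulr_sumr.
  apply: eq_bigr => f _; rewrite -/(bd f).
  case: (boolP (mirror_ok f)) => fm; last by rewrite !andbF !mul0r mulr0.
  rewrite -sym_weight // [RHS]mulrCA; congr (_ * _).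
  by case: (free_ok f); case: (bd f); rewrite ?mul0r ?mul1r ?mulr0 ?andbF ?andbT.
transitivity (\sum_f (bd f && mirror_ok f && (f == colouring W t))%:R *
    \prod_(k in left_part) - (-1) ^+ same f k : int).
  apply: eq_bigr => f _; rewrite -mulr_sumr sum_powerset_prod.
  case: (boolP (mirror_ok f)) => fm; last by rewrite !andbF /= !mul0r.
  (* Off the axis the factor is [swap_weight], on the axis it is the unsigned condition; so the
     signs form a product over [left_part]. *)
  rewrite (eq_bigr (fun k => (if k \in left_part then - (-1) ^+ same f k else 1) * (swaps f k)%:R)); last first.
    move=> k kh; have -> : (k \in left_part) = (k.1.*2.+1 < size W)%N.
      by rewrite left_partE inE (subsetP halfW _ kh).
    case: (boolP (k \in axis)) => ka.
      rewrite /= axis_weight //; move: ka; rewrite inE => /andP[_ /eqP->].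
      by rewrite ltnn mul1r.
    have -> : (k.1.*2.+1 < size W)%N.
      by move: kh ka; rewrite !inE => /andP[-> kh] /=; rewrite ltn_neqAle kh andbT.
    exact: swap_weight.
  rewrite big_split /= prod_bool mulrCA [RHS]mulrC; congr (_ * _).
    rewrite big_mkcond [RHS]big_mkcond; apply: eq_bigr => k _.
    rewrite !inE ltn_halfE.
    by case: (k.2 \in _) => //=; case: (boolP (k.1.*2.+1 < size W)%N) => [/ltnW->|_] //; rewrite if_same.
  rewrite -(forall_half (P := swaps f)); last by move=> k; have [] := local_mirror k fm.
  rewrite -mulrA -!natrM !mulnb !andbT; congr (nat_of_bool _)%:R.
  case: (boolP (bd f)) => //= /forallP fs.
  have e0 a : f (vtx W 0 a) (+) odd a = t a.
    rewrite /t -[s a]/((s \o @row_of m) (inl a)) -(eqP (fs (inl a))); congr (f _ (+) _).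
    by rewrite /vtx; congr pair; apply: val_inj; rewrite /= inordK.
  apply/(swapsP pW)/eqP => [->|->].
    by apply/ffunP => v; rewrite !ffunE /wire_colour e0.
  apply/ffunP => v; rewrite !ffunE /wire_colour; congr addb.
  by rewrite colouringE // wire_colour0 -addbA addbb addbF.
rewrite (bigD1 (colouring W t)) //= [X in _ + X]big1 ?addr0 => [|f /negbTE->]; last by rewrite andbF mul0r.
rewrite eqxx andbT mulrC.
have E0 i : ((0, i) : vertex W) = vtx W 0 i.
  by rewrite /vtx; congr pair; apply: val_inj; rewrite /= inordK.
have EL i : ((ord_max, i) : vertex W) = vtx W (size W) i.
  by rewrite /vtx; congr pair; apply: val_inj; rewrite /= inordK.
have bdE : bd (colouring W t) =
    [forall a, s (wire_end W a) (+) odd (wire_end W a) == s a (+) odd a].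
  apply/forallP/forallP => [fs a|fs [i|i]] /=.
  - have := fs (inr (wire_end W a)); rewrite /= EL colouringE // /wire_colour permK => /eqP <-.
    by rewrite -addbA addbb addbF.
  - by rewrite E0 colouringE // wire_colour0 /t -addbA addbb addbF.
  rewrite EL colouringE // /wire_colour -/(wire_end W) /t.
  by rewrite -(eqP (fs _)) permKV -addbA addbb addbF.
case: (boolP [forall a, _]) => [|nvalid]; last first.
  by rewrite bdE (negbTE nvalid) !mulr0.
move=> valid; have bdT : bd (colouring W t) by rewrite bdE.
have tW a : t (wire_end W a) = t a by apply/eqP; have /forallP := valid; apply.
(* A wire and its mirror image have the same value of [t], so the surviving colouring is
   symmetric. *)
have -> : mirror_ok (colouring W t).
  apply/mirror_okE => c r cL; rewrite !colouringE ?leq_subr // /wire_colour; congr addb.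
  rewrite -tW; congr t; apply: (@perm_inj _ (wire_at W c)).
  by rewrite -wire_at_mirror // !permKV.
rewrite bdT !mulr1 prod_same //.
  rewrite (ones_half mq tW); congr (_ ^+ (_ + 'C(_, 2) + _)); apply: eq_bigr => i _.
  by rewrite wire_colour0 /t -addbA addbb addbF.
by rewrite leq_half_double -addnn -addSn leq_addl.
Qed.

End SymStateSum.

(** * Symmetric diagrams are separated by colourings *)

Section Diagrams.
Variable m : nat.
Implicit Types (f D : diagram m) (p q : point m) (i j l : 'I_m).

Lemma matchingP f : is_matching f -> (forall p, f p != p) /\ involutive f.
Proof. by move/forallP=> fm; split=> p; have /andP[? /eqP] := fm p. Qed.

Lemma noncrossingP f p q : noncrossing f -> (label p < label q)%N ->
  (label q < label (f p))%N -> (label (f p) < label (f q))%N -> False.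
Proof.
by move=> /existsPn/(_ p)/existsPn/(_ q) + h1 h2 h3; rewrite h1 h2 h3.
Qed.

(** A partner of [l] outside the interval would make the two edges cross. *)
Lemma nested_left f i j l : f \in TL m -> f (inl i) = inl j -> (i < l < j)%N ->
  exists2 l', f (inl l) = inl l' & (i < l' < j)%N.
Proof.
rewrite inE => /andP[/matchingP[ff fK] nf] fi /andP[il lj].
have nc := noncrossingP nf.
have := nc (inl i) (inl l); rewrite fi /= => nc1.
case fl: (f (inl l)) => [l'|l'].
  exists l' => //; rewrite fl /= in nc1.
  have l'j : l' != j by apply: contraTneq il => e; have := fK (inl l); rewrite fl e -fi fK => -[->]; rewrite ltnn.
  have l'i : l' != i by apply: contraTneq lj => e; have := fK (inl l); rewrite fl e fi => -[->]; rewrite ltnn.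
  have fl' : f (inl l') = inl l by rewrite -fl fK.
  have := nc (inl l') (inl i); rewrite fl' fi /= => nc2.
  move: l'j l'i; rewrite -!val_eqE /=; lia.
by rewrite fl /= in nc1; have := ltn_ord j; have := ltn_ord l'; lia.
Qed.

Lemma nested_right f i j l : f \in TL m -> f (inr i) = inr j -> (i < l < j)%N ->
  exists2 l', f (inr l) = inr l' & (i < l' < j)%N.
Proof.
rewrite inE => /andP[/matchingP[ff fK] nf] fi /andP[il lj].
have fj : f (inr j) = inr i by rewrite -fi fK.
have nc := noncrossingP nf.
have im := ltn_ord i; have jm := ltn_ord j; have lm := ltn_ord l.
case fl: (f (inr l)) => [l'|l']; have l'm := ltn_ord l'.
  have fl' : f (inl l') = inr l by rewrite -fl fK.
  by have := nc (inl l') (inr j); rewrite fl' fj /=; lia.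
have l'j : l' != j by apply: contraTneq il => e; have := fK (inr l); rewrite fl e fj => -[->]; rewrite ltnn.
have l'i : l' != i by apply: contraTneq lj => e; have := fK (inr l); rewrite fl e fi => -[->]; rewrite ltnn.
exists l' => //; move: l'j l'i; rewrite -!val_eqE /=.
have := nc (inr j) (inr l); rewrite fl fj /=.
have fl' : f (inr l') = inr l by rewrite -fl fK.
have := nc (inr l') (inr j); rewrite fl' fj /=.
lia.
Qed.

Lemma even_between (g : 'I_m -> 'I_m) i j : (i < j)%N ->
  (forall l, (i < l < j)%N -> [/\ (i < g l < j)%N, g l != l & g (g l) = l]) -> odd i != odd j.
Proof.
move=> ij gP; have := @even_card_involution _ g [set l : 'I_m | (i < l < j)%N].
have -> : #|[set l : 'I_m | (i < l < j)%N]| = (j - i.+1)%N.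
  rewrite -sum1_card (eq_bigl (fun l : 'I_m => (i < l < j)%N)) => [|l]; last by rewrite inE.
  rewrite -(big_mkord (fun l : nat => (i < l < j)%N) (fun=> 1%N)).
  rewrite (big_cat_nat (n := i.+1)) //=.
  rewrite big_nat_cond big_pred0 ?add0n; last by move=> l; case: (ltnP i l) => //; lia.
  rewrite (big_cat_nat (n := j)) //=; last exact: ltnW.
  rewrite addnC big_nat_cond big_pred0 ?add0n; last by move=> l; lia.
  rewrite big_nat_cond (eq_bigl (fun l : nat => (i < l < j)%N)); last by move=> l; lia.
  by rewrite -big_nat sum_nat_const_nat muln1.
move=> ev; have {ev} : ~~ odd (j - i.+1).
  apply: ev => l; rewrite !inE => /gP[ib gn gg]; split=> //.
by rewrite oddB //=; case: (odd i); case: (odd j).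
Qed.

(** The points under an arc are matched among themselves, so their number is even. *)
Lemma arc_parity f i j : f \in TL m -> f (inl i) = inl j -> odd i != odd j.
Proof.
move=> fT; wlog ij : i j / (i < j)%N.
  move=> IH fi; have := fT; rewrite inE => /andP[/matchingP[ff fK] _].
  have [ij|ji|/val_inj e] := ltngtP i j; first exact: IH.
    by rewrite eq_sym; apply: IH => //; rewrite -fi fK.
  by have := ff (inl i); rewrite fi e eqxx.
move=> fi; apply: (@even_between (fun l => row_of (f (inl l)))) => // l il.
have [l' fl l'P] := nested_left fT fi il.
have := fT; rewrite inE => /andP[/matchingP[ff fK] _].
rewrite fl /= -fl fK; split=> //.
by have := ff (inl l); rewrite fl; apply: contraNneq => ->.
Qed.

Section SymTL.
Variable D : diagram m.
Hypothesis DT : D \in symTL m.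

Lemma symTL_TL : D \in TL m. Proof. by move: DT; rewrite inE => /andP[]. Qed.

Lemma symTLK : involutive D.
Proof. by have := symTL_TL; rewrite inE => /andP[/matchingP[]]. Qed.

Lemma symTL_neq p : D p != p.
Proof. by have := symTL_TL; rewrite inE => /andP[/matchingP[]]. Qed.

Lemma symTL_mirror p : D (mirror p) = mirror (D p).
Proof. by move: DT; rewrite inE => /andP[_ /forallP/(_ p)/eqP]. Qed.

(** Otherwise the edge would cross its mirror image. *)
Lemma horizontal i j : D (inl i) = inr j -> j = i.
Proof.
wlog ij : i j / (i < j)%N => [IH Di|Di].
  have Dj : D (inl j) = inr i by rewrite -[inl j]/(mirror (inr j)) symTL_mirror -Di symTLK.
  by have [ij|ji|/val_inj ->//] := ltngtP i j; [apply: IH|symmetry; apply: IH].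
have Dj : D (inl j) = inr i by rewrite -[inl j]/(mirror (inr j)) symTL_mirror -Di symTLK.
have := symTL_TL; rewrite inE => /andP[_ /(@noncrossingP _ (inl i) (inl j))].
rewrite Di Dj /= => nc; have := ltn_ord i; have := ltn_ord j; move: nc; lia.
Qed.

Definition openers : {set 'I_m} := [set i : 'I_m | [exists j : 'I_m, (i < j)%N && (D (inl i) == inl j)]].

Lemma openersP i : reflect (exists2 j : 'I_m, (i < j)%N & D (inl i) = inl j) (i \in openers).
Proof.
rewrite inE; apply: (iffP existsP) => -[j]; first by case/andP => ij /eqP e; exists j.
by move=> ij e; exists j; rewrite ij e eqxx.
Qed.

Lemma closer_notin i j : (i < j)%N -> D (inl i) = inl j -> j \notin openers.
Proof.
move=> ij Di; apply/openersP => -[l jl]; rewrite -Di symTLK => -[e].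
by move: jl; rewrite -e; lia.
Qed.

Lemma non_opener i j : i \notin openers -> D (inl i) = inl j -> (j < i)%N /\ j \in openers.
Proof.
move=> ni Di; have ji : (j < i)%N.
  rewrite ltnNge leq_eqVlt; apply/negP => /orP[/eqP/val_inj e|ij].
    by have := symTL_neq (inl i); rewrite Di e eqxx.
  by move/openersP: ni; case; exists j.
by split=> //; apply/openersP; exists i; rewrite // -Di symTLK.
Qed.

Definition agrees (s : 'I_m -> bool) : bool := [forall p, s (row_of (D p)) == s (row_of p)].

(** The ends of an arc have opposite parity, so the twist turns equality of colours into difference;
    horizontal edges impose nothing. In particular the indicator of the upper ends of the arcs is
    admissible. *)
Lemma agreesP (tau : 'I_m -> bool) :
  reflect (forall i j, D (inl i) = inl j -> tau i != tau j) (agrees (fun i => tau i (+) odd i)).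
Proof.
have flip i j : D (inl i) = inl j ->
    (tau j (+) odd j == tau i (+) odd i) = (tau i != tau j).
  move=> Di; have := arc_parity symTL_TL Di.
  by case: (tau i); case: (tau j); case: (odd i); case: (odd j).
apply: (iffP forallP) => [Ds i j Di|Dt].
  by have := Ds (inl i); rewrite Di /= flip.
have left i : tau (row_of (D (inl i))) (+) odd (row_of (D (inl i))) == tau i (+) odd i.
  by case Di: (D (inl i)) => [j|j] /=; [rewrite flip // Dt|rewrite (horizontal Di)].
case=> i; first exact: left.
by rewrite -[inr i]/(mirror (inl i)) symTL_mirror; case: (D (inl i)) (left i).
Qed.

(** The statistic that makes the matrix triangular. The summand is [i.+1] so that the loss of an
    opener in row 0 also lowers it. *)
Definition weight : nat := (\sum_(i in openers) i.+1)%N.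

End SymTL.

(** Arcs are recovered from their upper ends like parentheses, starting from the lowest opener. If
    the partner of [o] were further down in one diagram than its partner [j] in the other, then [j]
    would belong to an arc opening below [o], and this arc is common to both diagrams by
    induction. *)
Lemma openers_inj D D' : D \in symTL m -> D' \in symTL m -> openers D = openers D' -> D = D'.
Proof.
move=> DT DT' eqO.
have half_step D1 D2 (o : 'I_m) : D1 \in symTL m -> D2 \in symTL m -> openers D1 = openers D2 ->
   (forall l, (o < l)%N -> l \in openers D1 -> D1 (inl l) = D2 (inl l)) ->
   forall j j', D1 (inl o) = inl j -> D2 (inl o) = inl j' -> (o < j)%N -> (j' <= j)%N.
  move=> T1 T2 eO IH j j' e1 e2 oj; rewrite leqNgt; apply/negP => jj'.
  have [|l e2l /andP[ol lj']] := nested_left (symTL_TL T2) e2 (l := j); first by rewrite oj jj'.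
  have nj : j \notin openers D2 by rewrite -eO (closer_notin T1 oj).
  have [lj lO] := non_opener T2 nj e2l.
  have e1l : D1 (inl l) = inl j by rewrite IH ?eO // -e2l symTLK.
  by move: ol; have := symTLK T1 (inl l); rewrite e1l -e1 symTLK // => -[->]; rewrite ltnn.
have eq_open (o : 'I_m) : o \in openers D -> D (inl o) = D' (inl o).
  have [N] := ubnP (m - o); elim: N o => // N IH o Nm oO.
  have IHo l : (o < l)%N -> l \in openers D -> D (inl l) = D' (inl l).
    by move=> ol; apply: IH; have := ltn_ord l; move: ol Nm; lia.
  have /openersP[j oj e] := oO; have := oO; rewrite eqO => /openersP[j' oj' e'].
  have jj' := half_step _ _ _ DT DT' eqO IHo _ _ e e' oj.
  have j'j : (j <= j')%N.
    apply: (half_step _ _ _ DT' DT (esym eqO) _ _ _ e' e oj') => l ol lO.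
    by symmetry; apply: IHo; rewrite ?eqO.
  by rewrite e e'; congr inl; apply: val_inj; apply/eqP; rewrite eqn_leq j'j jj'.
have eq_left i : D (inl i) = D' (inl i).
  have [/eq_open //|ni] := boolP (i \in openers D).
  have ni' : i \notin openers D' by rewrite -eqO.
  case e: (D (inl i)) => [j|j]; case e': (D' (inl i)) => [j'|j'].
  - have [_ jO] := non_opener DT ni e.
    have e2 : D' (inl j) = inl i by rewrite -eq_open // -e symTLK.
    by rewrite -e' -e2 symTLK.
  - have [_ jO] := non_opener DT ni e.
    have e2 : D' (inl j) = inl i by rewrite -eq_open // -e symTLK.
    by rewrite -e2 symTLK in e'.
  - have [_ jO] := non_opener DT' ni' e'; rewrite -eqO in jO.
    have e2 : D (inl j') = inl i by rewrite eq_open // -e' symTLK.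
    by rewrite -e2 symTLK in e.
  - by rewrite (horizontal DT e) (horizontal DT' e').
apply/ffunP => -[i|i]; first exact: eq_left.
by rewrite -[inr i]/(mirror (inl i)) !symTL_mirror // eq_left.
Qed.

Lemma agrees_opener D : D \in symTL m -> agrees D (fun i => (i \in openers D) (+) odd i).
Proof.
move=> DT; apply/(agreesP DT) => i j Di.
have [iO|ni] := boolP (i \in openers D); last by have [_ ->] := non_opener DT ni Di.
have /openersP[j' ij'] := iO; rewrite Di => -[jj'].
by rewrite (negbTE (closer_notin DT _ Di)) // jj'.
Qed.

(** Each arc of [D'] has exactly one end that is an opener of [D]. Sending the upper end of the arc
    to that end is an injection [phi] of [openers D'] into [openers D] that never decreases the
    row. *)
Lemma agrees_weight D D' : D \in symTL m -> D' \in symTL m ->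
  agrees D' (fun i => (i \in openers D) (+) odd i) -> D' != D -> (weight D' < weight D)%N.
Proof.
move=> DT DT' /(agreesP DT') DD' neq.
pose phi i := if i \in openers D then i else row_of (D' (inl i)).
have phiO i : i \in openers D' -> [/\ (i <= phi i)%N, phi i \in openers D & i \notin openers D -> (i < phi i)%N].
  move/openersP => [j ij e]; rewrite /phi e /=; have := DD' i j e.
  by case: ifP => iO; rewrite ?iO //= => jO; split=> //; [exact: ltnW|case: (j \in _) jO].
have phi_inj : {in openers D' &, injective phi}.
  move=> i i' iO iO'; have /openersP[j ij e] := iO; have /openersP[j' ij' e'] := iO'.
  rewrite /phi e e' /=; case: ifP => _; case: ifP => _ //.
  - by move=> ee; move: iO; rewrite ee (negbTE (closer_notin DT' ij' e')).
  - by move=> ee; move: iO'; rewrite -ee (negbTE (closer_notin DT' ij e)).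
  by move=> ee; have := symTLK DT' (inl i); rewrite e ee -e' symTLK // => -[].
have sub : phi @: openers D' \subset openers D.
  by apply/subsetP => y /imsetP[i /phiO[_ iO _] ->].
have le2 : (\sum_(i in openers D') (phi i).+1 <= weight D)%N.
  rewrite -(big_imset (fun i : 'I_m => i.+1) phi_inj) /weight /=.
  by rewrite [leqRHS](big_setID (phi @: openers D')) /= (setIidPr sub) leq_addr.
(* If an opener of [D'] is not one of [D], then [phi] strictly increases it. Otherwise [openers D']
   is a proper subset of [openers D], by [openers_inj]. *)
have [subO|/subsetPn[i iO' niO]] := boolP (openers D' \subset openers D); last first.
  apply: leq_trans le2; rewrite /weight (bigD1 i) //= [leqRHS](bigD1 i) //=.
  have [_ _ /(_ niO) lt] := phiO i iO'.
  by rewrite -addSn; apply: leq_add => //; apply: leq_sum => l /andP[/phiO[]].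
have /subsetPn[i iO niO'] : ~~ (openers D \subset openers D').
  apply: contra neq => subO'; apply/eqP/openers_inj => //; apply/eqP.
  by rewrite eqEsubset subO subO'.
rewrite /weight [ltnRHS](big_setID (openers D')) /= (setIidPr subO) -addn1 leq_add2l.
by rewrite (bigD1 i) ?in_setD ?niO' ?iO.
Qed.

(** Tested against the openers of [D], the relation involves besides [q D] only diagrams of smaller
    weight, where [q] vanishes by induction. *)
Lemma agrees_independent (q : diagram m -> int) :
  (forall s : 'I_m -> bool, \sum_(D in symTL m) q D * (agrees D s)%:R = 0) ->
  forall D, D \in symTL m -> q D = 0.
Proof.
move=> q0 D; have [N] := ubnP (weight D); elim: N D => // N IH D wN DT.
have := q0 (fun i => (i \in openers D) (+) odd i).
rewrite (bigD1 D) //= agrees_opener // mulr1 big1 ?addr0 // => D' /andP[DT' neq].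
case: (boolP (agrees _ _)) => [/(agrees_weight DT DT')/(_ neq) lt|_]; last by rewrite mulr0.
by rewrite IH ?mul0r //; apply: leq_trans lt _.
Qed.

End Diagrams.

(** * Embeddings of matchings *)

Section EnumVal.
Variables (m : nat) (T : {set 'I_m}).

Lemma enum_val_ltn (r s : 'I_#|T|) : (enum_val r < enum_val s)%N = (r < s)%N.
Proof.
have srt : sorted (fun i j : 'I_m => (i < j)%N) (enum T).
  rewrite /enum_mem; apply: sorted_filter; first by move=> i j l; apply: ltn_trans.
  rewrite -enumT; have := iota_ltn_sorted 0 m; rewrite -val_enum_ord.
  by rewrite sorted_map.
have lt (a b : 'I_#|T|) : (a < b)%N -> (enum_val a < enum_val b)%N.
  have [x0 _] : exists x0 : 'I_m, true by exists (enum_val a).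
  move=> ab; rewrite !(enum_val_nth x0).
  apply: (sorted_ltn_nth (leT := fun i j : 'I_m => (i < j)%N)) => //.
  - by move=> i j l; apply: ltn_trans.
  - by rewrite inE -cardE.
  - by rewrite inE -cardE.
apply/idP/idP => [|/lt//]; apply: contraLR; rewrite -!leqNgt => rs.
move: rs; rewrite leq_eqVlt => /orP[/eqP/val_inj->//|/lt/ltnW//].
Qed.

Lemma card_ltn n (i : 'I_n) : #|[set j : 'I_n | (j < i)%N]| = i.
Proof.
rewrite -sum1_card (eq_bigl (fun j : 'I_n => (j < i)%N)) => [|j]; last by rewrite inE.
by rewrite (big_ord_narrow (ltnW (ltn_ord i))) sum1_card card_ord.
Qed.

Lemma enum_val_rank (r : 'I_#|T|) : nat_of_ord r = #|[set j in T | (j < enum_val r)%N]|.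
Proof.
rewrite -[LHS]card_ltn -(card_imset _ (@enum_val_inj _ T)); apply: eq_card => j.
apply/imsetP/idP => [[r']|]; first by rewrite !inE => rr' ->; rewrite enum_valP enum_val_ltn.
rewrite inE => /andP[jT jr]; exists (enum_rank_in jT j); last by rewrite enum_rankK_in.
by rewrite inE -enum_val_ltn enum_rankK_in.
Qed.

End EnumVal.

Lemma label_left_right n (a b : 'I_n) : (label (inl a : point n) < label (inr b : point n))%N.
Proof. by rewrite /=; have := ltn_ord a; have := ltn_ord b; lia. Qed.

Lemma label_right_left n (a b : 'I_n) :
  (label (inr a : point n) < label (inl b : point n))%N = false.
Proof. by rewrite ltnNge ltnW // label_left_right. Qed.

Lemma label_left n (a b : 'I_n) :
  (label (inl a : point n) < label (inl b : point n))%N = (a < b)%N.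
Proof. by []. Qed.

Lemma label_right n (a b : 'I_n) :
  (label (inr a : point n) < label (inr b : point n))%N = (b < a)%N.
Proof. by rewrite /=; have := ltn_ord a; have := ltn_ord b; lia. Qed.

(** * State sums of a symmetric matching, for [nu(pi)] and [nu(d)] alike *)

Section Embedding.
Variables (m : nat) (nu : diagram m) (W : embedding nu).
Let T := through nu.
Hypothesis nice : nice_embedding W.
Hypothesis numatch : is_matching nu.
Hypothesis numirror : forall p, nu (mirror p) = mirror (nu p).
Hypothesis nuplanar : forall i j l : 'I_m, nu (inl i) = inl j -> (i < l < j)%N ->
  exists2 l' : 'I_m, nu (inl l) = inl l' & (i < l' < j)%N.
Hypothesis nufree : forall i : 'I_m, nu (inl i) != inr i.

Let partner (i : 'I_m) : 'I_m := row_of (nu (inl i)).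

Lemma nuK : involutive nu. Proof. by have [] := matchingP numatch. Qed.
Lemma nu_neq p : nu p != p. Proof. by have [+ _] := matchingP numatch; apply. Qed.

Lemma in_through i : i \in T -> nu (inl i) = inr (partner i).
Proof. by rewrite inE /partner; case: (nu (inl i)). Qed.

Lemma notin_through i : i \notin T -> nu (inl i) = inl (partner i).
Proof. by rewrite inE /partner; case: (nu (inl i)). Qed.

Lemma partnerK : involutive partner.
Proof.
move=> i; rewrite /partner; case e: (nu (inl i)) => [j|j] /=; first by rewrite -e nuK.
by rewrite -[inl j]/(mirror (inr j)) -e numirror nuK.
Qed.

Lemma partner_through i : (partner i \in T) = (i \in T).
Proof.
have imp j : j \in T -> partner j \in T.
  move=> jT; rewrite inE -[inl _]/(mirror (inr (partner j))) -in_through // numirror nuK //.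
by apply/idP/idP => [/imp|/imp //]; rewrite partnerK.
Qed.

Lemma point_cases p : (exists2 q : point #|T|, p = strand_point q & row_of p \in T) \/ (row_of p \notin T).
Proof.
have [pT|] := boolP (row_of p \in T); [left|by right].
case: p pT => i /= iT; [exists (inl (enum_rank_in iT i))|exists (inr (enum_rank_in iT i))] => //=;
by rewrite enum_rankK_in.
Qed.

Lemma row_strand_point (q : point #|T|) : row_of (strand_point q) = enum_val (row_of q).
Proof. by case: q. Qed.

Lemma strand_point_inj : injective (@strand_point m T).
Proof. by case=> r [] s //= [/enum_val_inj->]. Qed.

Lemma strand_point_label (q q' : point #|T|) :
  (label (strand_point q) < label (strand_point q'))%N = (label q < label q')%N.
Proof.
by case: q q' => [r|r] [s|s]; rewrite ?label_left ?label_right ?label_left_right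
  ?label_right_left ?enum_val_ltn.
Qed.

Section Resolve.
Variable x : {set crossing W}.
Hypothesis xsym : x \in sym_uncrossings W.

Let pW : proper_wiring W. Proof. by case/and4P: nice. Qed.
Let sW : symmetric_wiring W. Proof. by case/and4P: nice. Qed.
Let xW : x \subset crossings W. Proof. by move: xsym; rewrite !inE => /andP[]. Qed.
Let mx : (@mirror_crossing _ W) @: x = x.
Proof. by move: xsym; rewrite !inE => /andP[_ /eqP]. Qed.

Lemma resolve_in_strand q : resolve_in (nu := nu) x (strand_point q) = strand_point (resolve x q).
Proof.
rewrite ffunE; case: pickP => [q' /eqP/strand_point_inj->//|/(_ q)].
by rewrite eqxx.
Qed.

Lemma resolve_in_out p : row_of p \notin T -> resolve_in (nu := nu) x p = nu p.
Proof.
move=> pT; rewrite ffunE; case: pickP => // q /eqP e.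
by move: pT; rewrite -e row_strand_point enum_valP.
Qed.

Lemma row_nu p : row_of (nu p) = partner (row_of p).
Proof.
case: p => i //; rewrite /partner -[inr i]/(mirror (inl i)) numirror.
by case: (nu _).
Qed.

Lemma row_nu_out p : row_of p \notin T -> row_of (nu p) \notin T.
Proof. by move=> pT; rewrite row_nu partner_through. Qed.

Lemma resolve_mirror q : resolve x (mirror q) = mirror (resolve x q).
Proof.
have [_ qf _] := resolveP pW xW q; have [_ _ fu] := resolveP pW xW (mirror q).
have end_mirror p : end_vertex W (mirror p) = mirror_vertex (end_vertex W p).
  by case: p => i; rewrite /mirror_vertex /=; congr pair; apply: val_inj; rewrite /= ?subSS ?subn0 ?subnn.
have : strand x (end_vertex W (mirror q)) (end_vertex W (mirror (resolve x q))).
  by rewrite !end_mirror strand_mirror.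
rewrite fu => /orP[/eqP|/eqP->//] e; have [+ _ _] := resolveP pW xW q.
suff -> : resolve x q = q by rewrite eqxx.
by case: (resolve x q) e; case: (q) => // r s [->].
Qed.

Lemma same_side p : row_of p \notin T -> 
  match p with inl i => nu p = inl (partner i) | inr i => nu p = inr (partner i) end.
Proof.
case: p => i /= iT; first exact: notin_through.
by rewrite -[inr i]/(mirror (inl i)) numirror notin_through.
Qed.

Lemma nu_between (i l : 'I_m) : i \notin T -> (i < l < partner i)%N ->
  l \notin T /\ (i < partner l < partner i)%N.
Proof.
move=> iT il; have [l' e l'P] := nuplanar (notin_through iT) il.
have -> : partner l = l' by rewrite /partner e.
by split=> //; rewrite inE e.
Qed.

Lemma nu_between' (i l : 'I_m) : i \notin T -> (partner i < l < i)%N ->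
  l \notin T /\ (partner i < partner l < i)%N.
Proof.
move=> iT; have := @nu_between (partner i) l.
by rewrite partnerK partner_through => /(_ iT).
Qed.

(** Between the ends of the strands this is the planarity of the resolved wiring. An edge with both
    ends on one side has no end of a strand between its ends, by [nu_between], so it crosses
    nothing. *)
Lemma resolve_in_symTL : resolve_in (nu := nu) x \in symTL m.
Proof.
have matchR := resolve_matching pW xW; have [fR KR] := matchingP matchR.
have ncR := resolve_noncrossing pW xW.
rewrite !inE; apply/andP; split; first apply/andP; first split.
- apply/forallP => p; have [[q -> _]|pT] := point_cases p.
    by rewrite !resolve_in_strand (inj_eq strand_point_inj) fR KR eqxx.
  by rewrite !resolve_in_out ?row_nu_out // nuK eqxx nu_neq.
- apply/existsPn => p; apply/existsPn => p'; apply/and3P => -[].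
  have [[q -> _]|pT] := point_cases p; have [[q' -> _]|pT'] := point_cases p'.
  + rewrite !resolve_in_strand !strand_point_label; exact: noncrossingP.
  + rewrite (resolve_in_out pT') resolve_in_strand => _.
    have := enum_valP (row_of (resolve x q)); rewrite -row_strand_point.
    move: (strand_point (resolve x q)) => b bT.
    have := same_side pT'; case: p' pT' => i iT ->; case: b bT => j jT;
    rewrite ?label_left ?label_right ?label_left_right ?label_right_left // => ij jp.
    * by have [] := @nu_between i j iT; rewrite ?ij ?jp ?jT.
    * by have [] := @nu_between' i j iT; rewrite ?ij ?jp ?jT.
  + rewrite (resolve_in_out pT) => + + _.
    have := enum_valP (row_of q'); rewrite -row_strand_point.
    move: (strand_point q') => b bT.
    have := same_side pT; case: p pT => i iT ->; case: b bT => j jT;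
    rewrite ?label_left ?label_right ?label_left_right ?label_right_left // => ij jp.
    * by have [] := @nu_between i j iT; rewrite ?ij ?jp ?jT.
    * by have [] := @nu_between' i j iT; rewrite ?ij ?jp ?jT.
  + rewrite (resolve_in_out pT) (resolve_in_out pT').
    have := same_side pT'; have := same_side pT.
    case: p pT => i iT ->; case: p' pT' => j jT ->;
    rewrite ?label_left ?label_right ?label_left_right ?label_right_left // => ij jp pp.
    * have [|_ /andP[_]] := @nu_between i j iT; first by rewrite ij.
      by rewrite ltnNge (ltnW pp).
    * have [|_ /andP[+ _]] := @nu_between' i j iT; first by rewrite ij jp.
      by rewrite ltnNge (ltnW pp).
apply/forallP => p; have [[q -> _]|pT] := point_cases p.
  have sm q' : mirror (strand_point q') = strand_point (mirror q') :> point m by case: q'.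
  by rewrite sm !resolve_in_strand resolve_mirror sm.
have pT' : row_of (mirror p) \notin T by case: (p) pT.
by rewrite !resolve_in_out // numirror.
Qed.

Definition outer_agrees (s : 'I_m -> bool) : bool :=
  [forall i, (i \notin T) ==> (s (partner i) == s i)].

Lemma agrees_resolve_in s : agrees (resolve_in (nu := nu) x) s =
  outer_agrees s &&
  [forall q, s (enum_val (row_of (resolve x q))) == s (enum_val (row_of q))].
Proof.
apply/forallP/andP => [sx|[/forallP so /forallP si] p].
  split; apply/forallP.
    move=> i; apply/implyP => iT.
    by have := sx (inl i); rewrite resolve_in_out // row_nu.
  by move=> q; have := sx (strand_point q); rewrite resolve_in_strand !row_strand_point.
have [[q -> _]|pT] := point_cases p.
  by rewrite resolve_in_strand !row_strand_point.
by rewrite resolve_in_out // row_nu; have /implyP := so (row_of p); apply.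
Qed.

End Resolve.

(** The rows above a strand that carry no strand are matched among themselves. So renumbering the
    strands preserves the parity of rows, and with it the twist. *)
Lemma odd_rank (r : 'I_#|T|) : odd (enum_val r) = odd r.
Proof.
pose i := enum_val r; have iT : i \in T by apply: enum_valP.
have := @even_card_involution _ partner [set j | (j \notin T) && (j < i)%N].
have e : #|[set j : 'I_m | (j < i)%N]| =
    (#|[set j in T | (j < i)%N]| + #|[set j | (j \notin T) && (j < i)%N]|)%N.
  rewrite -(cardsID T [set j : 'I_m | (j < i)%N]).
  by congr (_ + _)%N; apply: eq_card => j; rewrite !inE // andbC.
move=> ev; have {ev} ev : ~~ odd #|[set j | (j \notin T) && (j < i)%N]|.
  have mS j : (j \in [set j | (j \notin T) && (j < i)%N]) = (j \notin T) && (j < i)%N.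
    by rewrite in_set.
  apply: ev => j; rewrite !mS => /andP[jT ji].
  rewrite partner_through jT partnerK; split=> //=.
    rewrite ltnNge leq_eqVlt; apply/negP => /orP[/eqP/val_inj ip|ip].
      by move: iT; rewrite ip partner_through (negbTE jT).
    by have [] := @nu_between j i jT; rewrite ?ji ?iT.
  by apply: contra_eq_neq (notin_through jT) => ->; apply: nu_neq.
by rewrite -[enum_val r]/i -(card_ltn i) e oddD (negbTE ev) addbF -enum_val_rank.
Qed.

Lemma partner_wire_end (r : 'I_#|T|) : partner (enum_val r) = enum_val (wire_end W r).
Proof. by have /and4P[_ _ _ /forallP/(_ r)/eqP] := nice; rewrite /partner => ->. Qed.

Lemma card_inversions_through : #|inversions (wire_end W)| =
  #|[set ij : 'I_m * 'I_m | [&& ij.1 \in T, ij.2 \in T, (ij.1 < ij.2)%N & (partner ij.2 < partner ij.1)%N]]|.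
Proof.
pose ev (ab : 'I_#|T| * 'I_#|T|) : 'I_m * 'I_m := (enum_val ab.1, enum_val ab.2).
have ev_inj : injective ev by case=> a b [c d] [/enum_val_inj-> /enum_val_inj->].
rewrite -(card_imset _ ev_inj); apply: eq_card => -[i j]; rewrite inE /=.
apply/imsetP/and4P => [[[a b]]|[iT jT ij pij]].
  rewrite inE /= => /andP[ab eba] [-> ->].
  by rewrite !enum_valP !partner_wire_end !enum_val_ltn ab eba.
exists (enum_rank_in iT i, enum_rank_in jT j); last by rewrite /ev /= !enum_rankK_in.
by rewrite inE /= -!enum_val_ltn -!partner_wire_end !enum_rankK_in // ij.
Qed.

(** With [2q] strands and [q + 2P] inverted pairs, [P] is the number of crossings left of the axis.
    The edges outside the wiring contribute no sign, only the condition [outer_agrees]. *)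
Lemma coef_state_sum (s : 'I_m -> bool) (q P : nat) :
  #|T| = q.*2 ->
  #|[set ij : 'I_m * 'I_m | [&& ij.1 \in T, ij.2 \in T, (ij.1 < ij.2)%N
      & (row_of (nu (inl ij.2)) < row_of (nu (inl ij.1)))%N]]| = (q + P.*2)%N ->
  \sum_(D in symTL m) coef W D * (agrees D s)%:R =
  (-1) ^+ (P + 'C(\sum_(i in T) s i, 2) + 'C(q, 2)) *
  (outer_agrees s && [forall i in T, s (row_of (nu (inl i))) (+) odd (row_of (nu (inl i))) == s i (+) odd i])%:R :> int.
Proof.
move=> Tq invP; have /and4P[pW meetW sW _] := nice.
have freeW r : wire_end W r != r.
  apply: contraNneq (nufree (enum_val r)) => e.
  by rewrite in_through ?enum_valP // partner_wire_end e.
transitivity (\sum_(x in sym_uncrossings W) sym_wt x * (agrees (resolve_in (nu := nu) x) s)%:R : int).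
  rewrite (partition_big (fun x => resolve_in (nu := nu) x) (mem (symTL m))) /=; last first.
    by move=> x; apply: resolve_in_symTL.
  apply: eq_bigr => D _; rewrite /coef mulr_suml.
  by apply: eq_bigr => x /andP[_ /eqP->].
pose s' (r : 'I_#|T|) := s (enum_val r).
have := sym_state_sum pW sW meetW freeW s' Tq.
have leftP : #|left_part W| = P.
  have := card_crossings_half pW sW meetW freeW Tq.
  rewrite card_inversions_through invP => /eqP; rewrite eqn_add2l => /eqP/double_inj; exact.
have -> : (\sum_r s' r = \sum_(i in T) s i)%N by rewrite [RHS]big_enum_val.
have -> : [forall a, s' (wire_end W a) (+) odd (wire_end W a) == s' a (+) odd a] =
    [forall i in T, s (row_of (nu (inl i))) (+) odd (row_of (nu (inl i))) == s i (+) odd i].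
  apply/forallP/forall_inP => [h i iT|h r].
    have := h (enum_rank_in iT i); rewrite /s' -!odd_rank -partner_wire_end.
    by rewrite enum_rankK_in.
  by have := h _ (enum_valP r); rewrite -/(partner _) partner_wire_end !odd_rank.
rewrite leftP -mulnb natrM mulrCA => <-; rewrite mulr_sumr; apply: eq_bigr => x xs.
by rewrite agrees_resolve_in // -mulnb natrM mulrCA.
Qed.

End Embedding.

(** * The matching of a permutation *)

Section PermMatching.
Variable n : nat.
Implicit Types (w : 'S_n) (a b : 'I_n).

Definition perm_matching w : {ffun 'I_(n + n) -> 'I_(n + n)} :=
  [ffun i => match split i with
             | inl a => rshift n (w a)
             | inr b => lshift n (w^-1%g b)
             end].

Lemma split_lshift a : split (lshift n a) = inl a.
Proof. exact: (@unsplitK n n (inl a)). Qed.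

Lemma split_rshift a : split (rshift n a) = inr a.
Proof. exact: (@unsplitK n n (inr a)). Qed.

Lemma perm_matching_left w a : perm_matching w (lshift n a) = rshift n (w a).
Proof. by rewrite ffunE split_lshift. Qed.

Lemma perm_matching_right w a : perm_matching w (rshift n a) = lshift n (w^-1%g a).
Proof. by rewrite ffunE split_rshift. Qed.

Lemma split_ind (P : 'I_(n + n) -> Prop) :
  (forall a, P (lshift n a)) -> (forall a, P (rshift n a)) -> forall i, P i.
Proof. by move=> Pl Pr i; rewrite -(splitK i); case: (split i). Qed.

Lemma perm_matchingP w : is_matching (perm_matching w).
Proof.
apply/forallP; apply: split_ind => a.
  by rewrite perm_matching_left perm_matching_right permK eqxx andbT -val_eqE /=; have := ltn_ord a; lia.
by rewrite perm_matching_right perm_matching_left permKV eqxx andbT -val_eqE /=; have := ltn_ord (w^-1%g a); lia.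
Qed.

Lemma perm_matching_inj : injective perm_matching.
Proof.
move=> w w' /ffunP e; apply/permP => a; have := e (lshift n a).
by rewrite !perm_matching_left => /rshift_inj.
Qed.

Lemma bin2_double : (n * n = n + 'C(n, 2).*2)%N.
Proof.
elim: n => // k; rewrite binS bin1; nia.
Qed.

Lemma inversionsV w : #|inversions (w^-1)%g| = #|inversions w|.
Proof.
pose g (ab : 'I_n * 'I_n) : 'I_n * 'I_n := (w ab.2, w ab.1).
have g_inj : injective g by case=> a b [c d] [/perm_inj-> /perm_inj->].
rewrite -(card_imset (mem (inversions w)) g_inj); apply: eq_card => -[a b].
apply/idP/imsetP => [|[[c d]]]; rewrite inE /=.
  by case/andP=> ab ba; exists ((w^-1)%g b, (w^-1)%g a); rewrite ?inE /g /= ?permKV // ba.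
by case/andP=> cd dc [-> ->]; rewrite inE /= !permK dc.
Qed.

Lemma nu_matching_left (pi : {ffun 'I_(n + n) -> 'I_(n + n)}) i :
  nu_matching pi (inl i) = inr (pi i).
Proof. by rewrite ffunE. Qed.

Lemma nu_matching_right (pi : {ffun 'I_(n + n) -> 'I_(n + n)}) i :
  nu_matching pi (inr i) = inl (pi i).
Proof. by rewrite ffunE. Qed.

Lemma nu_matching_planar w (nu := nu_matching (perm_matching w)) :
  [/\ is_matching nu, (forall p, nu (mirror p) = mirror (nu p)),
      (forall i j l : 'I_(n + n), nu (inl i) = inl j -> (i < l < j)%N ->
        exists2 l' : 'I_(n + n), nu (inl l) = inl l' & (i < l' < j)%N) &
      (forall i, nu (inl i) != inr i)].
Proof.
have /forallP pm := perm_matchingP w.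
split.
- by apply/forallP => -[i|i]; have /andP[_ /eqP e] := pm i;
  rewrite /nu ?(nu_matching_left, nu_matching_right) e eqxx.
- by case=> i; rewrite /nu /= !(nu_matching_left, nu_matching_right).
- by move=> i j l; rewrite /nu nu_matching_left.
by move=> i; have /andP[ne _] := pm i; rewrite /nu nu_matching_left; apply: contraNneq ne => -[->].
Qed.

Lemma through_matching w : through (nu_matching (perm_matching w)) = setT.
Proof. by apply/setP => i; rewrite !inE nu_matching_left. Qed.

(** Pairs of rows within the first half and within the second half give the inversions of [w] and of
    its inverse. All [n * n] mixed pairs are inverted, and [n * n = n + 2 'C(n, 2)]. *)
Lemma card_matching_inversions w (nu := nu_matching (perm_matching w)) (T := through nu) :
  #|[set ij : 'I_(n + n) * 'I_(n + n) | [&& ij.1 \in T, ij.2 \in T, (ij.1 < ij.2)%N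
      & (row_of (nu (inl ij.2)) < row_of (nu (inl ij.1)))%N]]| =
  (n + ('C(n, 2) + #|inversions w|).*2)%N.
Proof.
pose pi := perm_matching w.
transitivity (\sum_(i < n + n) \sum_(j < n + n) ((i < j) && (pi j < pi i)))%N.
  rewrite pair_big /= -sum1_card big_mkcond; apply: eq_bigr => -[i j] _.
  by rewrite in_set /T through_matching !in_setT /nu !nu_matching_left /=; case: (_ && _).
have card_inv (f : 'I_n -> 'I_n) : #|inversions f| = (\sum_(a < n) \sum_(b < n) ((a < b) && (f b < f a)))%N.
  rewrite pair_big /= -sum1_card big_mkcond; apply: eq_bigr => -[a b] _.
  by rewrite inE /=; case: (_ && _).
rewrite big_split_ord /=.
under eq_bigr => a _ do rewrite big_split_ord /=.
under [X in (_ + X)%N]eq_bigr => a _ do rewrite big_split_ord /=.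
rewrite !big_split /=.
have -> : (\sum_(a < n) \sum_(b < n) ((lshift n a < lshift n b) && (pi (lshift n b) < pi (lshift n a))) = #|inversions w|)%N.
  rewrite card_inv; apply: eq_bigr => a _; apply: eq_bigr => b _.
  by rewrite /pi !perm_matching_left /= ltn_add2l.
have -> : (\sum_(a < n) \sum_(b < n) ((lshift n a < rshift n b) && (pi (rshift n b) < pi (lshift n a))) = n * n)%N.
  rewrite -[RHS]/(n * n)%N -[X in (X * _)%N]card_ord -sum_nat_const; apply: eq_bigr => a _.
  rewrite -[RHS]card_ord -sum1_card; apply: eq_bigr => b _.
  rewrite /pi perm_matching_left perm_matching_right /=.
  by rewrite !(ltn_addr _ (ltn_ord _)).
have -> : (\sum_(a < n) \sum_(b < n) ((rshift n a < lshift n b) && (pi (lshift n b) < pi (rshift n a))) = 0)%N.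
  apply: big1 => a _; apply: big1 => b _; rewrite /= ltnNge ltnW //.
  by have := ltn_ord b; lia.
have -> : (\sum_(a < n) \sum_(b < n) ((rshift n a < rshift n b) && (pi (rshift n b) < pi (rshift n a))) = #|inversions (w^-1)%g|)%N.
  rewrite card_inv; apply: eq_bigr => a _; apply: eq_bigr => b _.
  by rewrite /pi !perm_matching_right /= ltn_add2l.
rewrite inversionsV bin2_double.
by move: #|inversions w| 'C(n, 2) => x y; clear; lia.
Qed.

(** Here [q = n] and [P = 'C(n, 2) + #|inversions w|], so the two terms ['C(n, 2)] cancel in the
    sign. *)
Lemma perm_matching_state_sum w (W : embedding (nu_matching (perm_matching w)))
    (s : 'I_(n + n) -> bool) : nice_embedding W ->
  \sum_(D in symTL (n + n)) coef W D * (agrees D s)%:R =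
  (-1) ^+ (#|inversions w| + 'C(\sum_a s (lshift n a) + \sum_a s (rshift n a), 2)) *
  [forall a, s (rshift n (w a)) (+) odd (n + w a) == s (lshift n a) (+) odd a]%:R :> int.
Proof.
move=> nice; have [nu1 nu2 nu3 nu4] := nu_matching_planar w.
have cT : #|through (nu_matching (perm_matching w))| = n.*2.
  by rewrite through_matching cardsT card_ord addnn.
rewrite (coef_state_sum nice nu1 nu2 nu3 nu4 s cT (card_matching_inversions w)).
rewrite through_matching; congr (_ * _).
  apply: sign_parity; rewrite !oddD addbC !addbA addbb addFb; congr (_ (+) odd 'C(_, 2)).
  by rewrite (eq_bigl xpredT) ?big_split_ord // => i; rewrite in_setT.
congr (nat_of_bool _)%:R; apply/andP/forallP => [[_ /forall_inP h] a|h].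
  by have := h (lshift n a) (in_setT _); rewrite nu_matching_left /= perm_matching_left.
split; first by apply/forallP => i; rewrite through_matching in_setT.
apply/forall_inP => i _; rewrite nu_matching_left /=; move: i; apply: split_ind => a.
  by rewrite perm_matching_left; apply: h.
by rewrite perm_matching_right eq_sym; have := h ((w^-1)%g a); rewrite permKV.
Qed.

End PermMatching.

(** * The matching of a TL-diagram *)

Section TLMatching.
Variables (n : nat) (d : diagram n).
Hypothesis dT : d \in TL n.
Implicit Types (a b c : 'I_n) (p : point n).
Let nu := nu_TL d.

Lemma TL_involutive : involutive d.
Proof. by move: dT; rewrite inE => /andP[/matchingP[]]. Qed.

Lemma TL_neq p : d p != p.
Proof. by move: dT; rewrite inE => /andP[/matchingP[]]. Qed.

Lemma TL_noncrossing : noncrossing d.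
Proof. by move: dT; rewrite inE => /andP[]. Qed.

Lemma nu_TL_left a : nu (inl (lshift n a)) = embed_point (d (inl a)).
Proof. by rewrite ffunE split_lshift. Qed.

Lemma nu_TL_right b : nu (inl (rshift n b)) = mirror (embed_point (d (inr b))).
Proof. by rewrite ffunE split_rshift. Qed.

Lemma nu_TL_left' a : nu (inr (lshift n a)) = mirror (embed_point (d (inl a))).
Proof. by rewrite ffunE split_lshift. Qed.

Lemma nu_TL_right' b : nu (inr (rshift n b)) = embed_point (d (inr b)).
Proof. by rewrite ffunE split_rshift. Qed.

Lemma nu_embed p : nu (embed_point p) = embed_point (d p).
Proof. by case: p => a; rewrite /= ?nu_TL_left ?nu_TL_right'. Qed.

Lemma mirrorK m : involutive (@mirror m).
Proof. by case. Qed.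

Lemma nu_TL_mirror (p : point (n + n)) : nu (mirror p) = mirror (nu p).
Proof.
by case: p => i; move: i; apply: split_ind => a;
  rewrite /= ?nu_TL_left ?nu_TL_right ?nu_TL_left' ?nu_TL_right' ?mirrorK.
Qed.

Lemma nu_mirror_embed p : nu (mirror (embed_point p)) = mirror (embed_point (d p)).
Proof. by rewrite nu_TL_mirror nu_embed. Qed.

Lemma embed_cases (P : point (n + n) -> Prop) :
  (forall p, P (embed_point p)) -> (forall p, P (mirror (embed_point p))) -> forall q, P q.
Proof.
move=> P1 P2 [i|i]; move: i; apply: split_ind => a.
- exact: (P1 (inl a)).
- exact: (P2 (inr a)).
- exact: (P2 (inl a)).
- exact: (P1 (inr a)).
Qed.

Lemma embed_inj : injective (@embed_point n).
Proof. by case=> a [] b //= [/eqP]; rewrite ?eqn_add2l => /eqP/val_inj->. Qed.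

Lemma nu_TL_matching : is_matching nu.
Proof.
apply/forallP; apply: embed_cases => p.
  by rewrite !nu_embed TL_involutive eqxx andbT (inj_eq embed_inj) TL_neq.
by rewrite !nu_mirror_embed TL_involutive eqxx andbT (inj_eq (inv_inj (@mirrorK _))) (inj_eq embed_inj) TL_neq.
Qed.

Lemma nu_TL_planar (i j l : 'I_(n + n)) : nu (inl i) = inl j -> (i < l < j)%N ->
  exists2 l' : 'I_(n + n), nu (inl l) = inl l' & (i < l' < j)%N.
Proof.
move: i; apply: split_ind => a.
  rewrite nu_TL_left; case da: (d (inl a)) => [b|b] //= [<-] /=.
  move: l; apply: split_ind => c /= acb; last by have := ltn_ord b; move: acb; clear; lia.
  have [c' dc ac'b] := nested_left dT da acb.
  by exists (lshift n c'); rewrite // nu_TL_left dc.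
rewrite nu_TL_right; case da: (d (inr a)) => [b|b] //= [<-] /=.
move: l; apply: split_ind => c /= acb; first by have := ltn_ord c; move: acb; clear; lia.
rewrite !ltn_add2l in acb; have [c' dc ac'b] := nested_right dT da acb.
by exists (rshift n c'); rewrite /= ?ltn_add2l // nu_TL_right dc.
Qed.

Lemma nu_TL_free (i : 'I_(n + n)) : nu (inl i) != inr i.
Proof.
move: i; apply: split_ind => a.
  rewrite nu_TL_left; case: (d (inl a)) => [b|b] //; apply/eqP => -[e].
  by have := ltn_ord a; move: e; clear; lia.
rewrite nu_TL_right; case: (d (inr a)) => [b|b] //; apply/eqP => -[e].
by have := ltn_ord b; move: e; clear; lia.
Qed.

Definition right_through : {set 'I_n} := [set b | if d (inr b) is inl _ then true else false].

Lemma through_left a : (lshift n a \in through nu) = (a \in through d).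
Proof. by rewrite !inE nu_TL_left; case: (d (inl a)). Qed.

Lemma through_right b : (rshift n b \in through nu) = (b \in right_through).
Proof. by rewrite !inE nu_TL_right; case: (d (inr b)). Qed.

Let up b : 'I_n := row_of (d (inr b)).
Let down a : 'I_n := row_of (d (inl a)).

Lemma downP a : a \in through d -> d (inl a) = inr (down a).
Proof. by rewrite inE /down; case: (d (inl a)). Qed.

Lemma upP b : b \in right_through -> d (inr b) = inl (up b).
Proof. by rewrite inE /up; case: (d (inr b)). Qed.

Lemma outP a : a \notin through d -> d (inl a) = inl (down a).
Proof. by rewrite inE /down; case: (d (inl a)). Qed.

Lemma out_rightP b : b \notin right_through -> d (inr b) = inr (up b).
Proof. by rewrite inE /up; case: (d (inr b)). Qed.

Lemma downK a : a \in through d -> down a \in right_through /\ up (down a) = a.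
Proof.
move=> at_; have e : d (inr (down a)) = inl a by rewrite -downP // TL_involutive.
by rewrite inE /up e.
Qed.

Lemma upK b : b \in right_through -> up b \in through d /\ down (up b) = b.
Proof.
move=> bt; have e : d (inl (up b)) = inr b by rewrite -upP // TL_involutive.
by rewrite inE /down e.
Qed.

Lemma right_throughE : right_through = down @: through d.
Proof.
apply/setP => b; apply/idP/imsetP => [bt|[a at_ ->]]; last by have [] := downK at_.
by have [ut e] := upK bt; exists (up b).
Qed.

Lemma down_inj : {in through d &, injective down}.
Proof.
by move=> a b /downK[_ ea] /downK[_ eb] e; rewrite -ea e eb.
Qed.

Lemma card_right_through : #|right_through| = #|through d|.
Proof. by rewrite right_throughE card_in_imset //; apply: down_inj. Qed.

Lemma down_mono a b : a \in through d -> b \in through d -> (a < b)%N -> (down a < down b)%N.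
Proof.
move=> at_ bt ab; rewrite ltnNge leq_eqVlt; apply/negP => /orP[/eqP/val_inj/(down_inj bt at_) e|ba].
  by rewrite e ltnn in ab.
have := @noncrossingP n d (inl a) (inl b) TL_noncrossing.
rewrite !downP // label_left label_left_right label_right; exact.
Qed.

Lemma up_mono a b : a \in right_through -> b \in right_through -> (a < b)%N -> (up a < up b)%N.
Proof.
move=> /upK[uat ea] /upK[ubt eb]; rewrite -{1}ea -{1}eb => ab.
rewrite ltnNge leq_eqVlt; apply/negP => /orP[/eqP/val_inj e|ba].
  by rewrite e ltnn in ab.
by have := down_mono ubt uat ba; rewrite ltnNge ltnW.
Qed.

(** The edge from [a] to [down a] separates the [a + down a] points above it from the rest, so these
    are matched among themselves. *)
Lemma odd_down a : a \in through d -> odd (down a) = odd a.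
Proof.
move=> at_; pose b := down a.
pose S := [set p : point n | (label p < label (inl a : point n))%N || (label (inr b : point n) < label p)%N].
have lab p q : label p = label q -> p = q.
  case: p q => i [] j e.
  - by congr inl; apply: val_inj; move: e => /= [].
  - by have := label_left_right i j; rewrite e ltnn.
  - by have := label_left_right j i; rewrite e ltnn.
  - by congr inr; apply: val_inj; have := ltn_ord i; have := ltn_ord j; move: e => /=; lia.
have ev : ~~ odd #|S|.
  apply: (@even_card_involution _ d) => p; rewrite inE => pS.
  rewrite TL_involutive TL_neq; split=> //.
  have pa : p != inl a by apply: contraTneq pS => ->; rewrite ltnn label_right_left.
  have pb : p != inr b by apply: contraTneq pS => ->; rewrite ltnn label_right_left.
  have dpa : d p != inl a by rewrite (can2_eq TL_involutive TL_involutive) downP.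
  have dpb : d p != inr b by rewrite (can2_eq TL_involutive TL_involutive) -downP // TL_involutive.
  rewrite inE; apply: contraT; rewrite negb_or -!leqNgt => /andP[ap pb'].
  have {}ap : (label (inl a : point n) < label (d p))%N.
    rewrite ltn_neqAle ap andbT; apply: contra dpa => /eqP e.
    by rewrite (lab _ _ e).
  have {}pb' : (label (d p) < label (inr b : point n))%N.
    rewrite ltn_neqAle pb' andbT; apply: contra dpb => /eqP e.
    by rewrite (lab _ _ e).
  case/orP: pS => pS.
    have := @noncrossingP n d p (inl a) TL_noncrossing pS ap.
    by rewrite downP // -/b => /(_ pb').
  have := @noncrossingP n d (inl a) (d p) TL_noncrossing ap.
  by rewrite downP // -/b TL_involutive => /(_ pb' pS).
have cS : #|S| = (a + b)%N.
  rewrite -sum1_card big_mkcond big_sumType /=; congr addn.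
    rewrite -[RHS](card_ltn a) -sum1_card [RHS]big_mkcond; apply: eq_bigr => i _.
    by rewrite !in_set label_right_left orbF label_left.
  rewrite -[RHS](card_ltn b) -sum1_card [RHS]big_mkcond; apply: eq_bigr => i _.
  by rewrite !in_set label_right_left label_right.
by move: ev; rewrite cS oddD -/b; case: (odd a); case: (odd b).
Qed.

Lemma card_left_edges : n = (#|through d| + #|left_edges d|.*2)%N.
Proof.
pose A := [set a | (a \notin through d) && (a < down a)%N].
have ddown a : a \notin through d -> down a \notin through d /\ down (down a) = a.
  move=> na; have e : d (inl (down a)) = inl a by rewrite -outP // TL_involutive.
  by rewrite inE {2}/down e.
have cA : #|left_edges d| = #|A|.
  pose g a : 'I_n * 'I_n := (a, down a).
  have g_inj : injective g by move=> a b [].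
  rewrite -(card_imset (mem A) g_inj); apply: eq_card => -[a b].
  rewrite inE /=; apply/andP/imsetP => [[/eqP e ab]|[a' a'A [-> ->]]].
    have eb : down a = b by rewrite /down e.
    by exists a; [rewrite /= in_set eb ab andbT in_set e|rewrite /g eb].
  by move: a'A; rewrite in_set => /andP[/outP-> ->].
pose B := [set a | (a \notin through d) && (down a < a)%N].
have cB : #|A| = #|B|.
  rewrite -(@card_in_imset _ _ down (mem A)).
    apply: eq_card => a; rewrite in_set; apply/imsetP/andP => [[b]|[na lt]].
      by rewrite in_set => /andP[nb lt] ->; have [-> ->] := ddown b nb.
    by have [nd e] := ddown a na; exists (down a); [rewrite /= in_set nd e|rewrite e].
  have mA a : (a \in A) = (a \notin through d) && (a < down a)%N by rewrite in_set.
  move=> a b; rewrite /= !mA => /andP[/ddown[_ ea] _] /andP[/ddown[_ eb] _] e.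
  by rewrite -ea e eb.
have cS (S : {set 'I_n}) : #|S| = (\sum_a (a \in S))%N.
  by rewrite -sum1_card big_mkcond; apply: eq_bigr => a _; case: ifP.
rewrite cA -addnn {2}cB !cS -!big_split /=.
transitivity (\sum_(a < n) 1)%N; first by rewrite sum1_card card_ord.
apply: eq_bigr => a _.
have -> : (a \in A) = (a \notin through d) && (a < down a)%N by rewrite in_set.
have -> : (a \in B) = (a \notin through d) && (down a < a)%N by rewrite in_set.
have [at_|na] := boolP (a \in through d) => //=.
have := TL_neq (inl a); rewrite outP // => ne.
have ne' : (down a : nat) != a by apply: contraNneq ne => /val_inj->.
by case: ltngtP ne'.
Qed.

Lemma card_through_nu : #|through nu| = #|through d|.*2.
Proof.
rewrite -addnn -{2}card_right_through -!sum1_card big_mkcond big_split_ord /=; congr addn.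
  by rewrite [RHS]big_mkcond; apply: eq_bigr => a _; rewrite through_left.
by rewrite [RHS]big_mkcond; apply: eq_bigr => a _; rewrite through_right.
Qed.

Lemma partner_left a : a \in through d -> row_of (nu (inl (lshift n a))) = rshift n (down a).
Proof. by move=> at_; rewrite nu_TL_left downP. Qed.

Lemma partner_right b : b \in right_through -> row_of (nu (inl (rshift n b))) = lshift n (up b).
Proof. by move=> bt; rewrite nu_TL_right upP. Qed.

(** Edges of [d] do not cross each other, nor do their mirror images, while each of the [k] edges
    joining the sides crosses each of the [k] mirror images; and [k * k = k + 2 'C(k, 2)]. *)
Lemma card_nu_inversions (T := through nu) (k := #|through d|) :
  #|[set ij : 'I_(n + n) * 'I_(n + n) | [&& ij.1 \in T, ij.2 \in T, (ij.1 < ij.2)%N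
      & (row_of (nu (inl ij.2)) < row_of (nu (inl ij.1)))%N]]| = (k + 'C(k, 2).*2)%N.
Proof.
rewrite -bin2_double {1}/k -card_right_through /k.
pose g (ab : 'I_n * 'I_n) := (lshift n ab.1, rshift n ab.2).
have g_inj : injective g by case=> a b [c e] [/val_inj-> /eqP]; rewrite eqn_add2l => /eqP/val_inj->.
rewrite mulnC -cardsX -(card_imset _ g_inj); apply: eq_card => -[i j].
rewrite in_set /=; apply/idP/imsetP => [|[[a b]]]; last first.
  rewrite in_setX /= => /andP[at_ bt] [-> ->].
  rewrite /T through_left through_right at_ bt partner_left // partner_right //=.
  by rewrite !(ltn_addr _ (ltn_ord _)).
move: i j; apply: split_ind => a; apply: split_ind => b; rewrite /T ?through_left ?through_right.
- case/and4P=> at_ bt /= ab; rewrite !partner_left //= ltn_add2l.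
  by have := down_mono at_ bt ab; lia.
- by case/and4P=> at_ bt _ _; exists (a, b); rewrite // in_setX at_.
- by case/and4P=> _ _ /=; have := ltn_ord b; lia.
- case/and4P=> at_ bt /=; rewrite ltn_add2l => ab; rewrite !partner_right //=.
  by have := up_mono at_ bt ab; lia.
Qed.

(** An edge of [nu(d)] from row [a] to row [n + b] has [a] and [b] of equal parity, so its twisted
    colours agree exactly when the plain colours agree up to [odd n]. Including this correction
    leaves plain constancy on the edges of [d]. *)
Definition boundary_of (s : 'I_(n + n) -> bool) (p : point n) : bool :=
  match p with inl a => s (lshift n a) | inr b => s (rshift n b) (+) odd n end.

Lemma nu_agrees (s : 'I_(n + n) -> bool) :
  outer_agrees nu s && [forall i in through nu,
    s (row_of (nu (inl i))) (+) odd (row_of (nu (inl i))) == s i (+) odd i]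
  = [forall p, boundary_of s (d p) == boundary_of s p].
Proof.
have thr a : a \in through d ->
   (s (rshift n (down a)) (+) odd (rshift n (down a)) == s (lshift n a) (+) odd (lshift n a)) =
   (boundary_of s (inr (down a)) == boundary_of s (inl a)).
  move=> at_; rewrite /= oddD odd_down //.
  by case: (s _); case: (s _); case: (odd n); case: (odd a).
apply/andP/forallP => [[/forallP so /forall_inP st] [a|b]|h].
- have [at_|na] := boolP (a \in through d).
    by rewrite downP // -thr //; have := st (lshift n a); rewrite through_left partner_left //; apply.
  by have := so (lshift n a); rewrite through_left na nu_TL_left outP.
- have [bt|nb] := boolP (b \in right_through).
    have [ut e] := upK bt; rewrite upP // eq_sym -{1}e -thr // e eq_sym.
    by have := st (rshift n b); rewrite through_right partner_right //; apply.
  by have := so (rshift n b); rewrite through_right nb nu_TL_right out_rightP //= => /eqP->.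
split.
  apply/forallP; apply: split_ind => a; apply/implyP; rewrite ?through_left ?through_right => na.
    by have := h (inl a); rewrite nu_TL_left outP.
  have := h (inr a); rewrite nu_TL_right out_rightP //=.
  by case: (s _); case: (s _); case: (odd n).
apply/forall_inP; apply: split_ind => a; rewrite ?through_left ?through_right => at_.
  by rewrite partner_left // thr // -downP.
have [ut e] := upK at_; rewrite partner_right // -{3 4}e eq_sym thr // -downP //.
Qed.

(** The left-hand side collects all of the sign that depends on [d] apart from ['C(k, 2)], which
    occurs twice; the right-hand side does not involve [d]. *)
Lemma odd_sum_through (s : 'I_(n + n) -> bool) :
  (forall p, boundary_of s (d p) = boundary_of s p) ->
  odd (#|left_edges d| * n) (+) odd 'C(\sum_(i in through nu) s i, 2) =
  if odd n then odd 'C(n, 2) else odd (\sum_a s (lshift n a)).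
Proof.
move=> h.
have -> : (\sum_(i in through nu) s i =
    \sum_(a in through d) (s (lshift n a) + (s (lshift n a) (+) odd n)))%N.
  rewrite big_mkcond big_split_ord big_split /=; congr addn.
    by rewrite [RHS]big_mkcond; apply: eq_bigr => a _; rewrite through_left.
  rewrite (eq_bigr (fun b => if b \in right_through then nat_of_bool (s (rshift n b)) else 0%N)); last first.
    by move=> b _; rewrite through_right.
  rewrite -big_mkcond right_throughE big_imset /=; last exact: down_inj.
  apply: eq_bigr => a at_; have := h (inl a); rewrite downP //= => <-.
  by rewrite -addbA addbb addbF.
have nE := card_left_edges; rewrite oddM; case: ifP => on.
  (* For odd [n] each edge joining the sides has exactly one end of colour 1 under [s], so the sum
     is the number of these edges. *)
  rewrite (eq_bigr (fun=> 1%N)); last by move=> a _; case: (s _).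
  rewrite sum1_card (congr1 (fun k => odd 'C(k, 2)) nE) odd_bin2D odd_bin2_double odd_double !andbF andbT addbF.
  by rewrite addbC.
(* For even [n] both ends have the same colour, and ['C(2u, 2)] has the parity of [u]. *)
rewrite andbF addFb (eq_bigr (fun a => (s (lshift n a)).*2)); last first.
  by move=> a _; rewrite addbF addnn.
rewrite -(big_morph double doubleD double0) odd_bin2_double.
rewrite [in RHS](bigID (mem (through d))) /= oddD.
(* The remaining left points are paired by arcs whose two ends have equal colours. *)
suff /negbTE -> : ~~ odd (\sum_(a | a \notin through d) s (lshift n a)) by rewrite addbF.
have -> : (\sum_(a | a \notin through d) s (lshift n a) = #|[set a | (a \notin through d) && s (lshift n a)]|)%N.
  rewrite -sum1_card big_mkcond [RHS]big_mkcond; apply: eq_bigr => a _.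
  by rewrite in_set; case: (a \notin _); case: (s _).
have mS c : (c \in [set a | (a \notin through d) && s (lshift n a)]) =
    (c \notin through d) && s (lshift n c) by rewrite in_set.
apply: (@even_card_involution _ down) => a; rewrite !mS => /andP[na sa].
have e : d (inl (down a)) = inl a by rewrite -outP // TL_involutive.
split.
- by have := h (inl a); rewrite outP //= => ->; rewrite sa andbT in_set e.
- by have := TL_neq (inl a); rewrite outP //; apply: contraNneq => ->.
- by rewrite {1}/down e.
Qed.

Lemma nu_TL_state_sum (W : embedding nu) (s : 'I_(n + n) -> bool) : nice_embedding W ->
  \sum_(D in symTL (n + n)) (-1) ^+ (#|left_edges d| * n) * coef W D * (agrees D s)%:R =
  (-1) ^+ (if odd n then 'C(n, 2) else (\sum_a s (lshift n a))%N) *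
  [forall p, boundary_of s (d p) == boundary_of s p]%:R :> int.
Proof.
move=> nice; have := coef_state_sum nice nu_TL_matching nu_TL_mirror nu_TL_planar nu_TL_free s
  card_through_nu card_nu_inversions.
rewrite nu_agrees => e.
transitivity ((-1) ^+ (#|left_edges d| * n) *
    \sum_(D in symTL (n + n)) coef W D * (agrees D s)%:R : int).
  by rewrite mulr_sumr; apply: eq_bigr => D _; rewrite mulrA.
rewrite e mulrA -exprD.
case: (boolP [forall p, _]) => [/forallP h|_]; last by rewrite !mulr0.
rewrite !mulr1; apply: sign_parity.
rewrite [RHS]fun_if -(odd_sum_through (fun p => eqP (h p))) !oddD; congr addb.
by case: (odd 'C(#|through d|, 2)); case: (odd _).
Qed.

End TLMatching.

(** * Comparison of the two state sums *)

(** The final parity count: [U] and [V] are the numbers of rows of colour 1 among the first and the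
    last [n], and [V'] is [V] after the correction by [odd n]. *)
Lemma odd_bin2_shift n U V V' : (odd n -> V' + V = n)%N -> (~~ odd n -> V' = V) -> odd U = odd V' ->
  odd 'C(U + V, 2) = odd (if odd n then 'C(n, 2) else U) (+) odd 'C(U, 2) (+) odd 'C(V', 2).
Proof.
rewrite odd_bin2D; case: (odd n) => [/(_ isT) <- _|_ /(_ isT) ->] oU.
  rewrite odd_bin2D -oU.
  by case: (odd 'C(V', 2)); case: (odd 'C(V, 2)); case: (odd 'C(U, 2)); case: (odd U); case: (odd V).
rewrite -oU andbb; by case: (odd 'C(V, 2)); case: (odd 'C(U, 2)); case: (odd U).
Qed.

Lemma bipartite_coef (n : nat) (w : 'S_n) (W : embedding (nu_matching (perm_matching w)))
    (U : wiring n) (G : forall d : diagram n, embedding (nu_TL d)) (D : diagram (n + n)) :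
  nice_embedding W -> is_wiring_of w U ->
  (forall d, d \in TL n -> nice_embedding (G d)) -> D \in symTL (n + n) ->
  coef W D = \sum_(d in TL n) g_tilde G D d * f_TL U d.
Proof.
move=> niceW /andP[pU /eqP wU] niceG DT; apply/eqP; rewrite -subr_eq0; apply/eqP.
move: D DT; apply: agrees_independent => s.
under eq_bigr => D _ do rewrite mulrBl.
rewrite sumrB perm_matching_state_sum //; apply/eqP; rewrite subr_eq0; apply/eqP.
pose u a := s (lshift n a); pose v a := s (rshift n a) (+) odd n.
pose e := if odd n then 'C(n, 2) else (\sum_a u a)%N.
(* The sign [e] is common to all [d], so it can be taken out of the sum. *)
transitivity ((-1) ^+ e * \sum_(d in TL n) f_TL U d *
    [forall p, boundary_of s (d p) == boundary_of s p]%:R : int); last first.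
  rewrite mulr_sumr.
  under [RHS]eq_bigr => D _ do rewrite mulr_suml.
  rewrite [RHS]exchange_big; apply: eq_bigr => d dT.
  rewrite mulrCA -(nu_TL_state_sum dT s (niceG d dT)) mulr_sumr; apply: eq_bigr => D _.
  by rewrite /g_tilde mulrCA mulrA mulrC mulrA.
(* Grouping the uncrossings of [U] by the diagram they produce turns the sum over [d] into a plain
   state sum with boundary colours [boundary_of s]. *)
have -> : \sum_(d in TL n) f_TL U d * [forall p, boundary_of s (d p) == boundary_of s p]%:R =
    \sum_(x in uncrossings U) wt x *
      [forall p, boundary_of s (resolve x p) == boundary_of s p]%:R :> int.
  rewrite (partition_big (fun x : {set crossing U} => resolve x) (mem (TL n))) /=; last first.
    by move=> x; rewrite inE => xU; apply: resolve_TL.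
  apply: eq_bigr => d _; rewrite /f_TL mulr_suml.
  by apply: eq_bigr => x /andP[_ /eqP->].
rewrite (state_sum pU) wU mulrA -exprD.
have -> : [forall a, s (rshift n (w a)) (+) odd (n + w a) == s (lshift n a) (+) odd a] =
    [forall a, boundary_of s (inr (w a)) (+) odd (w a) == boundary_of s (inl a) (+) odd a].
  by apply: eq_forallb => a; rewrite /= oddD addbA.
case: (boolP [forall a, _]) => [/forallP h|_]; last by rewrite !mulr0.
rewrite !mulr1; apply: sign_parity.
(* The conditions along the wires are summed over all [a]; the parities of [a] and of [w a] have the
   same total because [w] is a permutation. *)
have oUV : odd (\sum_a u a) = odd (\sum_a v a).
  have : odd (\sum_a u a) (+) odd (\sum_(a < n) odd a) = odd (\sum_a v a) (+) odd (\sum_(a < n) odd a).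
    rewrite [in RHS](reindex_inj (@perm_inj _ w)) /= [X in _ = _ (+) odd X](reindex_inj (@perm_inj _ w)) /=.
    rewrite !(big_morph odd oddD (erefl (odd 0))) -!big_split /=; apply: eq_bigr => a _.
    by have /eqP := h a; rewrite /= /u /v !oddb => ->.
  by move/addIb.
rewrite !oddD (odd_card_crossings pU) wU /=.
rewrite (@odd_bin2_shift n _ _ _ _ _ oUV).
- by rewrite -/e -!addbA addbCA.
- move=> on; rewrite -big_split /= -[RHS]card_ord -sum1_card; apply: eq_bigr => a _.
  by rewrite /v on; case: (s _).
- by move=> on; apply: eq_bigr => a _; rewrite /v (negbTE on) addbF.
Qed.

(** * Reduction of the pfaffinant to matchings given by permutations *)

Section BipartitePfaffinant.
Variables (n : nat) (R : comNzRingType) (A : 'M[R]_(n + n)).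
Hypothesis A0 : forall i j : 'I_(n + n), (i < j)%N -> (j < n)%N || (n <= i)%N -> A i j = 0.

Lemma perm_matching_prod (w : 'S_n) :
  \prod_(i < n + n | (i < perm_matching w i)%N) A i (perm_matching w i) =
  \prod_(a < n) A (lshift n a) (rshift n (w a)).
Proof.
rewrite big_mkcond big_split_ord /= [X in _ * X]big1 ?mulr1 => [|a _].
  by apply: eq_bigr => a _; rewrite perm_matching_left /= ltn_addr.
by rewrite perm_matching_right /= ltnNge ltnW // ltn_addr.
Qed.

Lemma perm_matching_ex (pi : {ffun 'I_(n + n) -> 'I_(n + n)}) : is_matching pi ->
  (forall a : 'I_n, (n <= pi (lshift n a))%N) -> exists w : 'S_n, perm_matching w == pi.
Proof.
move=> /forallP pm cross.
have piK : involutive pi by move=> i; have /andP[_ /eqP] := pm i.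
pose f (a : 'I_n) : 'I_n := match split (pi (lshift n a)) with inl b => b | inr b => b end.
have fE a : pi (lshift n a) = rshift n (f a).
  rewrite /f; move: (cross a); rewrite -{1 2}(splitK (pi _)); case: (split _) => //= b.
  by rewrite leqNgt ltn_ord.
have f_inj : injective f.
  by move=> a b e; apply: (@lshift_inj n n); rewrite -[LHS]piK -[RHS]piK !fE e.
exists (perm f_inj); apply/eqP/ffunP; apply: split_ind => a.
  by rewrite perm_matching_left permE fE.
rewrite perm_matching_right.
have [b <-] : exists b, perm f_inj b = a by exists ((perm f_inj)^-1%g a); rewrite permKV.
by rewrite permK permE -fE piK.
Qed.

Lemma diag_Pfaf_bipartite (E : forall pi : {ffun 'I_(n + n) -> 'I_(n + n)}, embedding (nu_matching pi))
    (D : diagram (n + n)) :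
  diag_Pfaf E D A =
  \sum_(w : 'S_n) (coef (E (perm_matching w)) D)%:~R *
     \prod_(a < n) A (lshift n a) (rshift n (w a)).
Proof.
pose cross (pi : {ffun 'I_(n + n) -> 'I_(n + n)}) := [forall a : 'I_n, (n <= pi (lshift n a))%N].
rewrite /diag_Pfaf (bigID cross) /= [X in _ + X]big1 ?addr0; last first.
  move=> pi /andP[/forallP pm /forallPn[a]]; rewrite -ltnNge => pa.
  (* Some edge stays within the first [n] rows; taken from its smaller end [i], it contributes a
     zero entry of [A]. *)
  have [i [ip pn]] : exists i : 'I_(n + n), (i < pi i)%N /\ (pi i < n)%N.
    have /andP[pne /eqP piK] := pm (lshift n a).
    have [lt|lt|/val_inj e] := ltngtP (lshift n a) (pi (lshift n a)).
    - by exists (lshift n a).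
    - by exists (pi (lshift n a)); rewrite piK; split; last exact: ltn_ord a.
    - by rewrite -e eqxx in pne.
  by rewrite (bigD1 i) //= A0 ?pn // mul0r mulr0.
(* The default [1] is never reached: by [perm_matching_ex] every remaining matching comes from a
   permutation. *)
pose unperm (pi : {ffun 'I_(n + n) -> 'I_(n + n)}) : 'S_n :=
  odflt 1%g [pick w | perm_matching w == pi].
rewrite (reindex_onto (@perm_matching n) unperm) /=; last first.
  move=> pi /andP[pm /forallP pc]; rewrite /unperm; case: pickP => [w /eqP //|none].
  by have [w] := perm_matching_ex pm pc; rewrite none.
apply: eq_big => [w|w _]; last by rewrite perm_matching_prod.
rewrite perm_matchingP /unperm /=; apply/andP; split.
  by apply/forallP => a; rewrite perm_matching_left leq_addr.
case: pickP => [w' /eqP/perm_matching_inj->|/(_ w)] //=.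
by rewrite eqxx.
Qed.

End BipartitePfaffinant.

Theorem theorem40 (n : nat) (hn : (1 <= n)%N) (R : comNzRingType)
  (E : forall pi : {ffun 'I_(n + n) -> 'I_(n + n)}, embedding (nu_matching pi))
  (hE : forall pi : {ffun 'I_(n + n) -> 'I_(n + n)},
      is_matching pi -> nice_embedding (E pi))
  (V : 'S_n -> wiring n)
  (hV : forall w : 'S_n, is_wiring_of w (V w))
  (G : forall d : diagram n, embedding (nu_TL d))
  (hG : forall d : diagram n, d \in TL n -> nice_embedding (G d))
  (A : 'M[R]_(n + n))
  (hA : forall i j : 'I_(n + n), (i < j)%N -> (j < n)%N || (n <= i)%N ->
      A i j = 0)
  (D : diagram (n + n)) (hD : D \in symTL_even (n + n)) :
  Pfaf E D A =
    \sum_(D' in S_of D) \sum_(d in TL n)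
       (g_tilde G D' d)%:~R *
       Imm V d (\matrix_(i < n, j < n) A (lshift n i) (rshift n j)).
Proof.
(* Both sides are sums over [S_of D] and agree term by term. *)
apply: eq_bigr => D' /[!inE] /andP[D'T _].
have {}D'T : D' \in symTL (n + n) by rewrite !inE.
rewrite (diag_Pfaf_bipartite hA) /Imm.
under [RHS]eq_bigr => d _ do rewrite mulr_sumr.
rewrite [RHS]exchange_big; apply: eq_bigr => w _.
rewrite (bipartite_coef (hE _ (perm_matchingP w)) (hV w) hG D'T) rmorph_sum mulr_suml.
apply: eq_bigr => d _; rewrite rmorphM mulrA; congr (_ * _).
by apply: eq_bigr => i _; rewrite mxE.
Qed.
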